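(* Let $\mathbf{G}_0$ be a connected semisimple linear algebraic group defined over $\mathbb{Q}$, $G_0=\mathbf{G}_0(\mathbb{R})$, let $\rho:\mathbf{G}_0\to\mathbf{GL}(V)$ be a representation defined over $\mathbb{Q}$ on $V=\mathbb{R}^d$ (with $\mathbb{Z}$-structure $\mathbb{Z}^d$), and let $\Gamma_0$, $G=G_0\ltimes_\rho V$, $\Gamma=\Gamma_0\ltimes_\rho\mathbb{Z}^d$ and the measure $\lambda$ on $G/\Gamma$ be as described in the context. Assume that $a\in G_0$ is triangularizable with positive eigenvalues, that $\mu$ is an $a$-invariant, non-concentrated, ergodic probability measure on $G_0/\Gamma_0$, and that $\rho$ is irreducible over $\mathbb{Q}$, of dimension $>1$. Let $\alpha\in V$. Then the action by left multiplication by $(a,\alpha)$ on $G/\Gamma$ is ergodic with respect to the invariant measure $\lambda$. If we assume moreover that $\rho(a)$ is not unipotent, then the action of $(a,\alpha)$ on $(G/\Gamma,\lambda)$ is weakly mixing if and only if the action of $a$ on $(G_0/\Gamma_0,\mu)$ is weakly mixing; and likewise the action of $(a,\alpha)$ on $(G/\Gamma,\lambda)$ is strongly mixing if and only if the action of $a$ on $(G_0/\Gamma_0,\mu)$ is strongly mixing.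
   Context: Setting. $\Gamma_0=\mathbf{G}_0(\mathbb{Z})$, replaced if necessary by a finite-index subgroup so that $\rho(\Gamma_0)\subset \mathbf{GL}(d,\mathbb{Z})$; it is a lattice in $G_0$. $a$ acts on $G_0/\Gamma_0$ by left multiplication. $G=G_0\ltimes_\rho V$ has group law $(g,v)(h,w)=(gh,v+\rho(g)w)$, and $\Gamma=\Gamma_0\ltimes_\rho\mathbb{Z}^d$ is a subgroup of $G$. The projection $\pi:G/\Gamma\to G_0/\Gamma_0$ is a torus bundle whose fiber over $x\Gamma_0$ is the torus $\mathbb{R}^d/\rho(x)\mathbb{Z}^d$. $\lambda$ is the probability measure on $G/\Gamma$ with $\pi_*\lambda=\mu$ whose disintegration along the fibers of $\pi$ consists of the Haar probability measures of the fiber tori. Definitions. An element $a\in G_0-\{e\}$ is triangularizable with positive eigenvalues if for every finite-dimensional representation $\sigma$ of $\mathbf{G}_0$ defined over $\mathbb{Q}$, $\sigma(a)$ has only real, positive eigenvalues. An $a$-invariant ergodic probability measure $\mu$ on $G_0/\Gamma_0$ is non-concentrated if for every closed algebraic strict subgroup $H\subsetneq G_0$ containing $a$ and every $x\in G_0$ such that $Hx\Gamma_0$ is closed, one has $\mu(Hx\Gamma_0)<1$. $\rho$ is irreducible over $\mathbb{Q}$ if the only $\rho(\mathbf{G}_0)$-invariant subspaces of $V$ defined over $\mathbb{Q}$ are $\{0\}$ and $V$. *)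

(* Defs.v *)
From HB Require Import structures.
From mathcomp Require Import all_boot all_order all_algebra.
From mathcomp Require Import all_classical all_reals all_analysis.
(* The notations of multinomials clash with those of MathComp-Analysis, so
   polynomials in k variables over F are written [mpoly k F]. *)
From mathcomp Require Import -(notations) mpoly.
From mathcomp Require Import complex.

Set Implicit Arguments.
Unset Strict Implicit.
Unset Printing Implicit Defensive.

Import Order.TTheory GRing.Theory Num.Theory.
Import numFieldNormedType.Exports.

Local Open Scope classical_set_scope.
Local Open Scope ring_scope.

#[short(type="preTopologicalGroupType")]
HB.structure Definition PreTopologicalGroup :=
  {G of Group G & PointedTopological G}.

Section abstract_groups.
Variable T : groupType.
Implicit Types H A : set T.
Local Open Scope group_scope.

Definition is_subgroup H :=
  H 1 /\ forall x y, H x -> H y -> H (x^-1 * y).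

Definition is_normal H := forall g h, H h -> H (h ^ g).

Definition derived H : set T :=
  smallest is_subgroup [set z | exists x y, [/\ H x, H y & z = [~ x, y]]].

Definition is_solvable H := exists k, iter k derived H = [set 1].

Definition lcoset_set H (x : T) : set T := [set x * h | h in H].

End abstract_groups.

Record matgrp (F : fieldType) (n : nat) := MatGrp {
  mg_set :> set 'M[F]_n;
  mg_unit : forall A, mg_set A -> A \in unitmx;
  mg_one : mg_set 1%:M;
  mg_mul : forall A B, mg_set A -> mg_set B -> mg_set (A *m B);
  mg_inv : forall A, mg_set A -> mg_set (invmx A) }.

Definition points (F : fieldType) (n : nat) (P : matgrp F n) : Type :=
  set_type (mg_set P).

Section points_group.
Variables (F : fieldType) (n : nat) (P : matgrp F n).

HB.instance Definition _ := SubChoice.copy (points P) (set_type (mg_set P)).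

Definition pt_make (A : 'M[F]_n) (PA : mg_set P A) : points P :=
  exist _ A (mem_set PA).

Lemma pt_in (x : points P) : mg_set P (val x).
Proof. exact: set_valP. Qed.

Definition pt_one : points P := pt_make (mg_one P).
Definition pt_mul (x y : points P) : points P :=
  pt_make (mg_mul (pt_in x) (pt_in y)).
Definition pt_inv (x : points P) : points P := pt_make (mg_inv (pt_in x)).

Lemma pt_mulA : associative pt_mul.
Proof. by move=> x y z; apply: val_inj; rewrite /= mulmxA. Qed.
Lemma pt_mul1 : left_id pt_one pt_mul.
Proof. by move=> x; apply: val_inj; rewrite /= mul1mx. Qed.
Lemma pt_mulr1 : right_id pt_one pt_mul.
Proof. by move=> x; apply: val_inj; rewrite /= mulmx1. Qed.
Lemma pt_mulV : left_inverse pt_one pt_inv pt_mul.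
Proof.
by move=> x; apply: val_inj; rewrite /= mulVmx //; exact/(@mg_unit _ _ P)/pt_in.
Qed.
Lemma pt_mulrV : right_inverse pt_one pt_inv pt_mul.
Proof.
by move=> x; apply: val_inj; rewrite /= mulmxV //; exact/(@mg_unit _ _ P)/pt_in.
Qed.

HB.instance Definition _ := isGroup.Build (points P)
  pt_mulA pt_mul1 pt_mulr1 pt_mulV pt_mulrV.
HB.instance Definition _ := isPointed.Build (points P) pt_one.

End points_group.

HB.instance Definition _ (R : realType) (n : nat) (P : matgrp R n) :=
  Topological.copy (points P) (set_type (mg_set P)).

(* The coordinates of GL_n as an affine variety: the n * n entries, followed
   by the inverse of the determinant. *)
Definition gl_coord (F : fieldType) (n : nat) (A : 'M[F]_n)
  : 'I_(n * n + 1) -> F :=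
  fun i => row_mx (mxvec A) (\det A)^-1%:M ord0 i.

Definition rat_eval (F : fieldType) (n : nat) (p : mpoly (n * n + 1) rat)
  (A : 'M[F]_n) : F := mmap ratr (gl_coord A) p.

Section zariski.
Variables (F : fieldType) (n : nat) (P : matgrp F n).

Definition zariski_closed (Z : set (points P)) :=
  exists S : set (mpoly (n * n + 1) F),
    Z = [set g | forall p, S p -> meval (gl_coord (val g)) p = 0].

Definition zariski_connected (Z : set (points P)) :=
  forall X Y : set (points P), zariski_closed X -> zariski_closed Y ->
    Z `<=` X `|` Y -> Z `&` (X `&` Y) = set0 -> Z `<=` X \/ Z `<=` Y.

End zariski.

Definition zero_locus (F : fieldType) (n : nat)
    (S : set (mpoly (n * n + 1) rat)) : set 'M[F]_n :=
  [set A | A \in unitmx /\ forall p, S p -> rat_eval p A = 0].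
Arguments zero_locus F {n} S.

(* A linear algebraic group defined over Q, as a subgroup of GL_n cut out by
   polynomials with rational coefficients; R[i] is the algebraically closed
   field over which geometric properties are expressed. *)
Record alg_group (R : realType) (n : nat) := AlgGroup {
  ag_eqs : set (mpoly (n * n + 1) rat);
  ag_one : zero_locus R[i] ag_eqs 1%:M;
  ag_mul : forall A B, zero_locus R[i] ag_eqs A -> zero_locus R[i] ag_eqs B ->
    zero_locus R[i] ag_eqs (A *m B);
  ag_inv : forall A, zero_locus R[i] ag_eqs A ->
    zero_locus R[i] ag_eqs (invmx A) }.

Section base_change.
Variables (R : realType) (n : nat).
Local Notation toC := (real_complex R).

Lemma gl_coord_toC (A : 'M[R]_n) i :
  gl_coord (map_mx toC A) i = toC (gl_coord A i).
Proof.
rewrite /gl_coord -map_mxvec det_map_mx -fmorphV -map_scalar_mx -map_row_mx.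
by rewrite mxE.
Qed.

Lemma rat_eval_toC (p : mpoly (n * n + 1) rat) (A : 'M[R]_n) :
  rat_eval p (map_mx toC A) = toC (rat_eval p A).
Proof.
rewrite /rat_eval /mmap rmorph_sum; apply: eq_bigr => m _ /=.
rewrite rmorphM /= fmorph_rat; congr (_ * _).
rewrite /mmap1 rmorph_prod; apply: eq_bigr => i _.
by rewrite gl_coord_toC rmorphXn.
Qed.

Lemma zero_locus_toC (S : set (mpoly (n * n + 1) rat)) (A : 'M[R]_n) :
  zero_locus R[i] S (map_mx toC A) <-> zero_locus R S A.
Proof.
split=> -[uA SA]; (split; first by move: uA; rewrite map_unitmx) => p Sp.
  by apply: complexI; rewrite -rat_eval_toC SA // rmorph0.
by rewrite rat_eval_toC SA // rmorph0.
Qed.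

End base_change.

Section alg_group_points.
Variables (R : realType) (n : nat) (G : alg_group R n).

Definition complex_grp : matgrp R[i] n :=
  @MatGrp _ _ (zero_locus R[i] (ag_eqs G)) (fun A => @proj1 _ _)
    (ag_one G) (@ag_mul _ _ G) (@ag_inv _ _ G).

Lemma real_one : zero_locus R (ag_eqs G) 1%:M.
Proof. by apply/zero_locus_toC; rewrite map_mx1; exact: ag_one. Qed.

Lemma real_mul A B : zero_locus R (ag_eqs G) A -> zero_locus R (ag_eqs G) B ->
  zero_locus R (ag_eqs G) (A *m B).
Proof.
move=> /zero_locus_toC GA /zero_locus_toC GB; apply/zero_locus_toC.
by rewrite map_mxM; exact: (@ag_mul _ _ G _ _ GA GB).
Qed.

Lemma real_inv A : zero_locus R (ag_eqs G) A ->
  zero_locus R (ag_eqs G) (invmx A).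
Proof.
move=> /zero_locus_toC GA; apply/zero_locus_toC.
by rewrite map_invmx; exact: (@ag_inv _ _ G _ GA).
Qed.

Definition real_grp : matgrp R n :=
  @MatGrp _ _ (zero_locus R (ag_eqs G)) (fun A => @proj1 _ _)
    real_one real_mul real_inv.

Definition connected_group := zariski_connected [set: points complex_grp].

(* The radical of G, its largest connected solvable closed normal subgroup, is
   trivial. *)
Definition semisimple_group :=
  forall H : set (points complex_grp),
    is_subgroup H -> is_normal H -> zariski_closed H -> zariski_connected H ->
    is_solvable H -> H = [set 1%g].

End alg_group_points.

(* A representation of G on the d-dimensional space defined over Q: a
   homomorphism G -> GL_d whose matrix entries are regular functions with
   rational coefficients. *)
Record rat_rep (R : realType) (n : nat) (G : alg_group R n) (d : nat) :=
 RatRep {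
  rr_mx : 'M[mpoly (n * n + 1) rat]_d;
  rr_one : map_mx (fun p => rat_eval p (1%:M : 'M[R[i]]_n)) rr_mx = 1%:M;
  rr_mul : forall g h : points (complex_grp G),
    map_mx (fun p => rat_eval p (val (g * h)%g)) rr_mx =
    map_mx (fun p => rat_eval p (val g)) rr_mx *m
    map_mx (fun p => rat_eval p (val h)) rr_mx }.

Section representations.
Variables (R : realType) (n : nat) (G : alg_group R n) (d : nat).
Variable rho : rat_rep G d.

Definition Crep (g : points (complex_grp G)) : 'M[R[i]]_d :=
  map_mx (fun p => rat_eval p (val g)) (rr_mx rho).
Definition Rrep (g : points (real_grp G)) : 'M[R]_d :=
  map_mx (fun p => rat_eval p (val g)) (rr_mx rho).

Definition real_to_complex (g : points (real_grp G)) :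
    points (complex_grp G) :=
  @pt_make _ _ (complex_grp G) (map_mx (real_complex R) (val g))
    (proj2 (zero_locus_toC _ _) (pt_in g)).

Lemma Crep_real g : Crep (real_to_complex g) = map_mx (real_complex R) (Rrep g).
Proof. by apply/matrixP => i j; rewrite !mxE -rat_eval_toC. Qed.

Lemma Rrep1 : Rrep 1%g = 1%:M.
Proof.
apply: (@map_mx_inj _ _ (real_complex R)); rewrite -Crep_real map_mx1.
by rewrite -(rr_one rho) /Crep /= map_mx1.
Qed.

Lemma RrepM g h : Rrep (g * h)%g = Rrep g *m Rrep h.
Proof.
apply: (@map_mx_inj _ _ (real_complex R)); rewrite -Crep_real map_mxM.
rewrite -!Crep_real -rr_mul; congr (Crep _).
by apply: val_inj; rewrite /= map_mxM.
Qed.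

(* Subspaces of the column space V are given by matrices whose rows span
   them, whence the transpose. *)
Definition irreducible_over_rat :=
  forall W : 'M[rat]_d,
    (forall g, stablemx (map_mx ratr W : 'M[R[i]]_d) (Crep g)^T) ->
    \rank W = 0%N \/ \rank W = d.

Definition unipotent (A : 'M[R]_d) := exists k, (A - 1%:M) ^+ k = 0.

End representations.

Definition triang_pos (R : realType) (n : nat) (G : alg_group R n)
    (a : points (real_grp G)) :=
  a <> 1%g /\
  forall (m : nat) (sigma : rat_rep G m) (z : R[i]),
    eigenvalue (Crep sigma (real_to_complex a)) z ->
    exists2 r : R, 0 < r & z = real_complex R r.

Section semidirect_product.
Variables (R : realType) (n : nat) (G : alg_group R n) (d : nat).

Definition semidirect (rho : rat_rep G d) : Type :=
  (points (real_grp G) * 'cV[R]_d)%type.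

Variable rho : rat_rep G d.
Implicit Types x y z : semidirect rho.

HB.instance Definition _ := Topological.copy (semidirect rho)
  (points (real_grp G) * 'cV[R]_d)%type.

Definition sd_one : semidirect rho := (1%g, 0).
Definition sd_mul x y : semidirect rho :=
  ((x.1 * y.1)%g, x.2 + Rrep rho x.1 *m y.2).
Definition sd_inv x : semidirect rho :=
  (x.1^-1%g, - (Rrep rho (x.1^-1)%g *m x.2)).

Lemma sd_mulA : associative sd_mul.
Proof.
move=> x y z; rewrite /sd_mul /= mulgA; congr (_, _).
by rewrite RrepM mulmxDr addrA mulmxA.
Qed.
Lemma sd_mul1 : left_id sd_one sd_mul.
Proof. by case=> g v; rewrite /sd_mul /= mul1g add0r Rrep1 mul1mx. Qed.
Lemma sd_mulr1 : right_id sd_one sd_mul.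
Proof. by case=> g v; rewrite /sd_mul /= mulg1 mulmx0 addr0. Qed.
Lemma sd_mulV : left_inverse sd_one sd_inv sd_mul.
Proof. by case=> g v; rewrite /sd_mul /sd_inv /= mulVg addNr. Qed.
Lemma sd_mulrV : right_inverse sd_one sd_inv sd_mul.
Proof.
case=> g v; rewrite /sd_mul /sd_inv /= mulgV mulmxN mulmxA -RrepM mulgV Rrep1.
by rewrite mul1mx subrr.
Qed.

HB.instance Definition _ := isGroup.Build (semidirect rho)
  sd_mulA sd_mul1 sd_mulr1 sd_mulV sd_mulrV.
HB.instance Definition _ := isPointed.Build (semidirect rho) sd_one.

End semidirect_product.

Definition GLZ (R : realType) (m : nat) : set 'M[R]_m :=
  [set A | [/\ A \in unitmx, A \is a mxOver Num.int &
              invmx A \is a mxOver Num.int]].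

Definition integer_points (R : realType) (n : nat) (G : alg_group R n) :
  set (points (real_grp G)) := [set g | GLZ (val g)].
Arguments integer_points {R n} G.

Definition semidirect_lattice (R : realType) (n : nat) (G : alg_group R n)
    (d : nat) (rho : rat_rep G d) (Gamma0 : set (points (real_grp G))) :
    set (semidirect rho) :=
  [set x | Gamma0 x.1 /\ x.2 \is a mxOver Num.int].
Arguments semidirect_lattice {R n G d} rho Gamma0.

Section homogeneous_space.
Variables (G : preTopologicalGroupType) (Gamma : set G).
Local Open Scope quotient_scope.

Definition coset_rel : rel G :=
  fun x y => `[< lcoset_set Gamma x = lcoset_set Gamma y >].

Lemma coset_rel_refl : reflexive coset_rel.
Proof. by move=> x; apply/asboolP. Qed.
Lemma coset_rel_sym : ssrbool.symmetric coset_rel.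
Proof. by move=> x y; apply/asboolP/asboolP. Qed.
Lemma coset_rel_trans : transitive coset_rel.
Proof. by move=> y x z /asboolP xy /asboolP yz; apply/asboolP; rewrite xy. Qed.

Canonical coset_equiv :=
  EquivRel coset_rel coset_rel_refl coset_rel_sym coset_rel_trans.

(* G / Gamma with the quotient topology, and the same space with its Borel
   sigma-algebra. *)
Definition hspace := quotient_topology {eq_quot coset_equiv}.
Definition borel_hspace := g_sigma_algebraType (@open hspace).

Definition hproj (x : G) : hspace := \pi_hspace x.

Definition lact (g : G) (x : hspace) : hspace := hproj (g * repr x)%g.

End homogeneous_space.
Arguments hproj {G} Gamma x.
Arguments lact {G} Gamma g x.

Section dynamics.
Context d (T : measurableType d) (R : realType).
Variables (mu : probability T R) (f : T -> T).

Definition measure_preserving :=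
  measurable_fun setT f /\
  forall A, measurable A -> mu (f @^-1` A) = mu A.

Definition ergodic := measure_preserving /\
  forall A, measurable A -> f @^-1` A = A ->
    mu A = 0%E \/ mu A = 1%E.

Definition correlation (A B : set T) (k : nat) : R :=
  fine (mu (iter k f @^-1` A `&` B)) - fine (mu A) * fine (mu B).

Definition weakly_mixing := measure_preserving /\
  forall A B, measurable A -> measurable B ->
    arithmetic_mean (fun k => `|correlation A B k|) @ \oo --> (0 : R).

Definition strongly_mixing := measure_preserving /\
  forall A B, measurable A -> measurable B ->
    correlation A B @ \oo --> (0 : R).

End dynamics.

Section main_setting.
Variables (R : realType) (n : nat) (G : alg_group R n).
Variables (d : nat) (rho : rat_rep G d).
Local Notation G0 := (points (real_grp G)).
Variable Gamma0 : set G0.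
Local Notation Gamma := (semidirect_lattice rho Gamma0).
Local Notation X0 := (borel_hspace Gamma0).
Local Notation X := (borel_hspace Gamma).

Definition admissible_lattice :=
  [/\ is_subgroup Gamma0,
      Gamma0 `<=` integer_points G,
      finite_set [set lcoset_set Gamma0 g | g in integer_points G] &
      forall g, Gamma0 g -> GLZ (Rrep rho g)].

Definition non_concentrated (a : G0) (mu : probability X0 R) :=
  forall (H : set G0) (x : G0),
    is_subgroup H -> zariski_closed H -> H != [set: G0] -> H a ->
    closed [set hproj Gamma0 (h * x)%g | h in H] ->
    (mu [set hproj Gamma0 (h * x)%g | h in H] < 1)%E.

Definition bundle_proj (y : X) : X0 := hproj Gamma0 (repr y).1.

(* The left action of (1, v) on G / Gamma maps (x, w) Gamma to
   (x, w + v) Gamma: it is the translation by v of the torus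
   R^d / rho(x) Z^d, the fiber over x Gamma_0.  The Haar probability measure
   of that torus is its translation-invariant probability measure. *)
Definition is_fiber_haar (x : X0) (nu : {measure set X -> \bar R}) :=
  nu (bundle_proj @^-1` [set x]) = 1%E /\
  forall (v : 'cV[R]_d) (B : set X), measurable B ->
    nu (lact Gamma (1%g, v) @^-1` B) = nu B.

Definition is_haar_lift (mu : probability X0 R) (lambda : probability X R) :=
  (forall B, measurable B -> lambda (bundle_proj @^-1` B) = mu B) /\
  exists k : R.-pker X0 ~> X,
    (forall x, is_fiber_haar x (k x)) /\
    (forall B, measurable B -> lambda B = (\int[mu]_x k x B)%E).

End main_setting.

(* Main.v *)
From HB Require Import structures.
From mathcomp Require Import all_boot all_order all_algebra.
From mathcomp Require Import all_classical all_reals all_analysis.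
From mathcomp Require Import measurable_realfun ring lra.
From mathcomp Require Import -(notations) mpoly.
From mathcomp Require Import complex.
Require Import Defs.

(** The proof is a Fourier analysis along the fibers of the torus bundle, reduced
    to a recurrence argument for the frequencies.

    The fiber over [g Gamma_0] is the torus [R^d / rho(g) Z^d], whose characters are
    the covectors of the dual lattice [rho(g^-1)^T Z^d].  Choosing a Borel section
    of [G_0 -> G_0 / Gamma_0] turns every integer vector [eta] into a measurable
    family of characters, hence into functions on [G / Gamma] which oscillate along
    the fibers ([wave]); multiplied by indicators of Borel sets of the base they
    span an algebra which is dense in mean, for the Borel sigma-algebra is generated
    by their sublevel sets ([trig_dense]).  A wave of nonzero frequency has mean
    zero on each fiber ([phase_integral]).  The element [(a, alpha)] maps characters
    to characters, acting on frequencies by [rho(a)^T]; the vector [alpha] only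
    shifts phases.  The correlation at time [k] of two waves is therefore bounded by
    the measure of the set of base points at which the frequency of the second one is,
    up to sign, the image by [rho(a^k)^T] of the frequency of the first one at the
    translated point ([trig_gen_correlation]).

    These measures tend to zero as soon as one frequency is nonzero
    ([resonant_cvg0]).  Frequencies stay mostly in a compact shell, by invariance of
    [mu]; if the resonance recurred, the orbit of a covector of the dual lattice
    under [A = rho(a^-1)^T] would come back to the shell infinitely often.  Since
    [A] has positive eigenvalues only, the coordinates of this orbit are sums of
    products of polynomials and exponentials, hence are eventually monotone, so that
    the orbit converges to a nonzero covector fixed by [A] ([recurrent_orbit_cvg]).
    By ergodicity this fixed covector has to belong to almost all dual lattices
    ([converging_orbit_null]).  But the points whose dual lattice contains it form
    countably many closed orbits of its stabilizer, a closed algebraic subgroup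
    containing [a] ([fixed_covector_null]); non-concentration makes them null unless
    the stabilizer is the whole group.  In the latter case the covector is an
    integer vector fixed by all real points of the group, hence by the whole group,
    and its kernel is a rational invariant hyperplane, against irreducibility
    ([no_fixed_covector]).

    The Zariski density of the real points used in this last step is proved here
    directly.  The stabilizer of a vector in a group of complex points is Zariski
    open as soon as it contains the real points: a polynomial [F] vanishing on the
    real points has zero derivative at 1 along all tangent vectors, because these
    integrate to curves [exp(t x)] of real points; iterating, [F] vanishes at 1 to
    all orders along the group, and the intersection theorem of Krull, proved from
    the basis theorem of Hilbert, shows that [F] vanishes near 1.  Connectedness
    concludes.

    Mixing of the base then passes to trigonometric functions and by density to all
    Borel sets ([lifted_correlation_null]); the converse is the case of sets pulled
    back from the base.  For ergodicity, an invariant set is orthogonal to the waves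
    of nonzero frequency, and its measure in the fibers is an invariant function on
    the base, hence constant; its indicator is thus orthogonal to all trigonometric
    functions of mean zero, hence constant ([invariant_set_01]). *)

Set Implicit Arguments.
Unset Strict Implicit.
Unset Printing Implicit Defensive.

Import Order.TTheory GRing.Theory Num.Theory.
Import numFieldNormedType.Exports.

Local Open Scope classical_set_scope.
Local Open Scope ring_scope.

Local Notation mX i := (mpolyX _ (mnm1 i)).

(** * Noetherian rings *)

Section noetherian.
Variable A : comNzRingType.
Implicit Types (I J S : A -> Prop).

Definition is_ideal I :=
  [/\ I 0, forall x y, I x -> I y -> I (x + y) & forall a x, I x -> I (a * x)].

(** The ideal generated by [S] is taken as the intersection of the ideals
    above [S], so that a property of its elements follows as soon as the
    property defines an ideal. *)
Definition ideal_span S x := forall J, is_ideal J -> (forall y, S y -> J y) -> J x.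

Lemma ideal_span_ideal S : is_ideal (ideal_span S).
Proof.
split.
- by move=> J [].
- by move=> x y Sx Sy J iJ SJ; have [_ + _] := iJ; apply; [exact: Sx|exact: Sy].
- by move=> a x Sx J iJ SJ; have [_ _ +] := iJ; apply; exact: Sx.
Qed.

Lemma ideal_span_id S x : S x -> ideal_span S x.
Proof. by move=> Sx J _; apply. Qed.

Lemma ideal_span_mono S1 S2 x :
  (forall y, S1 y -> S2 y) -> ideal_span S1 x -> ideal_span S2 x.
Proof. by move=> S12 S1x J iJ S2J; apply: S1x => // y /S12/S2J. Qed.

Lemma ideal_opp I x : is_ideal I -> I x -> I (- x).
Proof. by move=> [_ _ IM] Ix; rewrite -mulN1r; exact: IM. Qed.

Definition noetherian := forall I, is_ideal I ->
  exists s : seq A, (forall x, x \in s -> I x) /\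
    forall x, I x -> ideal_span (fun y => y \in s) x.

Lemma noetherian_stationary (W : nat -> A) : noetherian ->
  exists n, ideal_span (fun y => exists2 i, (i < n)%N & y = W i) (W n).
Proof.
move=> noethA.
have [s [sW Ws]] := noethA _ (ideal_span_ideal (fun y => exists i, y = W i)).
have bound x : ideal_span (fun y => exists i, y = W i) x ->
    exists n, forall m, (n <= m)%N ->
      ideal_span (fun y => exists2 i, (i < m)%N & y = W i) x.
  move=> /(_ (fun x => exists n, forall m, (n <= m)%N ->
      ideal_span (fun y => exists2 i, (i < m)%N & y = W i) x)); apply; last first.
    by move=> y [i ->]; exists i.+1 => m im; apply: ideal_span_id; exists i.
  split.
  - by exists 0%N => m _; have [] := ideal_span_ideal
      (fun y => exists2 i, (i < m)%N & y = W i).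
  - move=> x1 y1 [n1 h1] [n2 h2]; exists (maxn n1 n2) => m.
    rewrite geq_max => /andP[m1 m2].
    by have [_ + _] := ideal_span_ideal (fun y => exists2 i, (i < m)%N & y = W i);
      apply; [exact: h1|exact: h2].
  - move=> a x1 [n1 h1]; exists n1 => m /h1 h.
    by have [_ _ +] := ideal_span_ideal (fun y => exists2 i, (i < m)%N & y = W i);
      apply.
have [n sn] : exists n, forall x, x \in s ->
    ideal_span (fun y => exists2 i, (i < n)%N & y = W i) x.
  have {sW Ws} : forall x, x \in s -> exists n, forall m, (n <= m)%N ->
      ideal_span (fun y => exists2 i, (i < m)%N & y = W i) x.
    by move=> x /sW/bound.
  elim: s => [_|x s IH h]; first by exists 0%N.
  have [|n1 h1] := IH; first by move=> y ys; apply: h; rewrite inE ys orbT.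
  have [n2 h2] := h x (mem_head _ _); exists (maxn n1 n2) => y.
  rewrite inE => /orP[/eqP->|/h1]; first by apply: h2; exact: leq_maxr.
  apply: ideal_span_mono => z [i i1 ->]; exists i => //.
  by apply: leq_trans i1 _; exact: leq_maxl.
exists n; apply: (Ws (W n)); last exact: sn.
- by apply: ideal_span_id; exists n.
- exact: ideal_span_ideal.
Qed.

End noetherian.

Lemma field_noetherian (F : fieldType) : noetherian F.
Proof.
move=> I [I0 ID IM]; have [[x [Ix x0]]|nI] := pselect (exists x, I x /\ x != 0).
  exists [:: x]; split; first by move=> y; rewrite inE => /eqP->.
  move=> y _; rewrite -[y](divfK x0).
  have [_ _] := ideal_span_ideal (fun z => z \in [:: x]); apply.
  by apply: ideal_span_id; rewrite inE.
exists [::]; split=> // y Iy; have -> : y = 0; last first.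
  by case: (ideal_span_ideal (fun z : F => z \in [::])).
by apply: contrapT => /eqP y0; apply: nI; exists y.
Qed.

(** Hilbert's basis theorem: the coefficients in degree [d] of the members of
    an ideal of size at most [d.+1] form an increasing sequence of ideals of
    [A]; generators of the first [D.+1] of them lift to generators. *)
Lemma poly_noetherian (A : comNzRingType) : noetherian A -> noetherian {poly A}.
Proof.
move=> noethA I iI; have [I0 ID IM] := iI.
pose L d c := exists p : {poly A}, [/\ I p, (size p <= d.+1)%N & p`_d = c].
have iL d : is_ideal (L d).
  split.
  - by exists 0; split; rewrite ?size_poly0 ?coef0.
  - move=> x y [p [Ip sp <-]] [q [Iq sq <-]]; exists (p + q); split.
    + exact: ID.
    + by apply: leq_trans (size_polyD _ _) _; rewrite geq_max sp.
    + by rewrite coefD.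
  - move=> a x [p [Ip sp <-]]; exists (a%:P * p); split; first exact: IM.
    + by rewrite mul_polyC; apply: leq_trans (size_scale_leq _ _) _.
    + by rewrite coefCM.
have Lmono d e c : (d <= e)%N -> L d c -> L e c.
  move=> de [p [Ip sp <-]]; exists ('X^(e - d) * p); split; first exact: IM.
    apply: leq_trans (size_polyMleq _ _) _; rewrite size_polyXn addSn /=.
    by apply: leq_trans (leq_add (leqnn _) sp) _; rewrite addnS subnK.
  by rewrite coefXnM ltnNge leq_subr /= subKn.
have iLoo : is_ideal (fun c => exists d, L d c).
  split.
  - by exists 0%N; case: (iL 0%N).
  - move=> x y [d1 h1] [d2 h2]; exists (maxn d1 d2).
    by have [_ + _] := iL (maxn d1 d2); apply;
      [apply: Lmono h1; exact: leq_maxl|apply: Lmono h2; exact: leq_maxr].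
  - by move=> a x [d h]; exists d; have [_ _] := iL d; apply.
have lift (s : seq A) d : (forall x, x \in s -> L d x) ->
    exists t : seq {poly A}, [/\ forall q, q \in t -> I q,
      forall q, q \in t -> (size q <= d.+1)%N &
      forall x, x \in s -> exists2 q, q \in t & q`_d = x].
  elim: s => [_|x s IH h]; first by exists [::].
  have [|t [t1 t2 t3]] := IH; first by move=> y ys; apply: h; rewrite inE ys orbT.
  have [p [Ip sp px]] := h x (mem_head _ _).
  exists (p :: t); split=> q; rewrite inE.
  - by case/orP=> [/eqP->|/t1].
  - by case/orP=> [/eqP->|/t2].
  - case/orP=> [/eqP->|/t3[r rt rq]]; first by exists p; rewrite ?mem_head.
    by exists r; rewrite // inE rt orbT.
have [soo [Lsoo sooL]] := noethA _ iLoo.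
have [D LD] : exists D, forall x, x \in soo -> L D x.
  elim: (soo) Lsoo => [_|x s IH h]; first by exists 0%N.
  have [|D1 h1] := IH; first by move=> y ys; apply: h; rewrite inE ys orbT.
  have [D2 h2] := h x (mem_head _ _); exists (maxn D1 D2) => y.
  rewrite inE => /orP[/eqP->|/h1]; first by apply: Lmono h2; exact: leq_maxr.
  by apply: Lmono; exact: leq_maxl.
have gen d : exists t : seq {poly A}, [/\ forall q, q \in t -> I q,
      forall q, q \in t -> (size q <= d.+1)%N &
      forall c, L d c -> ideal_span (fun y => exists2 q, q \in t & q`_d = y) c].
  have [s [Ls sL]] := noethA _ (iL d); have [t [t1 t2 t3]] := lift _ _ Ls.
  by exists t; split=> // c /sL; apply: ideal_span_mono.
have [tD [tD1 tD2 tD3]] := lift _ _ LD.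
have tDL c d : L d c -> ideal_span (fun y => exists2 q, q \in tD & q`_D = y) c.
  by move=> Lc; apply: ideal_span_mono tD3 _; apply: sooL; exists d.
have [t tP] := choice gen.
pose T := tD ++ flatten [seq t d | d <- iota 0 D].
have TI q : q \in T -> I q.
  rewrite mem_cat => /orP[/tD1//|/flattenP[u /mapP[d _ ->]]].
  by have [+ _ _] := tP d; apply.
exists T; split=> // p Ip.
have [n] := ubnP (size p); elim: n => // n IH in p Ip *; rewrite ltnS => sp.
have [T0 TD TM] := ideal_span_ideal (fun q => q \in T).
(* it is enough to find q in the span with the same coefficient in degree n *)
suff [q [Tq sq qn]] : exists q, [/\ ideal_span (fun q => q \in T) q,
    (size q <= n)%N & q`_n.-1 = p`_n.-1].
  rewrite -[p](subrK q); apply: TD => //; case: n IH sp sq qn => [_|n IH] sp sq qn.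
    have -> : p - q = 0; last exact: T0.
    apply/eqP; rewrite -size_poly_eq0 -leqn0.
    by apply: leq_trans (size_polyD _ _) _; rewrite size_polyN geq_max sp.
  apply: IH.
    apply: ID => //; apply: ideal_opp => //.
    by apply: Tq => // r /TI.
  rewrite ltnS; apply/leq_sizeP => j; rewrite leq_eqVlt => /orP[/eqP<-|nj].
    by rewrite coefB qn subrr.
  by rewrite coefB !nth_default ?subrr// ?(leq_trans sq)// (leq_trans sp).
case: n IH sp => [_|n _] sp.
  by exists 0; split=> //; rewrite ?size_poly0 ?coef0 ?nth_default.
have Lp : L n p`_n by exists p.
pose J c := exists q, [/\ ideal_span (fun q => q \in T) q,
    (size q <= n.+1)%N & q`_n = c].
have iJ : is_ideal J.
  split.
  - by exists 0; split; rewrite ?size_poly0 ?coef0.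
  - move=> x y [r [Ir sr <-]] [q [Iq sq <-]]; exists (r + q); split.
    + exact: TD.
    + by apply: leq_trans (size_polyD _ _) _; rewrite geq_max sr.
    + by rewrite coefD.
  - move=> a x [r [Ir sr <-]]; exists (a%:P * r); split; first exact: TM.
    + by rewrite mul_polyC; apply: leq_trans (size_scale_leq _ _) _.
    + by rewrite coefCM.
have [nD|Dn] := ltnP n D.
  have [t1 t2 t3] := tP n; apply: (t3 _ Lp J iJ) => _ [q qt <-].
  exists q; split=> //; last exact: t2.
  apply: ideal_span_id; rewrite mem_cat; apply/orP; right.
  by apply/flattenP; exists (t n) => //; apply: map_f; rewrite mem_iota.
apply: (tDL _ _ Lp J iJ) => _ [q qt <-].
exists ('X^(n - D) * q); split.
- by apply: TM; apply: ideal_span_id; rewrite mem_cat qt.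
- apply: leq_trans (size_polyMleq _ _) _; rewrite size_polyXn addSn /=.
  by apply: leq_trans (leq_add (leqnn _) (tD2 _ qt)) _; rewrite addnS subnK.
- by rewrite coefXnM ltnNge leq_subr /= subKn.
Qed.

(** A finitely generated algebra over a field is a quotient of an iterated
    polynomial ring; the quotient map is all that is needed of it. *)
Lemma noetherian_cover (F : fieldType) (B : comNzRingType)
    (f : {rmorphism F -> B}) (s : seq B) :
  exists (C : comNzRingType) (phi : {rmorphism C -> B}),
  [/\ noetherian C, forall x, exists c, phi c = f x,
      forall b, b \in s -> exists c, phi c = b &
      forall Q : B -> Prop, (forall x, Q (f x)) -> (forall b, b \in s -> Q b) ->
        (forall x y, Q x -> Q y -> Q (x + y)) ->
        (forall x y, Q x -> Q y -> Q (x * y)) -> forall c, Q (phi c)].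
Proof.
elim: s => [|b s [C [phi [noethC h1 h2 h3]]]].
  exists F, f; split=> //; first exact: field_noetherian.
  by move=> x; exists x.
have cb : commr_rmorph phi b by move=> x; exact: mulrC.
exists {poly C}, (horner_morph cb : {rmorphism {poly C} -> B}); split.
- exact: poly_noetherian.
- by move=> x; have [c <-] := h1 x; exists c%:P; rewrite /= horner_morphC.
- move=> b'; rewrite inE => /orP[/eqP->|/h2[c <-]].
    by exists 'X; rewrite /= horner_morphX.
  by exists c%:P; rewrite /= horner_morphC.
- move=> Q Qf Qs QD QM c /=.
  have QC : forall c, Q (phi c).
    by apply: h3 => // b' b's; apply: Qs; rewrite inE b's orbT.
  elim/poly_ind: c => [|p x IH].
    by rewrite rmorph0 -(rmorph0 phi).
  rewrite rmorphD rmorphM /= horner_morphX horner_morphC.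
  by apply: QD => //; apply: QM => //; apply: Qs; rewrite mem_head.
Qed.

(** * Infinitesimal neighbourhoods of a point of a variety *)

Lemma mpoly_ring_ind (R : comNzRingType) (N : nat) (P : mpoly N R -> Prop) :
  (forall c, P (mpolyC N c)) -> (forall i, P (mX i)) ->
  (forall p q, P p -> P q -> P (p + q)) ->
  (forall p q, P p -> P q -> P (p * q)) -> forall p, P p.
Proof.
move=> PC PX PD PM; elim/mpolyind => [|c m p _ _ Pp]; first by rewrite -mpolyC0.
apply: PD => //; rewrite -mul_mpolyC; apply: (PM) => //.
rewrite mpolyXE_id; apply: big_ind; [by rewrite -mpolyC1|exact: PM|].
move=> i _; move: (m i) => e; elim: e => [|k IH]; first by rewrite expr0 -mpolyC1.
by rewrite exprS; exact: PM.
Qed.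

Lemma mderivXU (R : comNzRingType) (N : nat) (i j : 'I_N) :
  mderiv i (mpolyX R (mnm1 j)) = mpolyC N (j == i)%:R.
Proof.
rewrite mderivX mnm1E; case: eqVneq => [->|_]; last by rewrite scale0r mpolyC0.
rewrite scale1r mpolyC1 -[X in X = _](mulr1) -mpolyX0 -mpolyXD.
congr (mpolyX _ _); apply/mnmP => l; rewrite mnmDE mnmBE mnm1E mnm0E addn0.
by rewrite subnn.
Qed.

Section infinitesimal.
Variables (K : fieldType) (N : nat) (y0 : 'I_N -> K) (I : mpoly N K -> Prop).
Hypothesis iI : is_ideal I.
Implicit Types p q : mpoly N K.

Definition loc_coord j : mpoly N K := mX j - mpolyC N (y0 j).
Local Notation z := loc_coord.

(** The [k]-th power of the maximal ideal of [y0], plus the ideal [I]. *)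
Fixpoint point_power k p : Prop :=
  if k is k'.+1 then
    exists g, (forall j, point_power k' (g j)) /\ I (p - \sum_j z j * g j)
  else True.
#[local] Arguments point_power : simpl never.
Local Notation J := point_power.

Let I0 : I 0. Proof. by case: iI. Qed.
Let ID p q : I p -> I q -> I (p + q). Proof. by case: iI => _ + _; apply. Qed.
Let IM a p : I p -> I (a * p). Proof. by case: iI => _ _; apply. Qed.
Let IB p q : I p -> I q -> I (p - q).
Proof. by move=> Ip Iq; apply: ID => //; exact: ideal_opp. Qed.

Lemma point_power_ideal k : is_ideal (J k).
Proof.
elim: k => [|k [J0 JD JM]]; first by split=> *; exact: Logic.I.
split.
- exists (fun=> 0); split=> //.
  by rewrite big1 ?subrr// => j _; rewrite mulr0.
- move=> p q [g [Jg Ig]] [h [Jh Ih]]; exists (fun j => g j + h j); split.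
    by move=> j; exact: (JD _ _ (Jg j) (Jh j)).
  under eq_bigr do rewrite mulrDr; rewrite big_split /= opprD addrACA.
  exact: ID.
- move=> a p [g [Jg Ig]]; exists (fun j => a * g j); split.
    by move=> j; exact: (JM _ _ (Jg j)).
  under eq_bigr do rewrite mulrCA; rewrite -mulr_sumr -mulrBr.
  exact: IM.
Qed.

Lemma point_powerD k p q : J k p -> J k q -> J k (p + q).
Proof. by have [_ + _] := point_power_ideal k; apply. Qed.
Lemma point_powerM k p q : J k q -> J k (p * q).
Proof. by have [_ _] := point_power_ideal k; apply. Qed.
Lemma point_powerB k p q : J k p -> J k q -> J k (p - q).
Proof.
move=> Jp Jq; apply: point_powerD => //; apply: ideal_opp => //.
exact: point_power_ideal.
Qed.
Lemma point_power0 k : J k 0.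
Proof. by have [] := point_power_ideal k. Qed.
Lemma point_power_sum k (T : finType) (F : T -> mpoly N K) :
  (forall j, J k (F j)) -> J k (\sum_j F j).
Proof.
by move=> JF; apply: big_ind; [exact: point_power0|exact: point_powerD|].
Qed.

Lemma point_powerI k p : I p -> J k p.
Proof.
case: k => [//|k] Ip; exists (fun=> 0); split; first by move=> _; exact: point_power0.
by rewrite big1 ?subr0// => j _; rewrite mulr0.
Qed.

Lemma point_powerZ k j p : J k p -> J k.+1 (z j * p).
Proof.
move=> Jp; exists (fun i => if i == j then p else 0); split.
  by move=> i; case: ifP => // _; exact: point_power0.
rewrite (bigD1 j)//= eqxx big1 ?addr0 ?subrr// => i /negbTE->.
by rewrite mulr0.
Qed.

Lemma point_power_mul a b p q : J a p -> J b q -> J (a + b)%N (p * q).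
Proof.
elim: a p => [|a IH] p; first by rewrite add0n => _; exact: point_powerM.
move=> [g [Jg Ig]] Jq; rewrite addSn -[p](subrK (\sum_j z j * g j)) mulrDl.
apply: point_powerD; first by apply: point_powerI; rewrite mulrC; exact: IM.
rewrite mulr_suml; apply: point_power_sum => j; rewrite -mulrA.
by apply: point_powerZ; exact: (IH _ (Jg j) Jq).
Qed.

Lemma point_power1 p : J 1%N (p - mpolyC N (meval y0 p)).
Proof.
elim/mpoly_ring_ind: p => [c|i|p q Jp Jq|p q Jp Jq].
- by rewrite mevalC subrr; exact: point_power0.
- by rewrite mevalXU -[X in J 1 X]mulr1; exact: point_powerZ.
- by rewrite mevalD mpolyCD opprD addrACA; exact: point_powerD.
- rewrite mevalM mpolyCM -[p * q](subrK (p * mpolyC N (meval y0 q))) -mulrBr.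
  rewrite -addrA -mulrBl; apply: point_powerD; first exact: point_powerM.
  by rewrite mulrC; exact: point_powerM.
Qed.

(** The first order Taylor formula; its remainder is in the square of the maximal
    ideal. *)
Lemma point_power2 p : J 2%N (p - mpolyC N (meval y0 p) -
  \sum_j z j * mpolyC N (meval y0 (mderiv j p))).
Proof.
elim/mpoly_ring_ind: p => [c|i|p q Jp Jq|p q Jp Jq].
- rewrite mevalC subrr sub0r big1 ?oppr0; first exact: point_power0.
  by move=> j _; rewrite mderivC meval0 mpolyC0 mulr0.
- rewrite mevalXU (bigD1 i)//= mderivXU eqxx mevalC mpolyC1 mulr1.
  rewrite big1 ?addr0 ?subrr; first by exact: (point_power0 2).
  by move=> j ji; rewrite mderivXU eq_sym (negbTE ji) mevalC mpolyC0 mulr0.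
- under eq_bigr do rewrite mderivD mevalD mpolyCD mulrDr.
  rewrite big_split /= mevalD mpolyCD opprD addrACA opprD.
  by rewrite [X in J 2 X]addrACA; exact: point_powerD.
- under eq_bigr do
    rewrite mderivM mevalD !mevalM mpolyCD !mpolyCM mulrDr.
  rewrite big_split /=.
  have -> : \sum_j z j * (mpolyC N (meval y0 (mderiv j p)) * mpolyC N (meval y0 q))
    = mpolyC N (meval y0 q) * \sum_j z j * mpolyC N (meval y0 (mderiv j p)).
    by rewrite mulr_sumr; apply: eq_bigr => j _; rewrite mulrA mulrC.
  have -> : \sum_j z j * (mpolyC N (meval y0 p) * mpolyC N (meval y0 (mderiv j q)))
    = mpolyC N (meval y0 p) * \sum_j z j * mpolyC N (meval y0 (mderiv j q)).
    by rewrite mulr_sumr; apply: eq_bigr => j _; rewrite mulrCA.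
  move: Jp Jq; rewrite mevalM mpolyCM.
  set a := mpolyC N (meval y0 p); set b := mpolyC N (meval y0 q).
  set dp := \sum_j _; set dq := \sum_j _ => Jp Jq.
  have -> : p * q - a * b - (b * dp + a * dq) =
      (p - a) * (q - b) + (a * (q - b - dq) + b * (p - a - dp)).
    by ring.
  apply: point_powerD; first exact: (@point_power_mul 1 1 _ _ (point_power1 _) (point_power1 _)).
  by apply: point_powerD; exact: point_powerM.
Qed.

(** A derivation which is the identity on the cotangent space is
    multiplication by [k] on the homogeneous functions of degree [k]. *)
Lemma euler_derivation (E : mpoly N K -> mpoly N K) :
  {morph E : p q / p + q} -> (forall p q, E (p * q) = E p * q + p * E q) ->
  (forall p, I p -> I (E p)) -> (forall p, J 1%N (E p)) ->
  (forall j, J 2%N (E (z j) - z j)) ->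
  forall k p, J k p -> J k.+1 (E p - p *+ k).
Proof.
move=> ED EM EI E1 E2; elim=> [|k IH] p; first by rewrite mulr0n subr0.
move=> [g [Jg Ig]].
have E0 : E 0 = 0 by apply: (addrI (E 0)); rewrite -ED !addr0.
have -> : E p - p *+ k.+1 =
    (E (p - \sum_j z j * g j) - (p - \sum_j z j * g j) *+ k.+1) +
    \sum_j ((E (z j) - z j) * g j + z j * (E (g j) - g j *+ k)).
  have -> : \sum_j ((E (z j) - z j) * g j + z j * (E (g j) - g j *+ k)) =
      E (\sum_j z j * g j) - (\sum_j z j * g j) *+ k.+1.
    rewrite (big_morph E ED E0) -sumrMnl -sumrB; apply: eq_bigr => j _.
    by rewrite EM mulrBr mulrnAr mulrS; ring.
  have -> : E p = E (p - \sum_j z j * g j) + E (\sum_j z j * g j).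
    by rewrite -ED subrK.
  by rewrite mulrnBl; ring.
apply: point_powerD.
  apply: point_powerI; apply: IB; first exact: EI.
  by rewrite -mulr_natl; exact: IM.
apply: point_power_sum => j; apply: point_powerD.
  exact: (@point_power_mul 2 k _ _ (E2 j) (Jg j)).
apply: point_powerZ; exact: (IH _ (Jg j)).
Qed.

(** Krull's intersection theorem, after Perdry: in the Noetherian ring
    [K[y][t (y - y0)]] the element [t^n F] is for large [n] a combination of
    the [t^i F], [i < n], and the coefficient of [t^n] in this relation reads
    [F = v F] modulo [I] with [v] vanishing at [y0]. *)
Lemma krull_intersection F : (forall k, J k F) ->
  exists u, meval y0 u = 1 /\ I (u * F).
Proof.
move=> JF.
pose s := [seq (mX j)%:P | j : 'I_N] ++ [seq 'X * (z j)%:P | j : 'I_N].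
have [C [phi [noethC phiC phis phiQ]]] := @noetherian_cover K {poly mpoly N K}
  (polyC \o @mpolyC N K : {rmorphism K -> {poly mpoly N K}}) s.
have phiP (p : mpoly N K) : exists c, phi c = p%:P.
  elim/mpoly_ring_ind: p => [c|i|p q [c cE] [e eE]|p q [c cE] [e eE]].
  - exact: phiC.
  - by apply: phis; rewrite mem_cat fintype.image_f.
  - by exists (c + e); rewrite rmorphD cE eE polyCD.
  - by exists (c * e); rewrite rmorphM cE eE polyCM.
have phiJ k p : J k p -> exists c p', I (p - p') /\ phi c = 'X^k * p'%:P.
  elim: k p => [|k IH] p.
    move=> _; have [c cp] := phiP p; exists c, p.
    by rewrite subrr expr0 mul1r.
  move=> [g [Jg Ig]].
  have /choice[c cP] : forall j, exists c, exists p', I (g j - p') /\ phi c = 'X^k * p'%:P.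
    by move=> j; exact: (IH _ (Jg j)).
  have [g' gP] := choice cP.
  have /choice[e eP] j : exists e, phi e = 'X * (z j)%:P.
    by apply: phis; rewrite mem_cat orbC fintype.image_f.
  exists (\sum_j e j * c j), (\sum_j z j * g' j); split.
    rewrite -[p](subrK (\sum_j z j * g j)) -addrA -sumrB; apply: ID => //.
    apply: big_ind => // j _; rewrite -mulrBr; apply: IM.
    by have [] := gP j.
  rewrite rmorph_sum raddf_sum mulr_sumr; apply: eq_bigr => j _ /=.
  rewrite rmorphM eP; have [_ ->] := gP j.
  by rewrite polyCM exprS mulrACA.
have phi1 c l : (0 < l)%N -> meval y0 (phi c)`_l = 0.
  move: c l; apply: (phiQ (fun P => forall l, (0 < l)%N -> meval y0 P`_l = 0)).
  - by move=> x l l0; rewrite coefC gtn_eqF// meval0.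
  - move=> b; rewrite mem_cat => /orP[]/fintype.imageP[j _ ->] l l0.
      by rewrite coefC gtn_eqF// meval0.
    rewrite coefMC coefX mevalM mevalB mevalXU mevalC subrr mulr0 //.
  - by move=> x y Qx Qy l l0; rewrite coefD mevalD Qx// Qy// addr0.
  - move=> x y Qx Qy l l0; rewrite coefM raddf_sum big1//= => i _.
    rewrite mevalM; have [->|i0] := posnP i; last by rewrite Qx ?mul0r.
    by rewrite subn0 Qy// mulr0.
have /choice[W WP] : forall k, exists c, exists p', I (F - p') /\ phi c = 'X^k * p'%:P.
  by move=> k; exact: phiJ.
have [n Wn] := noetherian_stationary W noethC.
pose Q (c : C) := forall l, exists v, I ((phi c)`_l - v * F) /\
  ((n <= l)%N -> meval y0 v = 0).
have QW : Q (W n).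
  apply: Wn.
    split.
    - by move=> l; exists 0; rewrite rmorph0 coef0 mul0r subrr meval0.
    - move=> x y Qx Qy l; have [v [v1 v2]] := Qx l; have [w [w1 w2]] := Qy l.
      exists (v + w); split; last by move=> nl; rewrite mevalD v2// w2// addr0.
      by rewrite rmorphD coefD mulrDl opprD addrACA; exact: ID.
    - move=> a x Qx l; have [v vP] := choice Qx.
      exists (\sum_(i < l.+1) (phi a)`_i * v (l - i)%N); split.
        rewrite rmorphM coefM mulr_suml -sumrB; apply: big_ind => // i _.
        by rewrite -mulrA -mulrBr; apply: IM; have [] := vP (l - i)%N.
      move=> nl; rewrite raddf_sum big1//= => i _; rewrite mevalM.
      have [i0|i0] := posnP i; last by rewrite phi1 ?mul0r.
      by have [_ ->] := vP (l - i)%N; rewrite ?mulr0// i0 subn0.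
  move=> _ [i ni ->] l; have [p' [Ip' phiW]] := WP i.
  exists (mpolyC N (l == i)%:R); rewrite phiW coefXnM coefC mevalC; split.
    case: ltngtP => [li|il|->].
    - by rewrite mpolyC0 mul0r subrr.
    - by rewrite subn_eq0 leqNgt il /= mpolyC0 mul0r subrr.
    - by rewrite subnn eqxx mpolyC1 mul1r -opprB; exact: ideal_opp.
  by move=> nl; rewrite gtn_eqF// (leq_trans ni).
have [v [Iv v0]] := QW n; exists (1 - v); split.
  by rewrite mevalB meval1 v0// subr0.
have [p' [Ip' phiW]] := WP n.
move: Iv; rewrite phiW coefXnM ltnn subnn coefC eqxx => Iv.
rewrite mulrBl mul1r -[F](subrK p') -addrA; apply: ID => //.
by rewrite subrK.
Qed.

End infinitesimal.

(** * Linear flows and polynomial equations *)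

Section flow.
Variable R : realType.

(** A function whose derivatives of all orders vanish at [0] and grow at most
    geometrically is zero. *)
Lemma derivatives_vanish (S : nat -> R -> R) (M L : R) :
  0 <= M -> 0 <= L ->
  (forall k (t : R), is_derive t (1 : R) (S k) (S k.+1 t)) -> (forall k, S k 0 = 0) ->
  (forall k t, 0 <= t <= 1 -> `|S k t| <= M * L ^+ k) ->
  forall t, 0 <= t <= 1 -> S 0%N t = 0.
Proof.
move=> M0 L0 dS S0 SM.
have ec (x : R) k : exp_coeff x k = x ^+ k * k`!%:R^-1 by [].
have bound (U : nat -> R -> R) : (forall k (t : R), is_derive t (1 : R) (U k) (U k.+1 t)) ->
    (forall k, U k 0 = 0) -> (forall k t, 0 <= t <= 1 -> U k t <= M * L ^+ k) ->
    forall m k t, 0 <= t <= 1 -> U k t <= M * L ^+ k * exp_coeff (L * t) m.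
  move=> dU U0 UM; elim=> [|m IH] k t t01.
    by rewrite /exp_coeff /= expr0 fact0 divr1 mulr1 UM.
  have [t0 t1] := andP t01.
  pose h s := M * L ^+ k * exp_coeff (L * s) m.+1 - U k s.
  pose dh s := M * L ^+ k.+1 * exp_coeff (L * s) m - U k.+1 s.
  have hdh (s : R) : is_derive s (1 : R) h (dh s).
    have -> : h = ((M * L ^+ k * L ^+ m.+1 / (m.+1)`!%:R) *: (@id R) ^+ m.+1) - U k.
      apply/funext => u; rewrite /h ec !fctE exprMn /GRing.scale.
      by move: (_%:R^-1) (L ^+ m.+1) (u ^+ m.+1) => f e v; rewrite /=; ring.
    apply: is_derive_eq.
    rewrite /dh ec /GRing.scale /= mulr1 factS natrM invfM exprMn.
    have m0 : m.+1%:R != 0 :> R by rewrite pnatr_eq0.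
    rewrite !exprS; move: (m`!%:R^-1) (L ^+ m) (s ^+ m) m0 => f e v m0.
    by field.
  have hc : {within `[0, t], continuous h}.
    by apply: derivable_within_continuous => x _; exact: ex_derive.
  have [c c0t] := MVT_segment t0 (fun x _ => hdh x) hc.
  have /andP[c0 ct] : 0 <= c <= t by move: c0t; rewrite in_itv.
  have h0 : h 0 = 0 by rewrite /h ec mulr0 expr0n mul0r mulr0 sub0r U0 oppr0.
  rewrite h0 subr0 subr0 /h => hE; rewrite -subr_ge0 hE mulr_ge0//.
  by rewrite subr_ge0 IH// c0 (le_trans ct).
move=> t t01.
have le_exp m : `|S 0%N t| <= M * exp_coeff (L * t) m.
  rewrite ler_norml lerNl; apply/andP; split.
    have dN k (s : R) : is_derive s (1 : R) (fun s => - S k s) (- S k.+1 s).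
      exact: is_deriveN.
    have N0 k : - S k 0 = 0 by rewrite S0 oppr0.
    have NM k s : 0 <= s <= 1 -> - S k s <= M * L ^+ k.
      by move=> /(SM k); rewrite ler_norml => /andP[+ _]; rewrite lerNl.
    by have := bound _ dN N0 NM m 0%N t t01; rewrite expr0 mulr1.
  have SM' k s : 0 <= s <= 1 -> S k s <= M * L ^+ k.
    by move=> /(SM k); rewrite ler_norml => /andP[].
  by have := bound _ dS S0 SM' m 0%N t t01; rewrite expr0 mulr1.
have : `|S 0%N t| <= 0.
  have cv : M * exp_coeff (L * t) m @[m --> \oo] --> M * 0.
    by apply: cvgMl_tmp; exact: cvg_exp_coeff.
  rewrite -[leRHS](mulr0 M) -(cvg_lim _ cv)//.
  by apply: limr_ge; [apply/cvg_ex; eexists; exact: cv|exact: nearW].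
by rewrite normr_le0 => /eqP.
Qed.

Variables (N : nat) (B : 'M[R]_N) (y0 : 'rV[R]_N).

Local Notation v k := (iter k (mulmx^~ B) y0).

Let M := \sum_j `|y0 0 j|.
Let L := \sum_i \sum_j `|B i j|.

Let M0 : 0 <= M. Proof. exact: sumr_ge0. Qed.
Let L0 : 0 <= L. Proof. by apply: sumr_ge0 => i _; exact: sumr_ge0. Qed.

Lemma iter_mulmx_sum_le k : \sum_j `|v k 0 j| <= M * L ^+ k.
Proof.
elim: k => [|k IH]; first by rewrite expr0 mulr1.
rewrite iterS; set w := iter k _ _ in IH *.
apply: (@le_trans _ _ (\sum_j \sum_i `|w 0 i| * `|B i j|)).
  apply: ler_sum => j _; rewrite mxE; apply: le_trans (ler_norm_sum _ _ _) _.
  by apply: ler_sum => i _; rewrite normrM.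
rewrite exchange_big /= exprSr mulrA.
apply: (@le_trans _ _ (\sum_i `|w 0 i| * L)).
  apply: ler_sum => i _; rewrite -mulr_sumr; apply: ler_wpM2l => //.
  by rewrite /L [leRHS](bigD1 i)//= lerDl; apply: sumr_ge0 => l _; exact: sumr_ge0.
by rewrite -mulr_suml; apply: ler_wpM2r.
Qed.

Lemma iter_mulmx_le k j : `|v k 0 j| <= M * L ^+ k.
Proof.
apply: le_trans (iter_mulmx_sum_le k); rewrite [leRHS](bigD1 j)//= lerDl.
exact: sumr_ge0.
Qed.

Let coef j k := v k 0 j / k`!%:R.

Lemma cvg_pseries_exp_bound (a : R^nat) (M1 L1 x : R) :
  (forall k, `|a k| <= M1 * L1 ^+ k) ->
  cvgn (pseries (fun k => a k / k`!%:R) x).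
Proof.
move=> aM; rewrite /pseries; apply: normed_cvg.
have eE k : (M1 *: exp_coeff (L1 * `|x|)) k = M1 * L1 ^+ k * (`|x| ^+ k / k`!%:R).
  by rewrite fctE /GRing.scale /= /exp_coeff /= exprMn !mulrA.
have x0 k : 0 <= `|x| ^+ k / k`!%:R :> R by rewrite divr_ge0// exprn_ge0.
apply: (@series_le_cvg _ _ (M1 *: (exp_coeff (L1 * `|x|)))).
- by move=> k; rewrite /=.
- move=> k; rewrite eE; apply: le_trans (_ : `|a k| * (`|x| ^+ k / k`!%:R) <= _).
    by rewrite mulr_ge0.
  by apply: ler_wpM2r.
- move=> k; rewrite eE /= !normrM normrX normfV [`|_%:R|]ger0_norm// mulrAC -mulrA.
  by apply: ler_wpM2r.
- by apply: is_cvg_seriesZ; exact: is_cvg_series_exp_coeff.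
Qed.

Lemma linear_flow : exists gamma : R -> 'rV[R]_N, gamma 0 = y0 /\
  forall (t : R) j, is_derive t (1 : R) (fun s => gamma s 0 j) ((gamma t *m B) 0 j).
Proof.
pose gamma t : 'rV[R]_N := \row_j limn (pseries (coef j) t).
have diffsE j : pseries_diffs (coef j) = fun k => v k.+1 0 j / k`!%:R.
  apply/funext => k; rewrite /pseries_diffs /coef factS natrM invfM mulrCA.
  by rewrite mulVKf// pnatr_eq0.
have v1_le k j : `|v k.+1 0 j| <= (M * L) * L ^+ k by rewrite -mulrA -exprS iter_mulmx_le.
have v2_le k j : `|v k.+2 0 j| <= (M * L ^+ 2) * L ^+ k.
  by rewrite -mulrA -exprD addnC addn2 iter_mulmx_le.
have diffs2E j : pseries_diffs (pseries_diffs (coef j)) = fun k => v k.+2 0 j / k`!%:R.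
  rewrite diffsE; apply/funext => k.
  by rewrite /pseries_diffs factS natrM invfM mulrCA mulVKf// pnatr_eq0.
exists gamma; split.
  apply/rowP => j; rewrite mxE; apply: cvg_lim => //.
  apply: cvg_near_cst; exists 1%N => // -[//|n] _.
  rewrite /pseries /series /= big_nat_recl// big1 ?addr0.
    by rewrite expr0 mulr1 /coef fact0 divr1.
  by move=> i _; rewrite expr0n mulr0.
move=> t j.
have -> : (fun s => gamma s 0 j) = (fun s => limn (pseries (coef j) s)).
  by apply/funext => s; rewrite mxE.
have -> : (gamma t *m B) 0 j = limn (pseries (pseries_diffs (coef j)) t).
  apply/esym/cvg_lim => //; rewrite mxE diffsE.
  have -> : pseries (fun k => v k.+1 0 j / k`!%:R) t =
      fun n => \sum_l pseries (coef l) t n * B l j.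
    apply/funext => n; rewrite /pseries /series /=.
    under [RHS]eq_bigr do rewrite mulr_suml; rewrite exchange_big /=.
    apply: eq_bigr => k _; rewrite mxE !mulr_suml; apply: eq_bigr => l _.
    by rewrite /coef -!mulrA; congr (_ * _); rewrite mulrC -!mulrA.
  apply: cvg_big; first exact: add_continuous.
  move=> l _; apply: cvgMr_tmp; rewrite mxE.
  exact: cvg_pseries_exp_bound (iter_mulmx_le^~ l).
apply: (@pseries_snd_diffs _ _ (`|t| + 1)).
- exact: cvg_pseries_exp_bound (iter_mulmx_le^~ j).
- by rewrite diffsE; exact: cvg_pseries_exp_bound (v1_le^~ j).
- by rewrite diffs2E; exact: cvg_pseries_exp_bound (v2_le^~ j).
- by rewrite [ltRHS]ger0_norm ?addr_ge0// ltrDl.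
Qed.
End flow.

Section linear_derivation.
Variables (R : comNzRingType) (N : nat) (B : 'M[R]_N).
Implicit Types (p q : mpoly N R).

(** The derivative along the vector field [y |-> y *m B]. *)
Definition linear_deriv p : mpoly N R :=
  \sum_j (\sum_l mpolyC N (B l j) * mX l) * mderiv j p.
Local Notation D := linear_deriv.

Lemma linear_derivD p q : D (p + q) = D p + D q.
Proof.
by rewrite -big_split; apply: eq_bigr => j _; rewrite mderivD mulrDr.
Qed.

Lemma linear_derivM p q : D (p * q) = D p * q + p * D q.
Proof.
rewrite /D mulr_suml mulr_sumr -big_split; apply: eq_bigr => j _ /=.
by rewrite mderivM; ring.
Qed.

Lemma linear_derivC c : D (mpolyC N c) = 0.
Proof. by rewrite /D big1// => j _; rewrite mderivC mulr0. Qed.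

Lemma linear_deriv0 : D 0 = 0.
Proof. by rewrite -mpolyC0 linear_derivC. Qed.

Lemma linear_derivX j : D (mX j) = \sum_l mpolyC N (B l j) * mX l.
Proof.
rewrite /D (bigD1 j)//= mderivXU eqxx mpolyC1 mulr1 [X in _ + X]big1 ?addr0// => i ij.
by rewrite mderivXU eq_sym (negbTE ij) mpolyC0 mulr0.
Qed.

Lemma meval_linear_deriv p (y : 'rV[R]_N) : meval (y 0) (D p) =
  \sum_j (y *m B) 0 j * meval (y 0) (mderiv j p).
Proof.
rewrite /D raddf_sum; apply: eq_bigr => j _ /=; rewrite mevalM; congr (_ * _).
rewrite raddf_sum mxE; apply: eq_bigr => l _ /=.
by rewrite mevalM mevalC mevalXU mulrC.
Qed.

End linear_derivation.

Section flow_equations.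
Variables (R : realType) (N : nat) (B : 'M[R]_N).
Implicit Types (p q : mpoly N R).
Local Notation D := (linear_deriv B).

Variable gamma : R -> 'rV[R]_N.
Hypothesis gamma_flow : forall (t : R) j,
  is_derive t (1 : R) (fun s => gamma s 0 j) ((gamma t *m B) 0 j).

Lemma is_derive_flow p (t : R) :
  is_derive t (1 : R) (fun s => meval (gamma s 0) p) (meval (gamma t 0) (D p)).
Proof.
elim/mpoly_ring_ind: p => [c|j|p q dp dq|p q dp dq].
- under eq_fun do rewrite mevalC; rewrite linear_derivC meval0.
  exact: is_derive_cst.
- under eq_fun do rewrite mevalXU; apply: is_derive_eq.
  rewrite linear_derivX raddf_sum mxE; apply: eq_bigr => l _ /=.
  by rewrite mevalM mevalC mevalXU mulrC.
- under eq_fun do rewrite mevalD; rewrite linear_derivD mevalD.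
  exact: is_deriveD.
- under eq_fun do rewrite mevalM; rewrite linear_derivM mevalD !mevalM.
  apply: is_derive_eq; rewrite /GRing.scale /= addrC.
  by congr (_ + _); rewrite mulrC.
Qed.

Definition geometric_growth p := exists M L : R, [/\ 0 <= M, 0 <= L &
  forall k (t : R), 0 <= t <= 1 ->
    `|meval (gamma t 0) (iter k D p)| <= M * L ^+ k].

Lemma flow_bounded : exists M : R, forall t : R, 0 <= t <= 1 ->
  \sum_j `|gamma t 0 j| <= M.
Proof.
pose f t := \sum_j `|gamma t 0 j|.
have fc : {within `[0, 1], continuous f}.
  apply: continuous_subspaceT => t; apply: cvg_big; first exact: add_continuous.
  move=> j _; apply: cvg_norm.
  have /derivable1_diffP/differentiable_continuous : derivable (fun s => gamma s 0 j) t 1.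
    exact: ex_derive.
  exact.
have [c _ cM] := EVT_max (@ler01 R) fc.
by exists (f c) => t t01; apply: cM; rewrite in_itv.
Qed.

Lemma geometric_growth_all p : geometric_growth p.
Proof.
elim/mpoly_ring_ind: p => [c|j|p q|p q].
- exists `|c|, 1; split=> // k t _; rewrite expr1n mulr1.
  case: k => [|k]; first by rewrite /= mevalC.
  have -> : iter k.+1 D (mpolyC N c) = 0.
    rewrite iterSr linear_derivC; elim: k => [//|k IH].
    by rewrite iterS IH linear_deriv0.
  by rewrite meval0 normr0.
- pose lin (c : 'cV[R]_N) : mpoly N R := \sum_l mpolyC N (c l 0) * mX l.
  have Dlin c : D (lin c) = lin (B *m c).
    rewrite /lin (big_morph D (linear_derivD B) (linear_deriv0 B)).
    under eq_bigr do rewrite linear_derivM linear_derivC mul0r add0r linear_derivX mulr_sumr.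
    rewrite exchange_big; apply: eq_bigr => l _ /=.
    rewrite mxE raddf_sum mulr_suml; apply: eq_bigr => i _ /=.
    by rewrite mulrA -mpolyCM [c i 0 * _]mulrC.
  have evlin (y : 'rV[R]_N) c : meval (y 0) (lin c) = (y *m c) 0 0 :> R.
    rewrite raddf_sum mxE; apply: eq_bigr => l _ /=.
    by rewrite mevalM mevalC mevalXU mulrC.
  have [M gM] := flow_bounded.
  exists `|M|, (\sum_i \sum_j `|B i j|); split=> //.
    by apply: sumr_ge0 => i _; exact: sumr_ge0.
  have -> : mX j = lin (delta_mx j 0).
    rewrite /lin (bigD1 j)//= mxE !eqxx mpolyC1 mul1r big1 ?addr0// => i ij.
    by rewrite mxE (negbTE ij) mpolyC0 mul0r.
  move=> k t t01.
  have -> : iter k D (lin (delta_mx j 0)) = lin (iter k (mulmx B) (delta_mx j 0)).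
    by elim: k => [//|k IH]; rewrite !iterS IH Dlin.
  have mulmx_iter w y : y *m iter k (mulmx B) w = iter k (mulmx^~ B) y *m w.
    by elim: k w => [//|k IH] w; rewrite iterSr IH iterS mulmxA.
  have mulmx_delta (w : 'rV[R]_N) : (w *m delta_mx j 0) 0 0 = w 0 j.
    rewrite mxE (bigD1 j)//= mxE !eqxx mulr1 big1 ?addr0// => i ij.
    by rewrite mxE (negbTE ij) mulr0.
  rewrite evlin mulmx_iter mulmx_delta.
  apply: le_trans (iter_mulmx_le _ _ _ _) _; apply: ler_wpM2r.
    by apply: exprn_ge0; apply: sumr_ge0 => i _; exact: sumr_ge0.
  exact: le_trans (gM t t01) (ler_norm _).
- move=> [M1 [L1 [M10 L10 h1]]] [M2 [L2 [M20 L20 h2]]].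
  exists (M1 + M2), (L1 + L2); split; rewrite ?addr_ge0// => k t t01.
  have -> : iter k D (p + q) = iter k D p + iter k D q.
    by elim: k => [//|k IH]; rewrite !iterS IH linear_derivD.
  rewrite mevalD; apply: le_trans (ler_normD _ _) _; rewrite mulrDl.
  apply: lerD; [apply: le_trans (h1 _ _ t01) _|apply: le_trans (h2 _ _ t01) _];
    apply: ler_wpM2l => //; apply: lerXn2r; rewrite ?nnegrE ?addr_ge0//.
    by rewrite lerDl.
  by rewrite lerDr.
- move=> [M1 [L1 [M10 L10 h1]]] [M2 [L2 [M20 L20 h2]]].
  exists (M1 * M2), (L1 + L2); split; rewrite ?addr_ge0 ?mulr_ge0// => k t t01.
  elim: k M1 M2 p q M10 M20 h1 h2 => [|k IH] M1 M2 p q M10 M20 h1 h2.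
    rewrite /= mevalM normrM expr0 mulr1.
    have := h1 0%N _ t01; have := h2 0%N _ t01; rewrite /= !expr0 !mulr1 => hq hp.
    exact: ler_pM.
  rewrite iterSr linear_derivM.
  have iterD u w : iter k D (u + w) = iter k D u + iter k D w.
    by elim: k {IH} => [//|k IH]; rewrite !iterS IH linear_derivD.
  rewrite iterD mevalD; apply: le_trans (ler_normD _ _) _.
  rewrite exprS mulrA [_ * (L1 + L2)]mulrDr mulrDl; apply: lerD.
    rewrite [M1 * M2 * L1]mulrAC; apply: IH; rewrite ?mulr_ge0// => m s s01.
    by rewrite -iterSr -mulrA -exprS; exact: h1.
  rewrite -[M1 * M2 * L2]mulrA; apply: IH; rewrite ?mulr_ge0// => m s s01.
  by rewrite -iterSr -mulrA -exprS; exact: h2.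
Qed.

(** The derivatives of an equation along the flow are equations again, hence all
    vanish at the initial point. *)
Lemma flow_ideal_vanish (I : mpoly N R -> Prop) :
  (forall p, I p -> I (D p)) -> (forall p, I p -> meval (gamma 0 0) p = 0) ->
  forall p, I p -> forall t : R, 0 <= t <= 1 -> meval (gamma t 0) p = 0.
Proof.
move=> ID I0 p Ip t t01; have [M [L [M0 L0 ML]]] := geometric_growth_all p.
apply: (@derivatives_vanish R (fun k s => meval (gamma s 0) (iter k D p))
  M L M0 L0 _ _ ML t t01).
  by move=> k s; rewrite iterS; exact: is_derive_flow.
by move=> k; apply: I0; elim: k => [//|k IH]; rewrite iterS; exact: ID.
Qed.

End flow_equations.

(** * Real points are Zariski dense *)

Section map_mpoly_morphism.
Variables (K L : comNzRingType) (f : {rmorphism K -> L}) (N : nat).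
Implicit Types p q : mpoly N K.

Lemma map_mpolyD p q : map_mpoly f (p + q) = map_mpoly f p + map_mpoly f q.
Proof. exact: rmorphD. Qed.
Lemma map_mpolyB p q : map_mpoly f (p - q) = map_mpoly f p - map_mpoly f q.
Proof. exact: rmorphB. Qed.
Lemma map_mpolyM p q : map_mpoly f (p * q) = map_mpoly f p * map_mpoly f q.
Proof. exact: rmorphM. Qed.
Lemma map_mpoly0 : map_mpoly f (0 : mpoly N K) = 0.
Proof. exact: rmorph0. Qed.
Lemma map_mpoly1 : map_mpoly f (1 : mpoly N K) = 1.
Proof. exact: rmorph1. Qed.
Lemma map_mpoly_sum (T : finType) (F : T -> mpoly N K) :
  map_mpoly f (\sum_j F j) = \sum_j map_mpoly f (F j).
Proof. exact: rmorph_sum. Qed.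

End map_mpoly_morphism.

Lemma meval_sum (K : comNzRingType) (N : nat) (y : 'I_N -> K) (T : finType)
  (F : T -> mpoly N K) : meval y (\sum_j F j) = \sum_j meval y (F j).
Proof. exact: rmorph_sum. Qed.

Lemma mderiv_sum (K : comNzRingType) (N : nat) (l : 'I_N) (T : finType)
  (F : T -> mpoly N K) :
  mderiv l (\sum_j F j) = \sum_j (mderiv l (F j) : mpoly N K).
Proof. exact: raddf_sum. Qed.

Lemma meval_map (K L : comNzRingType) (f : {rmorphism K -> L}) (N : nat)
  (y : 'I_N -> L) (p : mpoly N K) : meval y (map_mpoly f p) = mmap f y p.
Proof.
elim/mpoly_ring_ind: p => [c|i|p q hp hq|p q hp hq].
- by rewrite map_mpolyC mevalC mmapC.
- by rewrite map_mpolyX mevalXU mmapX mmap1U.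
- by rewrite !rmorphD /= hp hq.
- by rewrite !rmorphM /= hp hq.
Qed.

Lemma meval_map_rmorph (K L : comNzRingType) (f : {rmorphism K -> L}) (N : nat)
  (y : 'I_N -> K) (p : mpoly N K) :
  meval (f \o y) (map_mpoly f p) = f (meval y p).
Proof.
elim/mpoly_ring_ind: p => [c|i|p q hp hq|p q hp hq].
- by rewrite map_mpolyC !mevalC.
- by rewrite map_mpolyX !mevalXU.
- by rewrite !rmorphD /= hp hq.
- by rewrite !rmorphM /= hp hq.
Qed.

Lemma mderiv_map (K L : comNzRingType) (f : {rmorphism K -> L}) (N : nat)
  (i : 'I_N) (p : mpoly N K) :
  mderiv i (map_mpoly f p) = map_mpoly f (mderiv i p).
Proof.
elim/mpoly_ring_ind: p => [c|j|p q hp hq|p q hp hq].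
- by rewrite map_mpolyC !mderivC raddf0.
- rewrite map_mpolyX !mderivXU map_mpolyC; congr (mpolyC _ _).
  by case: (j == i); [exact: (esym (rmorph1 f))|exact: (esym (rmorph0 f))].
- by rewrite mderivD !rmorphD /= mderivD hp hq.
- by rewrite mderivM rmorphD !rmorphM /= mderivM hp hq.
Qed.

Lemma linear_deriv_map (K L : comNzRingType) (f : {rmorphism K -> L}) (N : nat)
  (B : 'M[K]_N) (p : mpoly N K) :
  map_mpoly f (linear_deriv B p) = linear_deriv (map_mx f B) (map_mpoly f p).
Proof.
rewrite /linear_deriv rmorph_sum; apply: eq_bigr => j _ /=.
rewrite rmorphM mderiv_map rmorph_sum; congr (_ * _); apply: eq_bigr => l _ /=.
by rewrite rmorphM /= map_mpolyC map_mpolyX mxE.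
Qed.

Definition lin_subst (K : comNzRingType) (N : nat) (Q : 'M[K]_N) (p : mpoly N K) :=
  comp_mpoly [tuple \sum_l mpolyC N (Q l j) * mX l | j < N] p.

Lemma meval_lin_subst (K : comNzRingType) (N : nat) (Q : 'M[K]_N) (p : mpoly N K)
  (y : 'rV[K]_N) : meval (y 0) (lin_subst Q p) = meval ((y *m Q) 0) p.
Proof.
rewrite /lin_subst comp_mpoly_meval; apply: meval_eq => j.
rewrite tnth_mktuple raddf_sum mxE; apply: eq_bigr => l _ /=.
by rewrite mevalM mevalC mevalXU mulrC.
Qed.

Lemma mderiv_lin_subst (K : comNzRingType) (N : nat) (Q : 'M[K]_N)
  (p : mpoly N K) (y : 'rV[K]_N) l :
  meval (y 0) (mderiv l (lin_subst Q p)) =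
  \sum_j Q l j * meval ((y *m Q) 0) (mderiv j p).
Proof.
elim/mpoly_ring_ind: p => [c|i|p q hp hq|p q hp hq].
- rewrite /lin_subst comp_mpolyC mderivC meval0 big1// => j _.
  by rewrite mderivC meval0 mulr0.
- rewrite /lin_subst comp_mpolyXU -tnth_nth tnth_mktuple.
  rewrite (big_morph _ (mderivD l) (mderiv0 _ l)) raddf_sum /=.
  rewrite [LHS](bigD1 l)//= [X in _ + X]big1 => [|j jl]; last first.
    by rewrite mderiv_mulC mderivXU (negbTE jl) mpolyC0 mulr0 meval0.
  rewrite [RHS](bigD1 i)//= [X in _ = _ + X]big1 => [|j ji]; last first.
    by rewrite mderivXU [i == j]eq_sym (negbTE ji) mpolyC0 meval0 mulr0.
  by rewrite mderiv_mulC !mderivXU !eqxx mevalM !mevalC.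
- rewrite /lin_subst comp_mpolyD mderivD mevalD -/(lin_subst Q p) hp hq.
  by rewrite -big_split; apply: eq_bigr => j _; rewrite mderivD mevalD mulrDr.
- rewrite /lin_subst rmorphM /= -/(lin_subst Q p) -/(lin_subst Q q).
  rewrite mderivM mevalD !mevalM hp hq !meval_lin_subst mulr_suml mulr_sumr.
  rewrite -big_split; apply: eq_bigr => j _ /=.
  by rewrite mderivM mevalD !mevalM; ring.
Qed.

Section matrix_coordinates.
Variables (F : fieldType) (n : nat).
Implicit Types A g : 'M[F]_n.

Definition gl_row A : 'rV[F]_(n * n + 1) := row_mx (mxvec A) (\det A)^-1%:M.

(** On the coordinates of the matrix and of the inverse of the determinant,
    right multiplication by an invertible matrix and the left-invariant vector
    fields are linear. *)
Definition right_mul g : 'M[F]_(n * n + 1) :=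
  block_mx (lin_mulmxr g) 0 0 (\det g)^-1%:M.

Definition tangent_field (v : 'rV[F]_(n * n + 1)) : 'M[F]_(n * n + 1) :=
  block_mx (lin_mulmx (vec_mx (lsubmx v))) 0 0 (rsubmx v 0 0)%:M.

Lemma gl_rowM A g : gl_row (A *m g) = gl_row A *m right_mul g.
Proof.
rewrite /gl_row /right_mul mul_row_block !mulmx0 addr0 add0r mul_vec_lin /=.
by rewrite -scalar_mxM det_mulmx invfM.
Qed.

Lemma gl_row_split (v : 'rV[F]_(n * n + 1)) :
  v = row_mx (mxvec (vec_mx (lsubmx v))) (rsubmx v 0 0)%:M.
Proof. by rewrite vec_mxK -mx11_scalar hsubmxK. Qed.

Lemma gl_row_field v g :
  gl_row g *m tangent_field v = v *m right_mul g.
Proof.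
rewrite [in RHS](gl_row_split v) /gl_row /right_mul /tangent_field.
rewrite !mul_row_block !mulmx0 !addr0 !add0r !mul_vec_lin /=.
by rewrite -!scalar_mxM [X in row_mx _ X%:M]mulrC.
Qed.

Lemma gl_row1_field v : gl_row 1%:M *m tangent_field v = v.
Proof.
rewrite gl_row_field /right_mul [in LHS](gl_row_split v) mul_row_block.
rewrite !mulmx0 addr0 add0r mul_vec_lin /= mulmx1 det1 invr1 mulmx1.
by rewrite -gl_row_split.
Qed.

End matrix_coordinates.

Lemma map_gl_row (F L : fieldType) (f : {rmorphism F -> L}) (n : nat) (A : 'M[F]_n) :
  map_mx f (gl_row A) = gl_row (map_mx f A).
Proof. by rewrite /gl_row map_row_mx map_mxvec map_scalar_mx fmorphV det_map_mx. Qed.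

Lemma map_tangent_field (F L : fieldType) (f : {rmorphism F -> L}) (n : nat)
  (v : 'rV[F]_(n * n + 1)) :
  map_mx f (tangent_field v) = tangent_field (map_mx f v).
Proof.
rewrite /tangent_field map_block_mx !map_mx0 map_scalar_mx.
rewrite (map_lin_mx (gf := mulmx (vec_mx (lsubmx (map_mx f v))))); last first.
  by move=> A /=; rewrite map_mxM map_vec_mx map_lsubmx.
by rewrite -[in RHS]map_rsubmx [in RHS]mxE /lin_mulmx.
Qed.

(** A matrix of maximal rank among those whose rows lie in [W] spans [W]. *)
Lemma row_space_of (F : fieldType) (N : nat) (W : 'rV[F]_N -> Prop) :
  W 0 -> (forall v w, W v -> W w -> W (v + w)) -> (forall a v, W v -> W (a *: v)) ->
  exists M : 'M[F]_N, forall w, W w <-> (w <= M)%MS.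
Proof.
move=> W0 WD WZ.
pose P r := `[< exists M : 'M[F]_N, (forall w : 'rV_N, (w <= M)%MS -> W w) /\ \rank M = r >].
have P0 : exists r, P r.
  exists 0%N; apply/asboolP; exists 0; split; last exact: mxrank0.
  by move=> w; rewrite submx0 => /eqP->.
have PN r : P r -> (r <= N)%N by move=> /asboolP[M [_ <-]]; exact: rank_leq_row.
case: (ex_maxnP P0 PN) => r /asboolP[M [MW Mr]] rmax.
exists M => w; split; last exact: MW.
move=> Ww; have : (\rank (M + w)%MS <= r)%N.
  apply: rmax; apply/asboolP; exists (M + w)%MS; split=> // u /sub_addsmxP[[a b] ->].
  apply: WD; first by apply: MW; rewrite submxMl.
  by rewrite [b]mx11_scalar mul_scalar_mx /=; exact: WZ.
rewrite -Mr => rk; apply: submx_trans (addsmxSr M w) _.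
by have [_ <-] := mxrank_leqif_sup (addsmxSl M w); rewrite eqn_leq rk mxrankS// addsmxSl.
Qed.

Section density.
Variables (R : realType) (C : fieldType) (toC : {rmorphism R -> C}).
Variables (conj : {rmorphism C -> C}) (im : C).
Hypothesis conj_toC : forall x, conj (toC x) = toC x.
Hypothesis conjK : involutive conj.
Hypothesis im2 : im * im = -1.
Hypothesis conj_im : conj im = - im.
Hypothesis toC_split : forall c, exists a b, c = toC a + im * toC b.

Variable n : nat.
Local Notation N := (n * n + 1)%N.
Variable S : set (mpoly N rat).
Local Notation GC := (zero_locus C S).
Hypothesis GC1 : GC 1%:M.
Hypothesis GCM : forall g h, GC g -> GC h -> GC (g *m h).
Implicit Types (p : mpoly N R) (q : mpoly N C) (g h : 'M[C]_n).

(** The real equations of the complex variety. *)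
Definition real_ideal p :=
  forall g, GC g -> meval (gl_row g 0) (map_mpoly toC p) = 0.
Local Notation I := real_ideal.

Definition complex_ideal q := forall g, GC g -> meval (gl_row g 0) q = 0.

Lemma real_ideal_ideal : is_ideal I.
Proof.
split.
- by move=> g _; rewrite map_mpoly0 meval0.
- by move=> p1 p2 h1 h2 g Gg; rewrite map_mpolyD mevalD h1// h2// addr0.
- by move=> a p h g Gg; rewrite map_mpolyM mevalM h// mulr0.
Qed.

Definition base_pt : 'rV[R]_N := gl_row 1%:M.
Local Notation y0 := base_pt.

Lemma base_ptC : map_mx toC y0 = gl_row 1%:M.
Proof. by rewrite map_gl_row map_mx1. Qed.

Lemma meval_toC (y : 'rV[R]_N) p :
  meval (map_mx toC y 0) (map_mpoly toC p) = toC (meval (y 0) p).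
Proof. by rewrite -meval_map_rmorph; apply: meval_eq => j; rewrite mxE. Qed.

Lemma toC_inj : injective toC.
Proof. exact: fmorph_inj. Qed.

Lemma real_ideal_base p : I p -> meval (y0 0) p = 0.
Proof.
move=> /(_ _ GC1); rewrite -base_ptC meval_toC => h.
by apply: toC_inj; rewrite h rmorph0.
Qed.

Definition ratR : {rmorphism rat -> R} := ratr.
Definition ratC : {rmorphism rat -> C} := toC \o ratR.

Lemma rat_evalE (F : fieldType) (f : {rmorphism rat -> F}) (p : mpoly N rat)
  (A : 'M[F]_n) : rat_eval p A = meval (gl_row A 0) (map_mpoly f p).
Proof.
rewrite meval_map /rat_eval /mmap; apply: eq_bigr => m _ /=.
by rewrite fmorph_eq_rat.
Qed.

Lemma map_mpoly_ratC (p : mpoly N rat) :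
  map_mpoly ratC p = map_mpoly toC (map_mpoly ratR p).
Proof. by apply/mpolyP => m; rewrite !mcoeff_map_mpoly. Qed.

Lemma map_mpoly_conj p : map_mpoly conj (map_mpoly toC p) = map_mpoly toC p.
Proof. by apply/mpolyP => m; rewrite !mcoeff_map_mpoly /= conj_toC. Qed.

Lemma meval_conj g p : meval (gl_row (map_mx conj g) 0) (map_mpoly toC p) =
  conj (meval (gl_row g 0) (map_mpoly toC p)).
Proof.
rewrite -meval_map_rmorph map_mpoly_conj; apply: meval_eq => j.
by rewrite -map_gl_row mxE.
Qed.

Lemma conj_point g : GC g -> GC (map_mx conj g).
Proof.
move=> [ug Gg]; split; first by rewrite map_unitmx.
move=> p /Gg; rewrite !(rat_evalE ratC) map_mpoly_ratC meval_conj => ->.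
exact: rmorph0.
Qed.

(** A complex equation is a combination of two real ones, because the variety
    is stable under complex conjugation. *)
Lemma complex_ideal_split q : complex_ideal q ->
  exists p1 p2, [/\ I p1, I p2 &
    q = map_mpoly toC p1 + mpolyC N im * map_mpoly toC p2].
Proof.
have [p1 [p2 ->]] : exists p1 p2,
    q = map_mpoly toC p1 + mpolyC N im * map_mpoly toC p2.
  elim/mpoly_ring_ind: q => [c|j|q1 q2 [a [b ->]] [c [d ->]]|q1 q2 [a [b ->]] [c [d ->]]].
  - have [a [b ->]] := toC_split c.
    exists (mpolyC N a), (mpolyC N b).
    by rewrite !map_mpolyC -mpolyCM -mpolyCD.
  - by exists (mX j), 0; rewrite map_mpolyX map_mpoly0 mulr0 addr0.
  - by exists (a + c), (b + d); rewrite !map_mpolyD; ring.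
  - exists (a * c - b * d), (a * d + b * c).
    rewrite map_mpolyB map_mpolyD !map_mpolyM.
    have i2 : mpolyC N im * mpolyC N im = -1 :> mpoly N C.
      by rewrite -mpolyCM im2 mpolyCN mpolyC1.
    set x := mpolyC N im in i2 *.
    set a' := map_mpoly _ a; set b' := map_mpoly _ b.
    set c' := map_mpoly _ c; set d' := map_mpoly _ d.
    have -> : (a' + x * b') * (c' + x * d') =
      a' * c' + (x * x) * (b' * d') + x * (a' * d' + b' * c') by ring.
    by rewrite i2; ring.
move=> hq.
have im0 : im != 0.
  by apply: contra_eq_neq im2 => ->; rewrite mul0r eq_sym oppr_eq0 oner_eq0.
have two0 : (2%:R : C) != 0.
  have -> : (2%:R : C) = toC 2%:R by rewrite rmorph_nat.
  by rewrite fmorph_eq0 pnatr_eq0.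
have hq1 g : GC g -> meval (gl_row g 0) (map_mpoly toC p1) +
    im * meval (gl_row g 0) (map_mpoly toC p2) = 0.
  by move=> /hq; rewrite mevalD mevalM mevalC.
have hq2 g : GC g -> meval (gl_row g 0) (map_mpoly toC p1) -
    im * meval (gl_row g 0) (map_mpoly toC p2) = 0.
  move=> /conj_point/hq1; rewrite !meval_conj => /(congr1 conj).
  by rewrite rmorph0 rmorphD rmorphM !conjK conj_im mulNr.
have I1 : I p1.
  move=> g Gg; have := congr2 +%R (hq1 _ Gg) (hq2 _ Gg).
  rewrite addrACA subrr !addr0 -mulr2n -mulr_natl => /eqP.
  by rewrite mulf_eq0 (negbTE two0) => /eqP.
exists p1, p2; split=> // g Gg; have := hq1 _ Gg.
rewrite (I1 _ Gg) add0r => /eqP.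
by rewrite mulf_eq0 (negbTE im0) => /eqP.
Qed.

(** The Zariski tangent space at the identity, in the coordinates [gl_row]. *)
Definition tangent (v : 'rV[R]_N) := forall p, I p ->
  \sum_j v 0 j * meval (y0 0) (mderiv j p) = 0.

Lemma tangent_complex v q : tangent v -> complex_ideal q ->
  \sum_j toC (v 0 j) * meval (map_mx toC y0 0) (mderiv j q) = 0.
Proof.
move=> Tv /complex_ideal_split[p1 [p2 [/Tv T1 /Tv T2 ->]]].
under eq_bigr => j _ do
  rewrite mderivD mderiv_mulC !mderiv_map mevalD mevalM mevalC !meval_toC
          mulrDr mulrCA -!rmorphM /=.
by rewrite big_split /= -mulr_sumr -!rmorph_sum /= T1 T2 !rmorph0 mulr0 addr0.
Qed.

Lemma meval_tangent_field v g p :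
  meval (gl_row g 0) (map_mpoly toC (linear_deriv (tangent_field v) p)) =
  \sum_l toC (v 0 l) *
    meval (map_mx toC y0 0) (mderiv l (lin_subst (right_mul g) (map_mpoly toC p))).
Proof.
rewrite linear_deriv_map meval_linear_deriv map_tangent_field gl_row_field.
under [RHS]eq_bigr do rewrite mderiv_lin_subst mulr_sumr.
rewrite [RHS]exchange_big /=; apply: eq_bigr => j _.
rewrite mxE mulr_suml; apply: eq_bigr => l _.
by rewrite mxE mulrA base_ptC -gl_rowM mul1mx.
Qed.

Lemma lin_subst_ideal g q : GC g -> complex_ideal q ->
  complex_ideal (lin_subst (right_mul g) q).
Proof.
by move=> Gg hq h Gh; rewrite meval_lin_subst -gl_rowM; apply: hq; exact: GCM.
Qed.

Lemma tangent_field_ideal v p : tangent v -> I p ->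
  I (linear_deriv (tangent_field v) p).
Proof.
move=> Tv Ip g Gg; rewrite meval_tangent_field tangent_complex//.
exact: lin_subst_ideal.
Qed.

Lemma zero_locus_real (y : 'rV[R]_N) : (forall p, I p -> meval (y 0) p = 0) ->
  exists2 A, zero_locus R S A & gl_row A = y.
Proof.
move=> yI; pose A : 'M[R]_n := vec_mx (lsubmx y); pose c := rsubmx y 0 0.
have yE : y = row_mx (mxvec A) c%:M by exact: gl_row_split.
pose Y (K : fieldType) : 'M[mpoly N K]_n :=
  \matrix_(i, j) mX (lshift 1 (mxvec_index i j)).
pose pdet (K : fieldType) : mpoly N K := \det (Y K) * mX (rshift (n * n) 0) - 1.
have pdetE (K : fieldType) (z : 'rV[K]_N) :
    meval (z 0) (pdet K) = \det (vec_mx (lsubmx z)) * rsubmx z 0 0 - 1.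
  rewrite mevalB meval1 mevalM mevalXU mxE; congr (_ * _ - _).
  rewrite -det_map_mx; congr (\det _); apply/matrixP => i j.
  by rewrite !mxE /= mevalXU.
have mappdet : map_mpoly toC (pdet R) = pdet C.
  have YE : map_mx (map_mpoly toC) (Y R) = Y C.
    by apply/matrixP => i j; rewrite !mxE /= map_mpolyX.
  by rewrite /pdet map_mpolyB map_mpolyM map_mpoly1 map_mpolyX -det_map_mx YE.
have detA : \det A * c = 1.
  apply/eqP; rewrite -subr_eq0 -pdetE; apply/eqP; apply: yI => g [ug _].
  rewrite mappdet pdetE row_mxKl row_mxKr mxvecK mxE mulr1n mulfV ?subrr//.
  by rewrite -unitfE.
have uA : A \in unitmx.
  rewrite unitmxE unitfE.
  by apply: contra_eq_neq detA => ->; rewrite mul0r eq_sym oner_eq0.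
have yA : gl_row A = y.
  rewrite yE /gl_row; congr (row_mx _ _%:M).
  by rewrite -[LHS]mulr1 -detA mulKf// -unitfE -unitmxE.
exists A => //; split=> // p Gp.
rewrite (rat_evalE ratR) yA; apply: yI => g [_ /(_ _ Gp)].
by rewrite (rat_evalE ratC) map_mpoly_ratC.
Qed.

(** The exponential of a tangent vector stays among the real points. *)
Lemma tangent_curve v p : tangent v ->
  (forall A, zero_locus R S A -> meval (gl_row A 0) p = 0) ->
  \sum_j v 0 j * meval (y0 0) (mderiv j p) = 0.
Proof.
move=> Tv p0; have [gamma [gamma0 dgamma]] := linear_flow (tangent_field v) y0.
have gammaI := flow_ideal_vanish dgamma (fun r : mpoly N R => @tangent_field_ideal v r Tv).
have pgamma (t : R) : 0 <= t <= 1 -> meval (gamma t 0) p = 0.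
  move=> t01; have [|A GA <-] := @zero_locus_real (gamma t); last exact: p0.
  move=> q0 Iq; apply: (gammaI _ q0 Iq t t01) => r Ir.
  by rewrite gamma0; exact: real_ideal_base.
have dp := is_derive_flow dgamma p 0.
rewrite gamma0 meval_linear_deriv gl_row1_field in dp.
have [/cvg_ex[l dl] dE] := dp.
rewrite -dE /derive; apply: cvg_lim => //.
suff l0 : l = 0 by rewrite l0 in dl.
have dl' := cvg_dnbhs_at_right dl.
apply: (cvg_unique _ dl') => //.
apply: cvg_near_cst; near=> h.
have h01 : 0 <= h <= 1.
  apply/andP; split; near: h; first exact: nbhs_right_ge.
  by apply: nbhs_right_le; exact: ltr01.
rewrite /= addr0 [_%:A]mulr1 !pgamma ?lexx ?ler01// subr0 scaler0 //.
Unshelve. all: by end_near. Qed.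


Variables (d : nat) (rr : 'M[mpoly N rat]_d) (eta : 'cV[R]_d).
Definition rat_mx (F : fieldType) (A : 'M[F]_n) : 'M[F]_d :=
  map_mx (fun r : mpoly N rat => rat_eval r A) rr.
Hypothesis rat_mxM :
  forall g h, GC g -> GC h -> rat_mx (g *m h) = rat_mx g *m rat_mx h.
Hypothesis eta_fixed : forall A, zero_locus R S A -> (rat_mx A)^T *m eta = eta.

Local Notation etaC := (map_mx toC eta).

Definition defect i : mpoly N R :=
  \sum_j map_mpoly ratR (rr j i) * mpolyC N (eta j 0) - mpolyC N (eta i 0).

Lemma meval_defect (A : 'M[R]_n) i :
  meval (gl_row A 0) (defect i) = ((rat_mx A)^T *m eta - eta) i 0.
Proof.
rewrite /defect mevalB mevalC meval_sum !mxE; congr (_ - _).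
by apply: eq_bigr => j _; rewrite mevalM mevalC !mxE (rat_evalE ratR).
Qed.

Lemma meval_defectC g i :
  meval (gl_row g 0) (map_mpoly toC (defect i)) = ((rat_mx g)^T *m etaC - etaC) i 0.
Proof.
rewrite /defect map_mpolyB mevalB map_mpolyC mevalC map_mpoly_sum meval_sum !mxE.
congr (_ - _); apply: eq_bigr => j _.
by rewrite map_mpolyM map_mpolyC mevalM mevalC !mxE (rat_evalE ratC) map_mpoly_ratC.
Qed.

Lemma defect_deriv v i : tangent v ->
  I (linear_deriv (tangent_field v) (defect i)).
Proof.
move=> Tv g Gg; rewrite meval_tangent_field.
pose q := lin_subst (right_mul g) (map_mpoly toC (defect i)) -
  (\sum_j mpolyC N (rat_mx g j i) * map_mpoly toC (defect j) +
   mpolyC N (((rat_mx g)^T *m etaC - etaC) i 0)).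
have Jq : complex_ideal q.
  move=> h Gh; rewrite mevalB meval_lin_subst -gl_rowM meval_defectC.
  rewrite mevalD mevalC meval_sum rat_mxM// trmx_mul -mulmxA.
  have -> : \sum_j meval (gl_row h 0) (mpolyC N (rat_mx g j i) * map_mpoly toC (defect j))
      = ((rat_mx g)^T *m ((rat_mx h)^T *m etaC - etaC)) i 0.
    rewrite [RHS]mxE; apply: eq_bigr => j _.
    by rewrite mevalM mevalC meval_defectC [_^T i j]mxE.
  rewrite mulmxBr; set a := _ *m (_ *m _); set b := _ *m etaC.
  by rewrite !mxE; ring.
have := tangent_complex Tv Jq.
have defect0 j : \sum_l toC (v 0 l) *
    meval (map_mx toC y0 0) (mderiv l (map_mpoly toC (defect j))) = 0.
  under eq_bigr do rewrite mderiv_map meval_toC -rmorphM /=.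
  rewrite -rmorph_sum (tangent_curve Tv) ?rmorph0// => A GA.
  by rewrite meval_defect eta_fixed// subrr mxE.
have qE l : toC (v 0 l) * meval (map_mx toC y0 0) (mderiv l q) =
    toC (v 0 l) * meval (map_mx toC y0 0)
      (mderiv l (lin_subst (right_mul g) (map_mpoly toC (defect i)))) -
    \sum_j rat_mx g j i * (toC (v 0 l) *
      meval (map_mx toC y0 0) (mderiv l (map_mpoly toC (defect j)))).
  rewrite /q mderivB mderivD mderivC addr0 mevalB mderiv_sum meval_sum mulrBr.
  congr (_ - _); rewrite mulr_sumr; apply: eq_bigr => j _.
  by rewrite mderiv_mulC mevalM mevalC mulrCA.
under eq_bigr do rewrite qE.
rewrite sumrB exchange_big /= [X in _ - X]big1 ?subr0// => j _.
by rewrite -mulr_sumr defect0 mulr0.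
Qed.

Lemma stabilizer_open : exists u : mpoly N C, meval (gl_row 1%:M 0) u = 1 /\
  forall g, GC g -> meval (gl_row g 0) u != 0 -> (rat_mx g)^T *m etaC = etaC.
Proof.
pose conormal (w : 'rV[R]_N) := exists2 p, I p &
  w = \row_j meval (y0 0) (mderiv j p).
have [I0 ID IM] := real_ideal_ideal.
have [M conormalM] : exists M : 'M[R]_N, forall w, conormal w <-> (w <= M)%MS.
  apply: row_space_of.
  - by exists 0 => //; apply/rowP => j; rewrite !mxE mderiv0 meval0.
  - move=> _ _ [p Ip ->] [q Iq ->]; exists (p + q); first exact: ID.
    by apply/rowP => j; rewrite !mxE mderivD mevalD.
  - move=> a _ [p Ip ->]; exists (mpolyC N a * p); first exact: IM.
    by apply/rowP => j; rewrite !mxE mderiv_mulC mevalM mevalC.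
(* a projection onto the tangent space, acting on column vectors *)
pose Pi : 'M[R]_N := 1%:M - pinvmx M *m M.
have MPi : M *m Pi = 0 by rewrite mulmxBr mulmx1 mulmxA mulmxKpV// subrr.
pose tau j : 'rV[R]_N := (col j Pi)^T.
have tauT j : tangent (tau j).
  move=> p Ip; have /conormalM/submxP[D wE] : conormal (\row_j meval (y0 0) (mderiv j p)).
    by exists p.
  have wPi : (\row_l meval (y0 0) (mderiv l p)) *m Pi = 0.
    by rewrite wE -mulmxA MPi mulmx0.
  have := congr1 (fun w : 'rV_N => w 0 j) wPi; rewrite mxE [RHS]mxE; apply: etrans.
  by apply: eq_bigr => l _; rewrite mulrC; congr (_ * _); rewrite !mxE.
pose E p := \sum_j loc_coord (y0 0) j * linear_deriv (tangent_field (tau j)) p.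
have ED : {morph E : p q / p + q}.
  move=> p q; rewrite /E -big_split; apply: eq_bigr => j _.
  by rewrite linear_derivD mulrDr.
have EM p (r : mpoly N R) : E (p * r) = E p * r + p * E r.
  rewrite /E mulr_suml mulr_sumr -big_split; apply: eq_bigr => j _.
  by rewrite linear_derivM /=; ring.
have EI p : (forall j, I (linear_deriv (tangent_field (tau j)) p)) -> I (E p).
  move=> h; rewrite /E; apply: big_ind => // j _; exact: IM.
have iI := real_ideal_ideal.
have E1 p : point_power (y0 0) I 1%N (E p).
  by apply: point_power_sum => // j; exact: point_powerZ.
have E2 i : point_power (y0 0) I 2%N (E (loc_coord (y0 0) i) - loc_coord (y0 0) i).
  pose V j := linear_deriv (tangent_field (tau j)) (loc_coord (y0 0) i).
  have Vy j : meval (y0 0) (V j) = Pi i j.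
    rewrite meval_linear_deriv gl_row1_field (bigD1 i)//= big1 ?addr0 => [|l li].
      by rewrite mderivB mderivC subr0 mderivXU eqxx mpolyC1 meval1 mulr1 !mxE.
    by rewrite mderivB mderivC subr0 mderivXU eq_sym (negbTE li) mpolyC0 meval0 mulr0.
  have /conormalM[p Ip pE] : (row i (Pi - 1%:M) <= M)%MS.
    by rewrite addrAC subrr add0r -mulNmx row_mul submxMl.
  have J2p : point_power (y0 0) I 2%N
      (\sum_j loc_coord (y0 0) j * mpolyC N (meval (y0 0) (mderiv j p))).
    have := point_power2 (y0 0) iI p; rewrite real_ideal_base// mpolyC0 subr0.
    move=> /(point_powerB iI (point_powerI (y0 0) iI 2 Ip)).
    by rewrite opprB addrC subrK.
  have -> : E (loc_coord (y0 0) i) - loc_coord (y0 0) i =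
      \sum_j loc_coord (y0 0) j * (V j - mpolyC N (meval (y0 0) (V j))) +
      \sum_j loc_coord (y0 0) j * mpolyC N (meval (y0 0) (mderiv j p)).
    rewrite -big_split /=.
    have -> : loc_coord (y0 0) i = \sum_j loc_coord (y0 0) j * mpolyC N (i == j)%:R.
      rewrite (bigD1 i)//= eqxx mpolyC1 mulr1 big1 ?addr0// => j ji.
      by rewrite eq_sym (negbTE ji) mpolyC0 mulr0.
    rewrite {1}/E -sumrB; apply: eq_bigr => j _.
    rewrite -mulrBr -mulrDr; congr (_ * _).
    have -> : meval (y0 0) (mderiv j p) = Pi i j - (i == j)%:R.
      by have := congr1 (fun w : 'rV_N => w 0 j) pE; rewrite !mxE => ->.
    rewrite Vy mpolyCB; set s := mpolyC N (Pi i j).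
    rewrite addrA subrK; congr (linear_deriv _ _ - _).
    rewrite [RHS](_ : _ = \sum_j loc_coord (y0 0) j * mpolyC N (i == j)%:R)//.
    rewrite (bigD1 i)//= eqxx mpolyC1 mulr1 big1 ?addr0// => l li.
    by rewrite eq_sym (negbTE li) mpolyC0 mulr0.
  apply: point_powerD => //; apply: point_power_sum => // j.
  by apply: point_powerZ => //; exact: point_power1.
have Edefect i : I (E (defect i)) by apply: EI => j; exact: defect_deriv.
have EII p : I p -> I (E p).
  by move=> Ip; apply: EI => j; exact: tangent_field_ideal.
have Jdefect i k : point_power (y0 0) I k (defect i).
  elim: k => [//|[|k] IH].
    have [A GA Ay] := zero_locus_real real_ideal_base.
    have := point_power1 (y0 0) iI (defect i).
    by rewrite -{2}Ay meval_defect eta_fixed// subrr mxE mpolyC0 subr0.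
  have := euler_derivation iI ED EM EII E1 E2 IH.
  move=> /(point_powerB iI (point_powerI (y0 0) iI k.+2 (Edefect i))).
  rewrite opprB addrC subrK => Jk.
  have -> : defect i = mpolyC N (k.+1%:R^-1) * (defect i *+ k.+1).
    rewrite mulrnAr -mulrnAl -mpolyCMn -[_^-1 *+ _]mulr_natr mulVf ?pnatr_eq0//.
    by rewrite mpolyC1 mul1r.
  exact: point_powerM.
have /choice[u uP] i : exists u, meval (y0 0) u = 1 /\ I (u * defect i).
  exact: krull_intersection.
exists (\prod_i map_mpoly toC (u i)); split.
  rewrite rmorph_prod big1//= => i _; have [u1 _] := uP i.
  by rewrite -base_ptC meval_toC u1 rmorph1.
move=> g Gg; rewrite rmorph_prod => /= u0; apply/eqP; rewrite -subr_eq0; apply/eqP.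
apply/matrixP => i j; rewrite (ord1 j) -meval_defectC [RHS]mxE.
have [_ /(_ _ Gg)] := uP i; rewrite map_mpolyM mevalM => /eqP.
rewrite mulf_eq0 => /orP[ui0|/eqP//]; case/negP: u0.
by rewrite (bigD1 i)//= mulf_eq0 ui0.
Qed.

End density.

Section real_points_dense.
Variables (R : realType) (n : nat) (G : alg_group R n) (d : nat).
Variable rho : rat_rep G d.
Hypothesis hconn : connected_group G.
Local Notation N := (n * n + 1)%N.
Local Notation toC := (real_complex R).

Lemma complex_stabilizer_open (eta : 'cV[R]_d) :
  (forall g, (Rrep rho g)^T *m eta = eta) ->
  exists u : mpoly N R[i], meval (gl_row 1%:M 0) u = 1 /\
  forall g : points (complex_grp G), meval (gl_row (val g) 0) u != 0 ->
    (Crep rho g)^T *m map_mx toC eta = map_mx toC eta.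
Proof.
move=> eta_fix.
have conjT x : conjc (toC x) = toC x by exact: conjc_real.
have iiN1 : Complex 0 1 * Complex 0 1 = -1 :> R[i] by apply/eqP; rewrite eq_complex /=; apply/andP; split; apply/eqP; ring.
have conji : conjc (Complex 0 1) = - Complex 0 1 :> R[i] by apply/eqP; rewrite eq_complex /= oppr0 !eqxx.
have split_toC (c : R[i]) : exists a b, c = toC a + Complex 0 1 * toC b.
  case: c => a b; exists a, b; apply/eqP; rewrite eq_complex /=.
  by apply/andP; split; apply/eqP; ring.
have GM (g h : 'M[R[i]]_n) : zero_locus R[i] (ag_eqs G) g -> zero_locus R[i] (ag_eqs G) h ->
    zero_locus R[i] (ag_eqs G) (g *m h) by exact: ag_mul.
have rrM (g h : 'M[R[i]]_n) : zero_locus R[i] (ag_eqs G) g -> zero_locus R[i] (ag_eqs G) h ->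
    rat_mx (rr_mx rho) (g *m h) = rat_mx (rr_mx rho) g *m rat_mx (rr_mx rho) h.
  move=> Gg Gh.
  exact: (rr_mul rho (@pt_make _ _ (complex_grp G) g Gg) (@pt_make _ _ (complex_grp G) h Gh)).
have fixR (A : 'M[R]_n) : zero_locus R (ag_eqs G) A -> (rat_mx (rr_mx rho) A)^T *m eta = eta.
  by move=> GA; exact: (eta_fix (@pt_make _ _ (real_grp G) A GA)).
have [u [u1 ufix]] := stabilizer_open conjT (@conjcK R) iiN1 conji split_toC
  (ag_one G) GM rrM fixR.
by exists u; split=> // g; exact: (ufix _ (pt_in g)).
Qed.

Lemma tr_mulmx_fixed (F : fieldType) (A B : 'M[F]_d) (v : 'cV[F]_d) :
  A^T *m v = v -> B^T *m v = v -> (A *m B)^T *m v = v.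
Proof. by move=> Av Bv; rewrite trmx_mul -mulmxA Av. Qed.

(** The stabilizer of [eta] is Zariski closed, and it is open because it
    contains the translates of a neighbourhood of the identity. *)
Theorem complex_fixed (eta : 'cV[R]_d) :
  (forall g, (Rrep rho g)^T *m eta = eta) ->
  forall g, (Crep rho g)^T *m map_mx toC eta = map_mx toC eta.
Proof.
move=> eta_fix; have [u [u1 ufix]] := complex_stabilizer_open eta_fix.
set etaC := map_mx toC eta in ufix *.
pose stab (g : points (complex_grp G)) := (Crep rho g)^T *m etaC = etaC.
have stabM g h : stab g -> stab h -> stab (g * h)%g.
  have CM : Crep rho (g * h)%g = Crep rho g *m Crep rho h by exact: rr_mul.
  by rewrite /stab CM; exact: tr_mulmx_fixed.
pose eqs i : mpoly N R[i] :=
  \sum_j map_mpoly (ratC toC) (rr_mx rho j i) * mpolyC N (etaC j 0) - mpolyC N (etaC i 0).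
have eqsE (g : points (complex_grp G)) i :
    meval (gl_coord (val g)) (eqs i) = ((Crep rho g)^T *m etaC - etaC) i 0.
  rewrite /eqs mevalB mevalC meval_sum [RHS]mxE [X in _ = _ + X]mxE.
  congr (_ - _); rewrite mxE; apply: eq_bigr => j _.
  by rewrite mevalM mevalC [_^T i j]mxE [Crep rho g j i]mxE (rat_evalE (ratC toC)).
pose Z : set (points (complex_grp G)) := [set g | stab g].
have Zc : zariski_closed Z.
  exists [set p | exists i, p = eqs i]; apply/seteqP; split=> g /=.
    by move=> sg _ [i ->]; rewrite eqsE sg subrr mxE.
  move=> h; apply/matrixP => i j; rewrite (ord1 j).
  by apply/eqP; rewrite -subr_eq0; have := h _ (ex_intro _ i erefl); rewrite eqsE !mxE => ->.
have Cc : zariski_closed (~` Z).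
  exists [set p | exists2 s, Z s & p = lin_subst (right_mul (val s^-1%g)) u].
  have evals (s g : points (complex_grp G)) :
      meval (gl_coord (val g)) (lin_subst (right_mul (val s^-1%g)) u) =
      meval (gl_row (val (g * s^-1)%g) 0) u.
    by rewrite (meval_lin_subst _ _ (gl_row (val g))) -gl_rowM.
  apply/seteqP; split=> g /=.
    move=> nZg _ [s Zs ->]; rewrite evals; apply/eqP; apply: contra_notT nZg => /ufix.
    move=> h; have -> : g = (g * s^-1 * s)%g by rewrite -mulgA mulVg mulg1.
    exact: (stabM (g * s^-1)%g s h Zs).
  move=> h Zg; have := h _ (ex_intro2 _ _ g Zg erefl); rewrite evals mulgV.
  by rewrite u1 => /eqP; rewrite oner_eq0.
have Z1 : Z 1%g by rewrite /Z /= /stab {1}/Crep rr_one trmx1 mul1mx.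
have [||h|h] := hconn Zc Cc.
- by move=> g _; have [] := pselect (Z g); [left|right].
- by rewrite setTI setIC setICl.
- by move=> g; exact: (h g).
- by case: (h 1%g Logic.I Z1).
Qed.

Hypothesis hirr : irreducible_over_rat rho.
Hypothesis hd : (1 < d)%N.

(** A rational covector fixed by [G] has a rational invariant hyperplane for
    kernel. *)
Lemma no_fixed_covector (eta : 'cV[int]_d) : eta != 0 ->
  ~ forall g, (Rrep rho g)^T *m map_mx intr eta = map_mx intr eta.
Proof.
move=> eta0 /complex_fixed fixC.
pose etaQ : 'cV[rat]_d := map_mx intr eta.
have etaQC : map_mx toC (map_mx intr eta) = map_mx ratr etaQ :> 'cV[R[i]]_d.
  by apply/matrixP => i j; rewrite !mxE rmorph_int ratr_int.
have rk1 : \rank etaQ = 1%N.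
  apply/eqP; rewrite eqn_leq rank_leq_col lt0n mxrank_eq0.
  apply: contra eta0 => /eqP e0; apply/eqP/matrixP => i j.
  have := congr1 (fun M : 'cV[rat]_d => M i j) e0; rewrite !mxE => /eqP.
  by rewrite intr_eq0 => /eqP.
have [] := hirr (W := kermx etaQ).
- move=> g; rewrite map_kermx -etaQC; apply/sub_kermxP.
  by rewrite -mulmxA fixC mulmx_ker.
- by move=> /eqP; rewrite mxrank_ker rk1 subn_eq0 leqNgt hd.
- have pred_neq m : (1 < m)%N -> (m - 1)%N <> m.
    by case: m => // m _; rewrite subn1 /= => /eqP; rewrite ltn_eqF.
  by rewrite mxrank_ker rk1 => /(pred_neq _ hd).
Qed.

End real_points_dense.

(** * Orbits of linear maps with positive spectrum *)

Section positive_spectrum.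
Variable R : realType.

Definition eventually_signed (c : R^nat) :=
  (exists K, forall k, (K <= k)%N -> 0 <= c k) \/
  (exists K, forall k, (K <= k)%N -> c k <= 0).

Lemma eventually_monotone_signed (e : R^nat) :
  eventually_signed (fun k => e k.+1 - e k) -> eventually_signed e.
Proof.
have up (f : R^nat) K : (forall k, (K <= k)%N -> 0 <= f k.+1 - f k) ->
    eventually_signed f.
  move=> f_incr.
  have mono k l : (K <= k)%N -> f k <= f (k + l)%N.
    move=> Kk; elim: l => [|l IH]; first by rewrite addn0.
    apply: le_trans IH _; rewrite addnS -subr_ge0 f_incr//.
    by rewrite (leq_trans Kk)// leq_addr.
  have [[k Kk fk]|neg] := pselect (exists2 k, (K <= k)%N & 0 <= f k).
    left; exists k => l kl; apply: le_trans fk _.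
    by rewrite -(subnKC kl) mono.
  right; exists K => k Kk; rewrite leNgt; apply/negP => fk.
  by apply: neg; exists k => //; exact: ltW.
move=> [[K h]|[K h]]; first exact: up h.
have [|[L hL]|[L hL]] := up (fun k => - e k) K.
- by move=> k /h; lra.
- by right; exists L => k /hL; rewrite oppr_ge0.
- by left; exists L => k /hL; rewrite oppr_le0.
Qed.

Variables (d : nat) (A : 'M[R]_d).
Implicit Types (v w : 'cV[R]_d) (s : seq R).

Definition shift_prod s v := foldl (fun w r => A *m w - r *: w) v s.
Local Notation orbit k v := (iter k (mulmx A) v).

Lemma orbit_sub (r : R) k v w : orbit k (v - r *: w) = orbit k v - r *: orbit k w.
Proof. by elim: k => [//|k IH]; rewrite !iterS IH mulmxBr -scalemxAr. Qed.

(** Solutions of a linear recurrence whose characteristic roots are positive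
    do not oscillate: dividing by [r ^+ k] turns the operator of shift minus
    [r] into a difference operator. *)
Lemma orbit_signed s v (l : 'rV[R]_d) : all (fun r => 0 < r) s ->
  shift_prod s v = 0 -> eventually_signed (fun k => (l *m orbit k v) 0 0).
Proof.
elim: s v => [|r s IH] v /=.
  move=> _ ->; left; exists 0%N => k _.
  have -> : orbit k (0 : 'cV_d) = 0 by elim: k => [//|k IH]; rewrite iterS IH mulmx0.
  by rewrite mulmx0 mxE.
move=> /andP[r0 s0] /(IH _ s0) hb.
pose c k := (l *m orbit k v) 0 0; pose e k := c k / r ^+ k.
have rk0 k : 0 < r ^+ k by rewrite exprn_gt0.
have bE k : (l *m orbit k (A *m v - r *: v)) 0 0 = (e k.+1 - e k) * r ^+ k.+1.
  rewrite orbit_sub -iterSr mulmxBr -scalemxAr mxE [X in _ + X]mxE [X in _ - X]mxE.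
  rewrite -/(c k.+1) -/(c k) /e mulrBl divfK ?gt_eqF// exprS mulrCA -mulrA.
  by rewrite mulVf ?gt_eqF// mulr1.
have es : eventually_signed e.
  apply: eventually_monotone_signed.
  case: hb => -[K h]; [left|right]; exists K => k /h; rewrite bE.
    by rewrite pmulr_lge0.
  by rewrite pmulr_lle0.
by case: es => -[K h]; [left|right]; exists K => k /h; rewrite /e;
  [rewrite pmulr_lge0|rewrite pmulr_lle0]; rewrite ?invr_gt0.
Qed.

Definition sqnorm v := \sum_i (v i 0) ^+ 2.

Hypothesis spectrum : exists2 s, all (fun r => 0 < r) s & forall v, shift_prod s v = 0.

Lemma orbit_coord_cvg v i (M : R) :
  (forall K, exists2 k, (K <= k)%N & (orbit k v i 0) ^+ 2 <= M) ->
  cvgn (fun k => orbit k v i 0).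
Proof.
move=> recb; have [s s0 sA] := spectrum.
pose c k := orbit k v i 0.
have cE w k : orbit k w i 0 = ((delta_mx 0 i : 'rV[R]_d) *m orbit k w) 0 0.
  by rewrite -rowE mxE.
have dsigned : eventually_signed (fun k => c k.+1 - c k).
  have := orbit_signed (delta_mx 0 i) s0 (sA (A *m v - v)).
  have dE k : ((delta_mx 0 i : 'rV[R]_d) *m orbit k (A *m v - v)) 0 0 = c k.+1 - c k.
    rewrite -cE; have -> : A *m v - v = A *m v - 1 *: v by rewrite scale1r.
    by rewrite orbit_sub -iterSr scale1r mxE [X in _ + X]mxE.
  by case=> -[K h]; [left|right]; exists K => k /h; rewrite dE.
have incr (f : R^nat) K : (forall k, (K <= k)%N -> 0 <= f k.+1 - f k) ->
    (forall K, exists2 k, (K <= k)%N & (f k) ^+ 2 <= M) -> cvgn f.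
  move=> f_incr fM.
  have nd : nondecreasing_seq (fun k => f (k + K)%N).
    apply/nondecreasing_seqP => k; rewrite addSn -subr_ge0 f_incr//.
    by rewrite leq_addl.
  apply/cvg_ex; exists (limn (fun k => f (k + K)%N)).
  rewrite -(cvg_shiftn K); apply: (nondecreasing_is_cvgn nd).
  exists (1 + M) => _ [k _ <-].
  have [m km fm] := fM (k + K)%N.
  have fkm : f (k + K)%N <= f m.
    have Km : (K <= m)%N by apply: leq_trans km; exact: leq_addl.
    by rewrite -(subnK Km); apply: nd; rewrite leq_subRL// addnC.
  apply: le_trans fkm _; have h1 := sqr_ge0 (f m - 1); have h2 := sqr_ge0 (f m).
  rewrite !expr2 in h1 h2 fm; nra.
case: dsigned => -[K h]; first exact: incr h recb.
rewrite -is_cvgNE; apply: (incr (fun k => - c k) K) => [k /h hk|K'].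
  by rewrite opprK addrC -opprB oppr_ge0.
have [k Kk kM] := recb K'; exists k => //.
by rewrite sqrrN.
Qed.

(** An orbit which meets a shell infinitely often converges, and its limit is
    a nonzero fixed vector. *)
Lemma recurrent_orbit_cvg v (lo hi : R) : 0 < lo ->
  (forall K, exists2 k, (K <= k)%N & lo <= sqnorm (orbit k v) <= hi) ->
  exists L : 'cV[R]_d, [/\ L != 0, A *m L = L &
    forall i, orbit k v i 0 @[k --> \oo] --> L i 0].
Proof.
move=> lo0 shell.
have cv i : cvgn (fun k => orbit k v i 0).
  apply: (@orbit_coord_cvg v i hi) => K; have [k Kk /andP[_ khi]] := shell K.
  exists k => //; apply: le_trans khi; rewrite /sqnorm (bigD1 i)//= lerDl.
  by apply: sumr_ge0 => j _; exact: sqr_ge0.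
pose L : 'cV[R]_d := \col_i limn (fun k => orbit k v i 0).
have cvL i : orbit k v i 0 @[k --> \oo] --> L i 0 by rewrite mxE; exact: cv.
exists L; split=> //.
  have cvn : sqnorm (orbit k v) @[k --> \oo] --> sqnorm L.
    apply: cvg_big; first exact: add_continuous.
    move=> i _; under eq_fun do rewrite expr2; rewrite expr2.
    by apply: cvgM; exact: cvL.
  apply: contraPneq (lo0) => L0; apply/negP; rewrite -leNgt.
  have -> : 0 = sqnorm L by rewrite L0 /sqnorm big1// => i _; rewrite mxE expr0n.
  rewrite leNgt; apply/negP => Llo.
  have : \forall k \near \oo, sqnorm (orbit k v) < lo by apply: cvgr_lt Llo.
  move=> [K _ hK].
  have [k Kk /andP[klo _]] := shell K.
  by have := hK k Kk; rewrite /= ltNge klo.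
apply/matrixP => i j; rewrite (ord1 j).
have cv1 : orbit k.+1 v i 0 @[k --> \oo] --> (A *m L) i 0.
  rewrite mxE; under eq_fun do rewrite iterS mxE.
  apply: cvg_big; first exact: add_continuous.
  by move=> l _; apply: cvgMl_tmp; exact: cvL.
apply: (cvg_unique _ cv1) => //.
by have := cvL i; rewrite -(cvg_shiftS (fun k => orbit k v i 0)).
Qed.

End positive_spectrum.

Section spectrum_of_matrix.
Variable R : realType.
Local Notation toC := (real_complex R).

Lemma char_poly_tr (F : comNzRingType) (d : nat) (B : 'M[F]_d) :
  char_poly B^T = char_poly B.
Proof.
rewrite /char_poly -det_tr; congr (\det _); apply/matrixP => i j.
by rewrite !mxE eq_sym.
Qed.

Lemma all_real_pos (s : seq R[i]) :
  (forall z, z \in s -> exists2 r : R, 0 < r & z = toC r) ->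
  exists2 t, all (fun r => 0 < r) t & s = map toC t.
Proof.
elim: s => [|z s IH] h; first by exists [::].
have [|t t0 ->] := IH; first by move=> y ys; apply: h; rewrite inE ys orbT.
have [r r0 ->] := h z (mem_head _ _); exists (r :: t) => //=.
by rewrite r0.
Qed.

Lemma positive_spectrumP (d : nat) (A B : 'M[R]_d) : char_poly A = char_poly B ->
  (forall z : R[i], root (char_poly (map_mx toC B)) z ->
     exists2 r : R, 0 < r & z = toC r) ->
  exists2 s, all (fun r => 0 < r) s & forall v, shift_prod A s v = 0.
Proof.
case: d A B => [|d] A B AB pos; first by exists [::] => // v; exact: flatmx0.
have [rs rsE] := closed_field_poly_normal (char_poly (map_mx toC B)).
rewrite (monicP (char_poly_monic _)) scale1r in rsE.
have [|s s0 rss] := @all_real_pos rs.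
  by move=> z zrs; apply: pos; rewrite rsE root_prod_XsubC.
exists s => // v.
have shiftE w : shift_prod A s w = horner_mx A (\prod_(r <- s) ('X - r%:P)) *m w.
  elim: (s) w => [|r t IH] w; first by rewrite big_nil rmorph1 mul1mx.
  rewrite big_cons mulrC rmorphM rmorphB /= horner_mx_X horner_mx_C -mulmxA.
  by rewrite /shift_prod /= -/(shift_prod A t _) IH mulmxBl mul_scalar_mx.
suff charA : \prod_(r <- s) ('X - r%:P) = char_poly A.
  by rewrite shiftE charA Cayley_Hamilton mul0mx.
rewrite AB; apply: (map_poly_inj toC); rewrite map_char_poly /= rsE rss.
rewrite big_map rmorph_prod; apply: eq_bigr => r _ /=.
by rewrite rmorphB /= map_polyX map_polyC.
Qed.

End spectrum_of_matrix.

(** * Homogeneous spaces and their Borel sets *)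

Section homogeneous_space_theory.
Variables (G : preTopologicalGroupType) (Gamma : set G).
Hypothesis subG : is_subgroup Gamma.
Local Open Scope group_scope.
Local Open Scope quotient_scope.
Implicit Types x y g : G.

Lemma subgroupV x : Gamma x -> Gamma x^-1.
Proof.
by case: subG => G1 GM Gx; rewrite -[x^-1]mulg1; exact: GM.
Qed.

Lemma subgroupM x y : Gamma x -> Gamma y -> Gamma (x * y).
Proof.
case: subG => G1 GM Gx Gy; rewrite -[x]invgK; apply: GM => //.
exact: subgroupV.
Qed.

Lemma hprojP x y : hproj Gamma x = hproj Gamma y <-> Gamma (x^-1 * y).
Proof.
have [G1 GM] := subG.
have -> : (hproj Gamma x = hproj Gamma y) <-> lcoset_set Gamma x = lcoset_set Gamma y.
  have e : reflect (x = y %[mod {eq_quot coset_equiv Gamma}]) (coset_rel Gamma x y).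
    exact: eqmodP.
  by split=> [/e/asboolP//|/asboolP/e].
split=> [xy|Gxy].
  have : lcoset_set Gamma y y by exists 1; rewrite ?mulg1.
  by rewrite -xy => -[h Gh <-]; rewrite mulgA mulVg mul1g.
apply/seteqP; split=> _ [h Gh <-].
  exists ((x^-1 * y)^-1 * h); first exact: GM.
  by rewrite invgM invgK !mulgA mulgV mul1g.
exists (x^-1 * y * h); first exact: subgroupM.
by rewrite !mulgA mulgV mul1g.
Qed.

Lemma hproj_repr (x : hspace Gamma) : hproj Gamma (repr x) = x.
Proof. exact: reprK. Qed.

Lemma hproj_surj (x : hspace Gamma) : exists g, hproj Gamma g = x.
Proof. by exists (repr x); exact: hproj_repr. Qed.

Lemma hprojMr x h : Gamma h -> hproj Gamma (x * h) = hproj Gamma x.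
Proof.
by move=> Gh; apply/esym/hprojP; rewrite mulgA mulVg mul1g.
Qed.

Lemma hproj_eqM x y : hproj Gamma x = hproj Gamma y -> exists2 h, Gamma h & y = x * h.
Proof.
by move=> /hprojP h; exists (x^-1 * y); rewrite // mulgA mulgV mul1g.
Qed.

Lemma lact_hproj g x : lact Gamma g (hproj Gamma x) = hproj Gamma (g * x).
Proof.
rewrite /lact; apply/esym/hprojP; rewrite invgM mulgA -(mulgA _ g^-1) mulVg mulg1.
by apply/hprojP; rewrite hproj_repr.
Qed.

Lemma lactM g h (x : hspace Gamma) : lact Gamma (g * h) x = lact Gamma g (lact Gamma h x).
Proof. by have [y <-] := hproj_surj x; rewrite !lact_hproj mulgA. Qed.

Lemma lact1 (x : hspace Gamma) : lact Gamma 1 x = x.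
Proof. by have [y <-] := hproj_surj x; rewrite lact_hproj mul1g. Qed.

Lemma iter_lact g k (x : hspace Gamma) : iter k (lact Gamma g) x = lact Gamma (g ^+ k) x.
Proof.
elim: k x => [|k IH] x; first by rewrite expg0 lact1.
by rewrite iterS IH -lactM expgS.
Qed.

Lemma open_hspaceP (U : set (hspace Gamma)) : open U <-> open (hproj Gamma @^-1` U).
Proof. by []. Qed.

Lemma closed_hspaceP (U : set (hspace Gamma)) : closed U <-> closed (hproj Gamma @^-1` U).
Proof.
by rewrite -openC -[X in _ <-> X]openC open_hspaceP preimage_setC.
Qed.

Hypothesis mulr_cont : forall h, Gamma h -> continuous (fun x : G => x * h).

Lemma open_hproj (U : set G) : open U -> open (hproj Gamma @` U).
Proof.
move=> oU; apply/open_hspaceP.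
have -> : hproj Gamma @^-1` (hproj Gamma @` U) =
    \bigcup_(h in Gamma) ((fun x => x * h) @^-1` U).
  apply/seteqP; split=> x /=.
    move=> [y Uy] /esym/hproj_eqM[h Gh yE]; exists h => //=.
    by rewrite -yE.
  by move=> [h Gh /= Uxh]; exists (x * h) => //; exact: hprojMr.
apply: bigcup_open => h Gh; by apply: open_comp => // x _; exact: mulr_cont.
Qed.

Hypothesis mull_cont : forall g : G, continuous (fun x : G => g * x).

Lemma continuous_lact g : continuous (lact Gamma g : hspace Gamma -> hspace Gamma).
Proof.
apply/continuousP => U oU; apply/open_hspaceP.
have -> : hproj Gamma @^-1` (lact Gamma g @^-1` U) =
    (fun x => g * x) @^-1` (hproj Gamma @^-1` U).
  by apply/seteqP; split=> x /=; rewrite lact_hproj.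
by apply: open_comp => [x _|]; [exact: mull_cont|exact/open_hspaceP].
Qed.

End homogeneous_space_theory.

Section borel.
Variables (G : preTopologicalGroupType) (Gamma : set G).

Lemma open_borel (U : set (hspace Gamma)) : open U ->
  measurable (U : set (borel_hspace Gamma)).
Proof. by move=> oU; exact: sub_sigma_algebra. Qed.

Lemma closed_borel (U : set (hspace Gamma)) : closed U ->
  measurable (U : set (borel_hspace Gamma)).
Proof.
by move=> cU; rewrite -[U]setCK; apply: measurableC; apply: open_borel; exact: closed_openC.
Qed.

Lemma measurable_into_borel d (T : measurableType d) (f : T -> borel_hspace Gamma) :
  (forall U : set (hspace Gamma), open U -> measurable (f @^-1` U)) ->
  measurable_fun setT f.
Proof.
move=> fU.
apply: (@measurability _ _ T (borel_hspace Gamma) setT f (@open (hspace Gamma)) erefl).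
by move=> _ [U oU <-]; rewrite setTI; exact: fU.
Qed.

End borel.

(** * Topology of the groups *)

Section matrix_continuity.
Variables (R : realType) (T : topologicalType).

Lemma mx_continuous (m n : nat) (f : T -> 'M[R]_(m, n)) :
  (forall i j, continuous (fun x => f x i j)) -> continuous f.
Proof.
move=> fc x U [/= P Px PU].
have : \forall y \near x, forall i j, P i j (f y i j).
  apply: filter_forall => i; apply: filter_forall => j.
  by apply: (fc i j x); exact: Px.
by apply: filterS => y Py; apply: PU.
Qed.

Lemma entry_continuous (m n : nat) (f : T -> 'M[R]_(m, n)) (i : 'I_m) (j : 'I_n) :
  continuous f -> continuous (fun x => f x i j).
Proof. move=> fc x; apply: (@continuous_comp _ _ _ f (fun M : 'M[R]_(m, n) => M i j)).
  exact: fc.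
exact: coord_continuous. Qed.

Lemma sum_continuous (I : finType) (f : I -> T -> R) :
  (forall i, continuous (f i)) -> continuous (fun x => \sum_i f i x).
Proof.
by move=> fc x; apply: cvg_big; [exact: add_continuous|move=> i _; exact: fc].
Qed.

Lemma mulmx_continuous (m n p : nat) (f : T -> 'M[R]_(m, n)) (g : T -> 'M[R]_(n, p)) :
  continuous f -> continuous g -> continuous (fun x => f x *m g x).
Proof.
move=> fc gc; apply: mx_continuous => i j.
under eq_fun do rewrite mxE.
apply: sum_continuous => k x.
by apply: continuousM; exact: entry_continuous.
Qed.

Lemma prod_continuous (I : finType) (f : I -> T -> R) :
  (forall i, continuous (f i)) -> continuous (fun x => \prod_i f i x).
Proof.
by move=> fc x; apply: cvg_big; [exact: mul_continuous|move=> i _; exact: fc].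
Qed.

Lemma fun_inv_continuous (f : T -> R) :
  (forall x, f x != 0) -> continuous f -> continuous (fun x => (f x)^-1).
Proof. by move=> f0 fc x; apply: cvgV; [exact: f0|exact: fc]. Qed.

Lemma fun_mul_continuous (f g : T -> R) :
  continuous f -> continuous g -> continuous (fun x => f x * g x).
Proof. by move=> fc gc x; apply: cvgM; [exact: fc|exact: gc]. Qed.

Lemma fun_addr_continuous (f g : T -> R) :
  continuous f -> continuous g -> continuous (fun x => f x + g x).
Proof. by move=> fc gc x; apply: cvgD; [exact: fc|exact: gc]. Qed.

Lemma fun_add_continuous (m n : nat) (f g : T -> 'M[R]_(m, n)) :
  continuous f -> continuous g -> continuous (fun x => f x + g x).
Proof.
move=> fc gc; apply: mx_continuous => i j.
have -> : (fun x => (f x + g x) i j) = (fun x => f x i j + g x i j).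
  by apply/funext => x; rewrite mxE.
by apply: fun_addr_continuous; exact: entry_continuous.
Qed.

Lemma det_continuous (n : nat) (f : T -> 'M[R]_n) :
  continuous f -> continuous (fun x => \det (f x)).
Proof.
move=> fc; apply: sum_continuous => s x; apply: cvgMl_tmp.
by apply: prod_continuous => i; exact: entry_continuous.
Qed.

Lemma open_box (m n : nat) (f : T -> 'M[R]_(m, n)) (M : 'M[R]_(m, n)) (e : R) :
  continuous f -> open [set x | forall i j, `|f x i j - M i j| < e].
Proof.
move=> fc; rewrite openE => x xM; rewrite /interior.
apply: filter_forall => i; apply: filter_forall => j.
have c : continuous (fun y => f y i j - M i j).
  apply: fun_addr_continuous; last exact: cst_continuous.
  exact: entry_continuous.
by apply: (cvgr_norm_lt _ (c x)); exact: xM.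
Qed.

(** Integer matrices are uniformly separated, so that all their subsets are
    closed. *)
Lemma closed_integer_preimage (m n : nat) (f : T -> 'M[R]_(m, n)) (D : set 'M[R]_(m, n)) :
  continuous f -> (forall M, D M -> M \is a mxOver Num.int) -> closed (f @^-1` D).
Proof.
move=> fc Dint x clx.
have near_x (e : R) : 0 < e -> \forall y \near x, forall i j, `|f x i j - f y i j| < e.
  move=> e0; apply: filter_forall => i; apply: filter_forall => j.
  by have := entry_continuous (i := i) (j := j) fc (x := x); move/cvgrPdist_lt/(_ _ e0).
have half0 : 0 < 2^-1 :> R by rewrite invr_gt0 ltr0n.
have [y [Dy xy]] := clx _ (near_x 2^-1 half0).
have [fxy|neq] := eqVneq (f x) (f y); first by rewrite /preimage /= fxy.
have [i [j nij]] : exists i j, f x i j != f y i j.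
  apply: contrapT => h; case/eqP: neq; apply/matrixP => i j.
  by apply: contrapT => /eqP hij; apply: h; exists i, j.
pose e := Num.min 2^-1 `|f x i j - f y i j|.
have e0 : 0 < e by rewrite lt_min half0 normr_gt0 subr_eq0.
have [z [Dz xz]] := clx _ (near_x e e0).
have := Dint _ Dy => /mxOverP/(_ i j)/intrP[a ya].
have := Dint _ Dz => /mxOverP/(_ i j)/intrP[b zb].
have := xy i j; have := xz i j; rewrite /e lt_min => /andP[xz1 xz2] xy1.
have ab : `|(a - b)%:~R : R| < 1.
  rewrite rmorphB /= -ya -zb.
  have -> : f y i j - f z i j = (f x i j - f z i j) - (f x i j - f y i j) by ring.
  apply: le_lt_trans (ler_normB _ _) _.
  by have := ltrD xz1 xy1; lra.
have : a - b = 0.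
  by apply/eqP; move: ab; rewrite -intr_norm -[1]/(1%:~R) ltr_int; case: (a - b) => [[|k]|k].
move=> /eqP; rewrite subr_eq0 => /eqP ab0.
by move: xz2; rewrite zb -ab0 -ya ltxx.
Qed.

End matrix_continuity.

Section points_topology.
Variables (R : realType) (n : nat) (P : matgrp R n).

Lemma continuous_val : continuous (val : points P -> 'M[R]_n).
Proof. exact: initial_continuous. Qed.

Lemma continuous_points (T : topologicalType) (f : T -> points P) :
  continuous (fun x => val (f x)) -> continuous f.
Proof. by move=> fc; apply: continuous_comp_initial. Qed.

End points_topology.

Section group_topology.
Variables (R : realType) (n : nat) (G : alg_group R n) (d : nat).
Variable rho : rat_rep G d.
Local Notation G0 := (points (real_grp G)).

Lemma continuous_mull (g : G0) : continuous (fun x : G0 => (g * x)%g).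
Proof.
apply: continuous_points; apply: mulmx_continuous => //; first exact: cst_continuous.
exact: continuous_val.
Qed.

Lemma continuous_mulr (g : G0) : continuous (fun x : G0 => (x * g)%g).
Proof.
apply: continuous_points; apply: mulmx_continuous => //; last exact: cst_continuous.
exact: continuous_val.
Qed.

Lemma continuous_gl_row i : continuous (fun g : G0 => gl_row (val g) 0 i).
Proof.
case: (split_ordP i) => j ->.
  case/mxvec_indexP: j => k l.
  have -> : (fun g : G0 => gl_row (val g) 0 (lshift 1 (mxvec_index k l))) =
      (fun g => val g k l).
    by apply/funext => g; rewrite /gl_row row_mxEl mxvecE.
  exact: (entry_continuous (@continuous_val R n (real_grp G))).
have -> : (fun g : G0 => gl_row (val g) 0 (rshift (n * n) j)) =
    (fun g => (\det (val g))^-1).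
  by apply/funext => g; rewrite /gl_row row_mxEr mxE (ord1 j) mulr1n.
apply: fun_inv_continuous; last exact: (det_continuous (@continuous_val R n (real_grp G))).
by move=> g; have [+ _] := pt_in g; rewrite unitmxE unitfE.
Qed.

Lemma continuous_meval (p : mpoly (n * n + 1) R) :
  continuous (fun g : G0 => meval (gl_row (val g) 0) p).
Proof.
elim/mpoly_ring_ind: p => [c|i|p q pc qc|p q pc qc].
- have -> : (fun g : G0 => meval (gl_row (val g) 0) (mpolyC (n * n + 1) c)) = (fun=> c).
    by apply/funext => g; rewrite mevalC.
  exact: cst_continuous.
- have -> : (fun g : G0 => meval (gl_row (val g) 0) (mpolyX R (mnm1 i))) =
      (fun g => gl_row (val g) 0 i).
    by apply/funext => g; rewrite mevalXU.
  exact: continuous_gl_row.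
- have -> : (fun g : G0 => meval (gl_row (val g) 0) (p + q)) =
      (fun g => meval (gl_row (val g) 0) p + meval (gl_row (val g) 0) q).
    by apply/funext => g; rewrite mevalD.
  exact: fun_addr_continuous.
- have -> : (fun g : G0 => meval (gl_row (val g) 0) (p * q)) =
      (fun g => meval (gl_row (val g) 0) p * meval (gl_row (val g) 0) q).
    by apply/funext => g; rewrite mevalM.
  exact: fun_mul_continuous.
Qed.

Lemma continuous_Rrep : continuous (fun g : G0 => Rrep rho g).
Proof.
apply: mx_continuous => i j.
have -> : (fun g : G0 => Rrep rho g i j) =
    (fun g => meval (gl_row (val g) 0) (map_mpoly (ratR R) (rr_mx rho i j))).
  by apply/funext => g; rewrite mxE (rat_evalE (ratR R)).
exact: continuous_meval.
Qed.

Lemma continuous_invg : continuous (fun g : G0 => (g^-1)%g).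
Proof.
apply: continuous_points; apply: mx_continuous => i j.
have E (g : G0) : val (g^-1)%g i j = (\det (val g))^-1 * cofactor (val g) j i.
  by rewrite /= /invmx; have [-> _] := pt_in g; rewrite !mxE.
have -> : (fun g : G0 => val (g^-1)%g i j) =
    (fun g : G0 => (\det (val g))^-1 * cofactor (val g) j i).
  by apply/funext => g; exact: E.
apply: fun_mul_continuous.
  apply: fun_inv_continuous; last exact: (det_continuous (@continuous_val R n (real_grp G))).
  by move=> g; have [+ _] := pt_in g; rewrite unitmxE unitfE.
apply: fun_mul_continuous; first exact: cst_continuous.
apply: det_continuous; apply: mx_continuous => k l.
have -> : (fun g : G0 => row' j (col' i (val g)) k l) =
    (fun g : G0 => val g (lift j k) (lift i l)) by apply/funext => h; rewrite !mxE.
exact: (entry_continuous (@continuous_val R n (real_grp G))).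
Qed.

Local Notation S := (semidirect rho).

Lemma continuous_sd_fst : continuous (fun x : S => x.1).
Proof. by move=> x; exact: cvg_fst. Qed.

Lemma continuous_sd_snd : continuous (fun x : S => x.2).
Proof. by move=> x; exact: cvg_snd. Qed.

Lemma continuous_sd (T : topologicalType) (f : T -> S) :
  continuous (fun x => (f x).1) -> continuous (fun x => (f x).2) -> continuous f.
Proof.
move=> f1 f2 x.
have -> : f = (fun x => ((f x).1, (f x).2)) by apply/funext => y; case: (f y).
exact: (cvg_pair (f1 x) (f2 x)).
Qed.

Lemma continuous_sd_mull (g : S) : continuous (fun x : S => (g * x)%g).
Proof.
apply: continuous_sd => /=.
  move=> x; apply: (@continuous_comp _ _ _ (fun x : S => x.1) (fun y : G0 => (g.1 * y)%g)); first exact: continuous_sd_fst.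
  exact: continuous_mull.
apply: fun_add_continuous; first exact: cst_continuous.
apply: mulmx_continuous; first exact: cst_continuous.
exact: continuous_sd_snd.
Qed.

Lemma continuous_sd_mulr (g : S) : continuous (fun x : S => (x * g)%g).
Proof.
apply: continuous_sd => /=.
  move=> x; apply: (@continuous_comp _ _ _ (fun x : S => x.1) (fun y : G0 => (y * g.1)%g)); first exact: continuous_sd_fst.
  exact: continuous_mulr.
apply: fun_add_continuous; first exact: continuous_sd_snd.
apply: mulmx_continuous; last exact: cst_continuous.
move=> y; apply: (@continuous_comp _ _ _ (fun x : S => x.1) (Rrep rho)); first exact: continuous_sd_fst.
exact: continuous_Rrep.
Qed.

End group_topology.

(** * A Borel section of the quotient map *)

Lemma measurable_fun_openP (R : realType) d (T : measurableType d) (f : T -> R) :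
  (forall O, open O -> measurable (f @^-1` O)) -> measurable_fun setT f.
Proof.
move=> fO; apply: (measurability _ (RGenOInfty.measurableE R)) => _ [_ [a ->] <-].
by rewrite setTI; apply: fO; exact: rray_open.
Qed.

Section lattice.
Variables (R : realType) (n : nat) (G : alg_group R n) (d : nat).
Variables (rho : rat_rep G d) (Gamma0 : set (points (real_grp G))).
Hypothesis hGamma0 : admissible_lattice rho Gamma0.
Local Notation G0 := (points (real_grp G)).
Local Notation Gamma := (semidirect_lattice rho Gamma0).
Local Notation X0 := (borel_hspace Gamma0).
Local Notation X := (borel_hspace Gamma).
Implicit Types (g h : G0) (u v w : 'cV[R]_d).

Lemma lattice_subgroup : is_subgroup Gamma0.
Proof. by case: hGamma0. Qed.

Lemma lattice_int g : Gamma0 g -> val g \is a mxOver Num.int.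
Proof. by case: hGamma0 => _ + _ _ => /[apply] -[]. Qed.

Lemma lattice_Rrep_int g : Gamma0 g -> Rrep rho g \is a mxOver Num.int.
Proof. by case: hGamma0 => _ _ _ /[apply] -[]. Qed.

Lemma Rrep_invl g : Rrep rho (g^-1)%g *m Rrep rho g = 1%:M.
Proof. by rewrite -RrepM mulVg Rrep1. Qed.

Lemma Rrep_invr g : Rrep rho g *m Rrep rho (g^-1)%g = 1%:M.
Proof. by rewrite -RrepM mulgV Rrep1. Qed.

Lemma mxOver_mul_int (m p q : nat) (A : 'M[R]_(m, p)) (B : 'M[R]_(p, q)) :
  A \is a mxOver Num.int -> B \is a mxOver Num.int -> A *m B \is a mxOver Num.int.
Proof. by move=> /mxOverP A_int /mxOverP B_int; apply/mxOverP => i j; rewrite mxE rpred_sum// => k _; rewrite rpredM. Qed.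

Lemma semidirect_lattice_subgroup : is_subgroup Gamma.
Proof.
have sub0 := lattice_subgroup; have [G1 GM] := sub0.
split=> [|x y [Gx xv] [Gy yv]].
  by split=> //=; apply/mxOverP => i j; rewrite mxE rpred0.
split; first exact: GM.
rewrite /= -mulmxN -mulmxDr; apply: mxOver_mul_int.
  by apply: lattice_Rrep_int; exact: subgroupV.
apply/mxOverP => i j; rewrite !mxE rpredD ?rpredN//; [exact: (mxOverP xv)|exact: (mxOverP yv)].
Qed.

(** Small open sets of the group on which the quotient map is injective. *)
Definition small_set (q : 'M[rat]_n) (k : nat) : set G0 :=
  [set g : G0 | (forall i j, `|val g i j - ratr (q i j)| < k.+1%:R^-1) /\
     forall i j, `|val (g^-1)%g i j| < k.+1%:R / (2 * n.+1%:R)].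

Lemma small_set_open q k : open (small_set q k).
Proof.
have -> : small_set q k =
    [set g : G0 | forall i j, `|val g i j - (map_mx ratr q : 'M[R]_n) i j| < k.+1%:R^-1] `&`
    [set g : G0 | forall i j,
       `|val (g^-1)%g i j - (0 : 'M[R]_n) i j| < k.+1%:R / (2 * n.+1%:R)].
  apply/seteqP; split=> g [g1 g2]; split=> i j.
  - by rewrite mxE.
  - by rewrite [X in _ - X]mxE subr0.
  - by have := g1 i j; rewrite mxE.
  - by have := g2 i j; rewrite [X in _ - X]mxE subr0.
apply: openI.
  exact: (open_box _ _ (@continuous_val R n (real_grp G))).
apply: (@open_box _ _ _ _ (fun g : G0 => val (g^-1)%g)) => g.
apply: (@continuous_comp _ _ _ (fun h : G0 => (h^-1)%g) val).
  exact: continuous_invg.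
exact: continuous_val.
Qed.

Lemma small_set_inj q k g h : Gamma0 h -> small_set q k g -> small_set q k (g * h)%g ->
  h = 1%g.
Proof.
move=> Gh [g1 g2] [gh1 _]; apply: val_inj; rewrite /=.
have hE : val h - 1%:M = val (g^-1)%g *m (val (g * h)%g - val g).
  by rewrite mulmxBr -[X in _ = X - _]/(val (g^-1 * (g * h))%g) -[X in _ = _ - X]/(val (g^-1 * g)%g) mulgA mulVg mul1g.
apply/matrixP => i j.
have : `|(val h - 1%:M) i j| < 1.
  rewrite hE mxE.
  have K0 : 0 < k.+1%:R :> R by rewrite ltr0n.
  have n0 : 0 < n.+1%:R :> R by rewrite ltr0n.
  apply: (@le_lt_trans _ _ (\sum_(l < n) (n.+1%:R^-1))).
    apply: le_trans (ler_norm_sum _ _ _) _; apply: ler_sum => l _.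
    rewrite normrM.
    have d2 : `|(val (g * h)%g - val g) l j| <= 2 / k.+1%:R.
      have -> : (val (g * h)%g - val g) l j =
          (val (g * h)%g l j - ratr (q l j)) - (val g l j - ratr (q l j)).
        by rewrite !mxE; ring.
      apply: le_trans (ler_normB _ _) _.
      rewrite (_ : 2 / _ = k.+1%:R^-1 + k.+1%:R^-1); last by rewrite mulrDl mul1r.
      by apply: lerD; apply: ltW; [exact: gh1|exact: g1].
    apply: le_trans (ler_pM _ _ (ltW (g2 i l)) d2) _ => //.
    have -> : k.+1%:R / (2 * n.+1%:R) * (2 / k.+1%:R) = n.+1%:R^-1 :> R.
      by field; rewrite !gt_eqF.
    by [].
  rewrite sumr_const card_ord -[_ *+ n]mulr_natl ltr_pdivrMr// mul1r ltr_nat ltnSn //.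
have /mxOverP/(_ i j) := lattice_int Gh; rewrite [(val h - _) i j]mxE [in X in _ + X]mxE.
move=> /intrP[a ->]; rewrite mxE => h1.
have : a - (i == j)%:Z = 0.
  have : `|(a - (i == j)%:Z)%:~R : R| < 1 by rewrite rmorphB.
  rewrite -intr_norm -[1]/(1%:~R) ltr_int.
  by case: (a - _) => [[|m]|m].
by move=> /eqP; rewrite subr_eq0 => /eqP ->.
Qed.

Lemma small_set_cover g : exists q k, small_set q k g.
Proof.
pose M : R := \sum_i \sum_j `|val (g^-1)%g i j|.
have gM i j : `|val (g^-1)%g i j| <= M.
  rewrite /M (bigD1 i)//= (bigD1 j)//= -addrA lerDl.
  by rewrite addr_ge0// sumr_ge0// => l _; rewrite sumr_ge0.
have n0 : 0 < 2 * n.+1%:R :> R by rewrite mulr_gt0.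
pose k := Num.truncn (M * (2 * n.+1%:R)).
have /choice[qf qfP] (ij : 'I_n * 'I_n) : exists q : rat, `|val g ij.1 ij.2 - ratr q| < k.+1%:R^-1.
  have lt_itv : val g ij.1 ij.2 - k.+1%:R^-1 < val g ij.1 ij.2 + k.+1%:R^-1.
    by rewrite ltrD2l gtrN// invr_gt0.
  have [q] := rat_in_itvoo lt_itv; rewrite in_itv /= => /andP[q1 q2].
  exists q; rewrite ltr_norml; apply/andP; split; first by rewrite ltrNl opprB ltrBlDl.
  by rewrite ltrBlDl -ltrBlDr.
exists (\matrix_(i, j) qf (i, j)), k; split=> i j.
  by rewrite mxE; exact: (qfP (i, j)).
rewrite ltr_pdivlMr//; apply: (@le_lt_trans _ _ (M * (2 * n.+1%:R))).
  by rewrite ler_pM2r.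
by rewrite truncnS_gt.
Qed.

Definition chart i : set G0 :=
  if unpickle i is Some (q, k) then small_set q k else set0.

Lemma chart_open i : open (chart i).
Proof.
rewrite /chart; case: unpickle => [[q k]|]; [exact: small_set_open|exact: open0].
Qed.

Lemma chart_inj i g h : chart i g -> chart i h ->
  hproj Gamma0 g = hproj Gamma0 h -> g = h.
Proof.
rewrite /chart; case: unpickle => [[q k]|//] gq hq /(hproj_eqM lattice_subgroup)[c Gc hE].
by rewrite hE in hq *; rewrite (small_set_inj Gc gq hq) mulg1.
Qed.

Lemma chart_cover (x : X0) : exists i, `[< (hproj Gamma0 @` chart i) x >].
Proof.
have [g <-] := hproj_surj x; have [q [k gqk]] := small_set_cover g.
by exists (pickle (q, k)); apply/asboolP; exists g => //; rewrite /chart pickleK.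
Qed.

Definition chart_index x : nat := ex_minn (chart_cover x).

Lemma chart_indexP x : exists g, chart (chart_index x) g /\ hproj Gamma0 g = x.
Proof.
by rewrite /chart_index; case: ex_minnP => i /asboolP[g gi <-] _; exists g.
Qed.

(** Points are lifted to the first chart which reaches them, so that the section
    is continuous on each of countably many Borel pieces. *)
Definition sec (x : X0) : G0 := sval (cid (chart_indexP x)).

Lemma sec_chart x : chart (chart_index x) (sec x).
Proof. by rewrite /sec; case: cid => g []. Qed.

Lemma sec_proj x : hproj Gamma0 (sec x) = x.
Proof. by rewrite /sec; case: cid => g []. Qed.

Definition piece i : set X0 := [set x | chart_index x = i].

Lemma sec_eq i g : chart i g -> piece i (hproj Gamma0 g) -> sec (hproj Gamma0 g) = g.
Proof.
move=> gi pi; apply: (chart_inj (i := i)) => //; last exact: sec_proj.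
by rewrite -{1}pi; exact: sec_chart.
Qed.

Lemma open_hproj0 (U : set G0) : open U -> open (hproj Gamma0 @` U).
Proof.
by apply: open_hproj; [exact: lattice_subgroup|move=> h _; exact: continuous_mulr].
Qed.

Lemma measurable_piece i : measurable (piece i).
Proof.
have -> : piece i = (hproj Gamma0 @` chart i) `\` \bigcup_(j < i) (hproj Gamma0 @` chart j).
  apply/seteqP; split=> x /=.
    move=> <-; have [g [gi gx]] := chart_indexP x; split; first by exists g.
    move=> [j /= ji [h hj hx]]; move: ji; rewrite /chart_index.
    case: ex_minnP => m _ mmin; rewrite ltnNge mmin//.
    by apply/asboolP; exists h.
  move=> [xi xj]; rewrite /piece /= /chart_index; case: ex_minnP => m /asboolP xm mmin.
  apply/eqP; rewrite eqn_leq mmin; last exact/asboolP.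
  by rewrite leqNgt; apply/negP => mi; apply: xj; exists m.
apply: measurableD; first by apply: open_borel; apply: open_hproj0; exact: chart_open.
apply: bigcup_measurable => j _; apply: open_borel; apply: open_hproj0; exact: chart_open.
Qed.

Lemma measurable_sec (O : set G0) : open O -> measurable (sec @^-1` O).
Proof.
move=> oO.
have -> : sec @^-1` O = \bigcup_i (piece i `&` (hproj Gamma0 @` (chart i `&` O))).
  apply/seteqP; split=> x /=.
    move=> Ox; exists (chart_index x) => //; split=> //; exists (sec x); last exact: sec_proj.
    by split=> //; exact: sec_chart.
  move=> [i _ [xi [g [gi gO] gx]]]; rewrite -gx in xi *.
  by rewrite (sec_eq gi xi).
apply: bigcupT_measurable => i; apply: measurableI; first exact: measurable_piece.
apply: open_borel; apply: open_hproj0; apply: openI => //; exact: chart_open.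
Qed.

Lemma measurable_fun_sec (f : G0 -> R) : continuous f -> measurable_fun setT (f \o sec).
Proof.
move=> fc; apply: measurable_fun_openP => O oO.
rewrite comp_preimage; apply: measurable_sec.
by apply: open_comp => // x _; exact: fc.
Qed.

End lattice.

(** * Coordinates on the torus bundle *)

Definition intv (R : realType) (d : nat) (eta : 'cV[int]_d) : 'cV[R]_d := map_mx intr eta.
Arguments intv R {d} eta.
Definition dotp (R : realType) (d : nat) (xi v : 'cV[R]_d) : R := (xi^T *m v) 0 0.

Section dot_product.
Variables (R : realType) (d : nat).
Implicit Types (xi zeta v w : 'cV[R]_d).

Lemma dotpC xi v : dotp xi v = dotp v xi.
Proof.
by rewrite /dotp !mxE; apply: eq_bigr => i _; rewrite !mxE mulrC.
Qed.

Lemma dotpDl xi zeta v : dotp (xi + zeta) v = dotp xi v + dotp zeta v.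
Proof. by rewrite /dotp linearD mulmxDl mxE. Qed.

Lemma dotpNl xi v : dotp (- xi) v = - dotp xi v.
Proof. by rewrite /dotp linearN mulNmx mxE. Qed.

Lemma dotpDr xi v w : dotp xi (v + w) = dotp xi v + dotp xi w.
Proof. by rewrite /dotp mulmxDr mxE. Qed.

Lemma dotp_mulmx (M : 'M[R]_d) xi v : dotp xi (M *m v) = dotp (M^T *m xi) v.
Proof. by rewrite /dotp trmx_mul trmxK mulmxA. Qed.

Lemma dotp_delta xi (c : R) i : dotp xi (c *: delta_mx i 0) = c * xi i 0.
Proof.
rewrite /dotp -scalemxAr mxE; congr (_ * _).
rewrite mxE (bigD1 i)//= !mxE !eqxx mulr1 big1 ?addr0// => j ji.
by rewrite !mxE (negPf ji) mulr0.
Qed.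

Lemma dotp_intv (eta m : 'cV[int]_d) :
  dotp (intv R eta) (intv R m) = ((eta^T *m m) 0 0)%:~R.
Proof.
rewrite /dotp !mxE rmorph_sum; apply: eq_bigr => j _.
by rewrite !mxE rmorphM.
Qed.

Lemma intvD (eta m : 'cV[int]_d) : intv R (eta + m) = intv R eta + intv R m.
Proof. by rewrite /intv map_mxD. Qed.

Lemma intvN (eta : 'cV[int]_d) : intv R (- eta) = - intv R eta.
Proof. by rewrite /intv map_mxN. Qed.

Lemma intv_eq0 (eta : 'cV[int]_d) : (intv R eta == 0) = (eta == 0).
Proof.
apply/eqP/eqP => [/matrixP h|->]; last by rewrite /intv map_mx0.
apply/matrixP => i j; have /eqP := h i j.
by rewrite !mxE intr_eq0 => /eqP.
Qed.

Lemma int_vectorP v : v \is a mxOver Num.int -> exists m, v = intv R m.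
Proof.
move=> /mxOverP vint.
have /choice[m mP] i : exists z : int, v i 0 = z%:~R by exact/intrP.
by exists (\col_i m i); apply/matrixP => i j; rewrite !mxE (ord1 j).
Qed.

Lemma intv_int (m : 'cV[int]_d) : intv R m \is a mxOver Num.int.
Proof. by apply/mxOverP => i j; rewrite mxE intr_int. Qed.

End dot_product.

Lemma cos_addz (R : realType) (x : R) (z : int) : cos (x + pi *+ 2 * z%:~R) = cos x.
Proof.
have cosn (t : R) (k : nat) : cos (t + pi *+ 2 * k%:R) = cos t.
  by rewrite mulr_natr (periodicn (@cosD2pi R)).
case: z => k; first exact: cosn.
by rewrite NegzE rmorphN /= mulrN -(cosn _ k.+1) subrK.
Qed.

Section torus_bundle.
Variables (R : realType) (n : nat) (G : alg_group R n) (d : nat).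
Variables (rho : rat_rep G d) (Gamma0 : set (points (real_grp G))).
Hypothesis hGamma0 : admissible_lattice rho Gamma0.
Local Notation G0 := (points (real_grp G)).
Local Notation S := (semidirect rho).
Local Notation Gamma := (semidirect_lattice rho Gamma0).
Local Notation X0 := (borel_hspace Gamma0).
Local Notation X := (borel_hspace Gamma).
Local Notation bp := (@bundle_proj R n G d rho Gamma0).
Implicit Types (g h : G0) (u v w xi : 'cV[R]_d) (x : X0) (y : X) (eta : 'cV[int]_d).

Let sub0 := lattice_subgroup hGamma0.
Let subG := semidirect_lattice_subgroup hGamma0.

Lemma bundle_projE (s : S) : bp (hproj Gamma s) = hproj Gamma0 s.1.
Proof.
have [h [Gh _] hE] := hproj_eqM subG (esym (hproj_repr (hproj Gamma s : X))).
by rewrite /bundle_proj hE /= hprojMr.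
Qed.

Lemma bundle_proj_lact (s : S) y : bp (lact Gamma s y) = lact Gamma0 s.1 (bp y).
Proof.
have [t <-] := hproj_surj (y : hspace Gamma).
by rewrite (lact_hproj subG) !bundle_projE (lact_hproj sub0).
Qed.

Lemma measurable_bundle_proj : measurable_fun setT bp.
Proof.
apply: measurable_into_borel => U oU; apply: open_borel; apply/open_hspaceP.
have -> : hproj Gamma @^-1` (bp @^-1` U) = (fun s : S => s.1) @^-1` (hproj Gamma0 @^-1` U).
  by apply/seteqP; split=> s /=; rewrite bundle_projE.
by apply: open_comp => // s _; exact: continuous_sd_fst.
Qed.

Lemma measurable_lact0 g : measurable_fun setT (lact Gamma0 g : X0 -> X0).
Proof.
apply: measurable_into_borel => U oU; apply: open_borel.
apply: open_comp => // x _; apply: continuous_lact; first exact: sub0.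
by move=> h; exact: continuous_mull.
Qed.

Lemma measurable_lact (s : S) : measurable_fun setT (lact Gamma s : X -> X).
Proof.
apply: measurable_into_borel => U oU; apply: open_borel.
apply: open_comp => // x _; apply: continuous_lact; first exact: subG.
by move=> h; exact: continuous_sd_mull.
Qed.

Lemma measurable_point x : measurable [set x].
Proof.
apply: closed_borel; apply/closed_hspaceP.
have [h <-] := hproj_surj (x : hspace Gamma0).
have -> : hproj Gamma0 @^-1` [set hproj Gamma0 h] =
    (fun g : G0 => val (h^-1 * g)%g) @^-1` [set val g | g in Gamma0].
  apply/seteqP; split=> g /=.
    by move=> /esym/(hprojP sub0) Gg; exists (h^-1 * g)%g.
  move=> [c Gc vE]; have cE : c = (h^-1 * g)%g by exact: val_inj.
  apply/esym/(hprojP sub0).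
  by rewrite -cE.
apply: closed_integer_preimage => [g|_ [g Gg <-]].
  apply: (@continuous_comp _ _ _ (fun g : G0 => (h^-1 * g)%g) val).
    exact: continuous_mull.
  exact: continuous_val.
exact: (lattice_int hGamma0).
Qed.

(** Coordinates identifying each fiber with the standard torus; they are only
    meaningful modulo integer vectors. *)
Definition ucoord y : 'cV[R]_d := Rrep rho (sec (bp y))^-1%g *m (repr y).2.

Lemma torus_point_eq g u u' :
  hproj Gamma ((g, Rrep rho g *m u) : S) = hproj Gamma ((g, Rrep rho g *m u') : S) ->
  exists m, u' = u + intv R m.
Proof.
move=> /(hproj_eqM subG)[[h1 h2] [/= Gh /int_vectorP[m ->]] [_ /= e]].
exists m; have := congr1 (fun w => Rrep rho g^-1%g *m w) e.
by rewrite mulmxDr !mulmxA Rrep_invl !mul1mx.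
Qed.

Lemma torus_pointD g u m :
  hproj Gamma ((g, Rrep rho g *m (u + intv R m)) : S) =
  hproj Gamma ((g, Rrep rho g *m u) : S).
Proof.
have -> : ((g, Rrep rho g *m (u + intv R m)) : S) =
    (((g, Rrep rho g *m u) : S) * ((1%g, intv R m) : S))%g.
  by rewrite /= [RHS]/(_ * _)%g /= /sd_mul /= mulg1 mulmxDr.
apply: (hprojMr subG); split; first by have [] := sub0.
exact: intv_int.
Qed.

Lemma ucoordE y : y = hproj Gamma ((sec (bp y), Rrep rho (sec (bp y)) *m ucoord y) : S).
Proof.
rewrite /ucoord mulmxA Rrep_invr mul1mx.
have := sec_proj (bp y); rewrite {2}/bundle_proj => /(hproj_eqM sub0)[c Gc rE].
have rE2 : repr y = (((sec (bp y), (repr y).2) : S) * ((c, 0) : S))%g.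
  rewrite [RHS]/(_ * _)%g /= /sd_mul /= mulmx0 addr0 -rE.
  by case: (repr y).
rewrite -{1}[y]hproj_repr {1}rE2; apply: (hprojMr subG); split => //=.
by apply/mxOverP => i j; rewrite mxE rpred0.
Qed.

Lemma ucoord_sec x u : exists m,
  ucoord (hproj Gamma ((sec x, Rrep rho (sec x) *m u) : S)) = u + intv R m.
Proof.
set y := hproj _ _; have by_ : bp y = x by rewrite bundle_projE sec_proj.
apply: (@torus_point_eq (sec x)); rewrite -[LHS]/y.
by have := ucoordE y; rewrite by_.
Qed.

(** The covector of R^d by which the character [eta] of the standard torus acts on
    the universal cover of the fiber over [x], seen through the section: these are
    the elements of the lattice dual to the one defining the fiber. *)
Definition frequency eta x : 'cV[R]_d := (Rrep rho (sec x)^-1%g)^T *m intv R eta.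

(** [Phi] is, on the fiber over [x] and modulo 2 pi, an affine function with linear
    part [2 pi xi]. *)
Definition phase x (Phi : X -> R) xi := forall y, bp y = x -> forall v,
  exists z : int, Phi (lact Gamma (1%g, v) y) = Phi y + pi *+ 2 * (dotp xi v + z%:~R).

Definition std_phase eta (theta : R) y := pi *+ 2 * dotp (intv R eta) (ucoord y) + theta.

Lemma std_phaseP eta theta x : phase x (std_phase eta theta) (frequency eta x).
Proof.
move=> y yx v; set s := sec x.
have yE : y = hproj Gamma ((s, Rrep rho s *m ucoord y) : S).
  by have := ucoordE y; rewrite yx.
have ly : lact Gamma (1%g, v) y =
    hproj Gamma ((s, Rrep rho s *m (ucoord y + Rrep rho s^-1%g *m v)) : S).
  rewrite {1}yE (lact_hproj subG) [X in hproj _ X]/(_ * _)%g /= /sd_mul /=.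
  by rewrite mul1g Rrep1 mul1mx mulmxDr [in RHS]mulmxA Rrep_invr mul1mx addrC.
have [m mE] := ucoord_sec x (ucoord y + Rrep rho s^-1%g *m v).
exists ((eta^T *m m) 0 0).
rewrite /std_phase ly mE !dotpDr dotp_intv dotp_mulmx -/(frequency eta x).
ring.
Qed.

Lemma phaseD x Phi Psi xi zeta : phase x Phi xi -> phase x Psi zeta ->
  phase x (fun y => Phi y + Psi y) (xi + zeta).
Proof.
move=> h1 h2 y yx v; have [z1 ->] := h1 y yx v; have [z2 ->] := h2 y yx v.
by exists (z1 + z2); rewrite dotpDl rmorphD /=; ring.
Qed.

Lemma phaseB x Phi Psi xi zeta : phase x Phi xi -> phase x Psi zeta ->
  phase x (fun y => Phi y - Psi y) (xi - zeta).
Proof.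
move=> h1 h2 y yx v; have [z1 ->] := h1 y yx v; have [z2 ->] := h2 y yx v.
by exists (z1 - z2); rewrite dotpDl dotpNl rmorphB /=; ring.
Qed.

Lemma phase_lact (s : S) x Phi xi : phase (lact Gamma0 s.1 x) Phi xi ->
  phase x (fun y => Phi (lact Gamma s y)) ((Rrep rho s.1)^T *m xi).
Proof.
move=> h y yx v; have sE : (s * ((1%g, v) : S) = ((1%g, Rrep rho s.1 *m v) : S) * s)%g.
  rewrite [LHS]/(_ * _)%g [RHS]/(_ * _)%g /= /sd_mul /= mulg1 mul1g Rrep1 mul1mx.
  by rewrite addrC.
have [|z zE] := h (lact Gamma s y) _ (Rrep rho s.1 *m v).
  by rewrite bundle_proj_lact yx.
by exists z; rewrite -(lactM subG) sE (lactM subG) zE dotp_mulmx.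
Qed.

Definition wave eta theta y : R := cos (std_phase eta theta y).

Lemma measurable_wave eta theta : measurable_fun setT (wave eta theta).
Proof.
pose F (s : S) : R := cos (pi *+ 2 * dotp (intv R eta) (Rrep rho s.1^-1%g *m s.2) + theta).
have Fc : continuous F.
  have c1 : continuous (fun s : S => Rrep rho s.1^-1%g *m s.2).
    apply: mulmx_continuous; last exact: continuous_sd_snd.
    move=> s; apply: (@continuous_comp _ _ _ (fun s : S => s.1^-1%g) (Rrep rho)); last exact: continuous_Rrep.
    apply: (@continuous_comp _ _ _ (fun s : S => s.1) (fun g : G0 => (g^-1)%g)); last exact: continuous_invg.
    exact: continuous_sd_fst.
  move=> s; apply: (@continuous_comp _ _ _
    (fun s : S => pi *+ 2 * dotp (intv R eta) (Rrep rho s.1^-1%g *m s.2) + theta) (@cos R)); last exact: continuous_cos.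
  apply: fun_addr_continuous; last exact: cst_continuous.
  apply: fun_mul_continuous; first exact: cst_continuous.
  apply: entry_continuous; apply: mulmx_continuous => //; exact: cst_continuous.
have FE y : F (sec (bp y), Rrep rho (sec (bp y)) *m ucoord y) = wave eta theta y.
  by rewrite /F /wave /std_phase /= mulmxA Rrep_invl mul1mx.
have waveF i (s : S) : @chart R n G i s.1 -> piece i (hproj Gamma0 s.1) ->
    wave eta theta (hproj Gamma s) = F s.
  case: s => g w /= ci pi_; have sE := sec_eq hGamma0 ci pi_.
  have [m mE] := ucoord_sec (hproj Gamma0 g) (Rrep rho g^-1%g *m w).
  rewrite sE mulmxA Rrep_invr mul1mx in mE.
  rewrite /wave /std_phase mE dotpDr dotp_intv mulrDr addrAC cos_addz.
  by rewrite /F.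
apply: measurable_fun_openP => O oO.
have -> : wave eta theta @^-1` O = \bigcup_i (bp @^-1` piece i `&`
    (hproj Gamma @` [set s : S | @chart R n G i s.1 /\ O (F s)])).
  apply/seteqP; split=> y /=.
    move=> Oy; exists (chart_index (bp y)) => //; split => //.
    exists ((sec (bp y), Rrep rho (sec (bp y)) *m ucoord y) : S); last by rewrite -ucoordE.
    by split; [exact: sec_chart|rewrite FE].
  move=> [i _ [pi_ [s [ci Os] sy]]].
  have pi' : piece i (hproj Gamma0 s.1) by rewrite -bundle_projE sy.
  by rewrite /preimage /= -sy (waveF i).
apply: bigcupT_measurable => i; apply: measurableI.
  by rewrite -[_ @^-1` _]setTI; apply: measurable_bundle_proj => //; exact: (measurable_piece hGamma0).
apply: open_borel; apply: open_hproj; first exact: subG.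
  by move=> h _; exact: continuous_sd_mulr.
apply: openI.
  apply: (@open_comp _ _ (fun s : S => s.1)); last exact: chart_open.
  by move=> s _; exact: continuous_sd_fst.
by apply: open_comp => // s _; exact: Fc.
Qed.

End torus_bundle.

(** * Integrals of bounded functions *)

Section bounded_functions.
Context d (T : measurableType d) (R : realType).
Implicit Types f g : T -> R.

Definition bounded_fun f := measurable_fun setT f /\ exists M, forall x, `|f x| <= M.

Lemma bounded_fun_cst (c : R) : bounded_fun (fun=> c).
Proof. by split; [exact: measurable_cst|exists `|c|]. Qed.

Lemma bounded_funD f g : bounded_fun f -> bounded_fun g ->
  bounded_fun (fun x => f x + g x).
Proof.
move=> [mf [M fM]] [mg [N gN]]; split; first exact: measurable_funD.
by exists (M + N) => x; apply: le_trans (ler_normD _ _) _; exact: lerD.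
Qed.

Lemma bounded_funM f g : bounded_fun f -> bounded_fun g ->
  bounded_fun (fun x => f x * g x).
Proof.
move=> [mf [M fM]] [mg [N gN]]; split; first exact: measurable_funM.
by exists (M * N) => x; rewrite normrM ler_pM.
Qed.

Lemma bounded_funZ (c : R) f : bounded_fun f -> bounded_fun (fun x => c * f x).
Proof. by move=> bf; apply: bounded_funM => //; exact: bounded_fun_cst. Qed.

Lemma bounded_funB f g : bounded_fun f -> bounded_fun g ->
  bounded_fun (fun x => f x - g x).
Proof.
move=> bf bg; have := bounded_funD bf (bounded_funZ (-1) bg).
by under [X in bounded_fun X -> _]eq_fun do rewrite mulN1r.
Qed.

Lemma bounded_fun_norm f : bounded_fun f -> bounded_fun (fun x => `|f x|).
Proof.
move=> [mf [M fM]]; split; first exact: measurableT_comp.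
by exists M => x; rewrite normr_id.
Qed.

Lemma bounded_fun_indic (A : set T) : measurable A -> bounded_fun (\1_A : T -> R).
Proof.
move=> mA; split; first exact: measurable_indic.
exists 1 => x; rewrite indicE; case: (_ \in _); rewrite ?normr1 ?normr0 ?ler01//.
Qed.

Variable m : {measure set T -> \bar R}.
Hypothesis m1 : m setT = 1%E.

Lemma bounded_integrable f : bounded_fun f -> m.-integrable setT (EFin \o f).
Proof.
move=> [mf [M fM]]; apply: measurable_bounded_integrable => //.
  by rewrite m1 ltry.
exists M; split; first exact: num_real.
by move=> N MN x _; apply: le_trans (fM x) (ltW MN).
Qed.

Lemma bintD f g : bounded_fun f -> bounded_fun g ->
  \int[m]_x (f x + g x) = \int[m]_x f x + \int[m]_x g x.
Proof. by move=> bf bg; rewrite RintegralD//; exact: bounded_integrable. Qed.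

Lemma bintB f g : bounded_fun f -> bounded_fun g ->
  \int[m]_x (f x - g x) = \int[m]_x f x - \int[m]_x g x.
Proof. by move=> bf bg; rewrite RintegralB//; exact: bounded_integrable. Qed.

Lemma bintZ (c : R) f : bounded_fun f ->
  \int[m]_x (c * f x) = c * \int[m]_x f x.
Proof. by move=> bf; rewrite RintegralZl//; exact: bounded_integrable. Qed.

Lemma bint_cst (c : R) : \int[m]_x c = c.
Proof. by rewrite Rintegral_cst// -[m _]/(m setT) m1 mulr1. Qed.

Lemma bint_indic (A : set T) : measurable A -> \int[m]_x \1_A x = fine (m A).
Proof. by move=> mA; rewrite /Rintegral integral_indic// setIT. Qed.

Lemma bint_le f g : bounded_fun f -> bounded_fun g -> (forall x, f x <= g x) ->
  \int[m]_x f x <= \int[m]_x g x.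
Proof. by move=> bf bg fg; apply: le_Rintegral => //; exact: bounded_integrable. Qed.

Lemma bint_norm f : bounded_fun f -> `|\int[m]_x f x| <= \int[m]_x `|f x|.
Proof. by move=> bf; apply: le_normr_Rintegral => //; exact: bounded_integrable. Qed.

Lemma bint_norm_le f (c : R) : bounded_fun f -> (forall x, `|f x| <= c) ->
  `|\int[m]_x f x| <= c.
Proof.
move=> bf fc; apply: le_trans (bint_norm bf) _; rewrite -[leRHS]bint_cst.
by apply: bint_le => //; [exact: bounded_fun_norm|exact: bounded_fun_cst].
Qed.

Lemma measure_setC0 (D : set T) : measurable D -> m D = 1%E -> m (~` D) = 0%E.
Proof.
move=> mD mD1; have : m D + m (~` D) = 1%E.
  by rewrite -measureU// ?setUv//; [exact: measurableC|rewrite setICr].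
rewrite mD1; have := measure_ge0 m (~` D).
by case: (m (~` D)) => [r| |]//= r0 [] h; congr EFin; lra.
Qed.

Lemma bint_on f g (D : set T) : measurable D -> m D = 1%E ->
  bounded_fun f -> bounded_fun g -> (forall x, D x -> f x = g x) ->
  \int[m]_x f x = \int[m]_x g x.
Proof.
move=> mD mD1 bf bg fg; rewrite /Rintegral; congr fine.
apply: ae_eq_integral => //.
- by apply/measurable_EFinP; case: bf.
- by apply/measurable_EFinP; case: bg.
exists (~` D); split; first exact: measurableC.
  exact: measure_setC0.
by move=> x /= h; apply: contra_not h => Dx _; rewrite /= fg.
Qed.

Lemma bint_cvg (f_ : nat -> T -> R) f (M : R) :
  (forall k, measurable_fun setT (f_ k)) -> measurable_fun setT f ->
  (forall k x, `|f_ k x| <= M) -> (forall x, f_ k x @[k --> \oo] --> f x) ->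
  \int[m]_x f_ k x @[k --> \oo] --> \int[m]_x f x.
Proof.
move=> mf_ mf fM ff.
have bM : bounded_fun (fun=> M) := bounded_fun_cst M.
have ff' : {ae m, forall x, setT x -> (EFin \o f_ k) x @[k --> \oo] --> (EFin \o f) x}.
  by apply: aeW => x _; apply: cvg_EFin; [exact: nearW|exact: ff].
have [_ _] := @dominated_convergence _ _ _ m setT measurableT
  (fun k => EFin \o f_ k) (EFin \o f) (EFin \o (fun=> M))
  (fun k => (measurable_EFinP _ _).2 (mf_ k)) ((measurable_EFinP _ _).2 mf)
  ff' (bounded_integrable bM) (aeW _ (fun x k _ => fM k x)).
have bf : bounded_fun f.
  split=> //; exists M => x; have nf : `|f_ k x| @[k --> \oo] --> `|f x| by exact: cvg_norm.
  by apply: (cvgr_to_le nf); exact: nearW.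
rewrite -[X in _ --> X]fineK; last by apply: integrable_fin_num => //; exact: bounded_integrable.
exact: fine_cvg.
Qed.

End bounded_functions.

Section bounded_functionals.
Context d (T : measurableType d) (R : realType).
Implicit Types (f g : T -> R) (I J : (T -> R) -> R).

Definition mean_functional I :=
  [/\ forall f g, bounded_fun f -> bounded_fun g ->
        I (fun x => f x + g x) = I f + I g,
      forall (c : R) f, bounded_fun f -> I (fun x => c * f x) = c * I f &
      forall (c : R) f, bounded_fun f -> (forall x, `|f x| <= c) -> `|I f| <= c].

Lemma mean_functional_sum I (N : nat) (F : nat -> T -> R) : mean_functional I ->
  (forall j, bounded_fun (F j)) ->
  bounded_fun (fun x => \sum_(j < N) F j x) /\
  I (fun x => \sum_(j < N) F j x) = \sum_(j < N) I (F j).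
Proof.
move=> [ID IZ Ib] bF; elim: N => [|N [bS IS]].
  have b0 := bounded_fun_cst T (0 : R).
  have e : (fun x : T => \sum_(j < 0) F j x) = (fun=> 0) by apply/funext => x; rewrite big_ord0.
  rewrite e big_ord0; split=> //; by have := IZ 0 _ b0; rewrite !mul0r.
have e : (fun x => \sum_(j < N.+1) F j x) = (fun x => \sum_(j < N) F j x + F N x).
  by apply/funext => x; rewrite big_ord_recr.
by rewrite e; split; [exact: bounded_funD|rewrite ID// IS big_ord_recr].
Qed.

Lemma sum_lt_nat (N t : nat) : (t <= N)%N -> \sum_(j < N) ((j < t)%N : nat)%:R = t%:R :> R.
Proof.
elim: N t => [|N IH] t; first by rewrite leqn0 => /eqP ->; rewrite big_ord0.
rewrite leq_eqVlt => /orP[/eqP ->|tN].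
  rewrite (eq_bigr (fun=> 1)) ?sumr_const ?card_ord// => j _.
  by rewrite ltn_ord.
by rewrite big_ord_recr /= IH// ltnNge -ltnS tN addr0.
Qed.

(** A function with values in [0, 1] is the uniform limit of the averages of the
    indicators of its superlevel sets at the levels [1/N, ..., N/N]. *)
Lemma mean_functional_ext I J : mean_functional I -> mean_functional J ->
  (forall A, measurable A -> I \1_A = J \1_A) ->
  forall f, bounded_fun f -> I f = J f.
Proof.
move=> mI mJ IJ; have [ID IZ Ib] := mI; have [JD JZ Jb] := mJ.
have unit_case f : bounded_fun f -> (forall x, 0 <= f x <= 1) -> I f = J f.
  move=> bf f01; have [mf _] := bf.
  apply/eqP; rewrite -subr_eq0 -normr_le0; apply/ler_addgt0Pr => e e0; rewrite add0r.
  pose N := (Num.truncn (2 / e)).+1.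
  have N0 : 0 < N%:R :> R by rewrite ltr0n.
  have Ne : 2 / N%:R <= e.
    rewrite ler_pdivrMr// mulrC -ler_pdivrMr//.
    by apply: ltW; exact: truncnS_gt.
  pose A (j : nat) := [set x | j.+1%:R <= N%:R * f x].
  have mA j : measurable (A j).
    have -> : A j = (fun x => N%:R * f x) @^-1` `[j.+1%:R, +oo[.
      by apply/seteqP; split=> x /=; rewrite in_itv /= andbT.
    rewrite -[_ @^-1` _]setTI; apply: measurable_funM => //.
  have bA j := bounded_fun_indic R (mA j).
  pose s x := \sum_(j < N) (\1_(A j) x : R).
  have [bs Is] := mean_functional_sum N mI bA.
  have [_ Js] := mean_functional_sum N mJ bA.
  have sE x : s x = (Num.truncn (N%:R * f x))%:R.
    have /andP[f0 f1] := f01 x.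
    rewrite /s -(@sum_lt_nat N); last first.
      rewrite -(ler_nat R); apply: (@le_trans _ _ (N%:R * f x)); first by rewrite truncn_le mulr_ge0// ltW.
      by rewrite ler_piMr// ltW.
    apply: eq_bigr => j _; rewrite indicE; congr (nat_of_bool _)%:R.
    by rewrite truncn_gt_nat; apply/idP/idP; rewrite inE.
  have bc := bounded_funZ N%:R^-1 bs.
  have bd := bounded_funB bf bc.
  have fE : f = (fun x => (f x - N%:R^-1 * s x) + N%:R^-1 * s x).
    by apply/funext => x; rewrite subrK.
  have small x : `|f x - N%:R^-1 * s x| <= N%:R^-1.
    have /andP[f0 f1] := f01 x; rewrite sE.
    have -> : f x - N%:R^-1 * (Num.truncn (N%:R * f x))%:R =
        N%:R^-1 * (N%:R * f x - (Num.truncn (N%:R * f x))%:R).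
      by rewrite mulrBr mulKf// gt_eqF.
    have iN0 : 0 <= N%:R^-1 :> R by rewrite invr_ge0 ltW.
    rewrite normrM (ger0_norm iN0) ler_piMr//.
    have Nf : 0 <= N%:R * f x by rewrite mulr_ge0// ltW.
    have h1 : (Num.truncn (N%:R * f x))%:R <= N%:R * f x by rewrite truncn_le.
    have := truncnS_gt (N%:R * f x); rewrite -natr1 => h2.
    by rewrite ger0_norm ?subr_ge0//; lra.
  rewrite fE ID// JD// IZ// JZ// Is Js (eq_bigr (fun j : 'I_N => J \1_(A j))) => [|j _]; last exact: IJ.
  rewrite opprD addrACA subrr addr0; apply: le_trans (ler_normB _ _) _; apply: le_trans _ Ne.
  by rewrite mulrDl mul1r; apply: lerD; [exact: Ib|exact: Jb].
move=> f bf; have [mf [M fM]] := bf.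
pose K := `|M| + 1; have K0 : 0 < K by rewrite ltr_wpDl.
have fK x : `|f x| <= K by rewrite (le_trans (fM x))// (le_trans (ler_norm _))// lerDl.
pose g x := (2 * K)^-1 * f x + 2^-1.
have b2 := bounded_fun_cst T (2^-1 : R).
have bg : bounded_fun g := bounded_funD (bounded_funZ _ bf) b2.
have g01 x : 0 <= g x <= 1.
  have := fK x; rewrite ler_norml => /andP[f1 f2]; rewrite /g.
  have K2 : 0 < 2 * K by rewrite mulr_gt0.
  have -> : (2 * K)^-1 * f x + 2^-1 = (f x + K) / (2 * K) by field; rewrite gt_eqF.
  by rewrite divr_ge0 ?(ltW K2)//=; [rewrite ler_pdivrMr//; lra|lra].
have fE : f = (fun x => 2 * K * g x + (- K) * \1_setT x).
  apply/funext => x; rewrite indicT /g /=; field; rewrite gt_eqF//.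
have bT := bounded_fun_indic R (@measurableT _ T).
rewrite fE ID//; [|exact: bounded_funZ|exact: bounded_funZ].
rewrite JD//; [|exact: bounded_funZ|exact: bounded_funZ].
by rewrite !IZ// !JZ// IJ// (unit_case g).
Qed.

Lemma mean_functional_bint (m : {measure set T -> \bar R}) : m setT = 1%E ->
  mean_functional (fun f => \int[m]_x f x).
Proof.
move=> m1; split=> [f g bf bg|c f bf|c f bf fc]; [exact: bintD|exact: bintZ|].
exact: bint_norm_le.
Qed.

End bounded_functionals.

Section change_of_variables.
Context d1 d2 (T1 : measurableType d1) (T2 : measurableType d2) (R : realType).

Lemma bounded_fun_comp (phi : T1 -> T2) (f : T2 -> R) :
  measurable_fun setT phi -> bounded_fun f -> bounded_fun (fun x => f (phi x)).
Proof.
move=> mphi [mf [M fM]]; split; last by exists M.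
exact: measurableT_comp.
Qed.

Lemma bint_pushforward (m1 : {measure set T1 -> \bar R}) (m2 : {measure set T2 -> \bar R})
    (phi : T1 -> T2) (f : T2 -> R) :
  m1 setT = 1%E -> measurable_fun setT phi ->
  (forall B, measurable B -> m1 (phi @^-1` B) = m2 B) -> bounded_fun f ->
  \int[m1]_x f (phi x) = \int[m2]_x f x.
Proof.
move=> m11 mphi m12; have m21 : m2 setT = 1%E.
  by have := m12 _ (@measurableT _ T2); rewrite preimage_setT m11 => <-.
have [ID IZ Ib] := mean_functional_bint m11.
apply: (mean_functional_ext (I := fun f => \int[m1]_x f (phi x))
   (J := fun f => \int[m2]_x f x)); [|exact: mean_functional_bint|].
  split=> [g h bg bh|c g bg|c g bg gc]; [apply: ID|apply: IZ|apply: Ib => //];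
  exact: bounded_fun_comp.
move=> A mA; rewrite (bint_indic m2)// -m12// -bint_indic//.
by rewrite -[_ @^-1` _]setTI; exact: mphi.
Qed.

Variables (mu : {measure set T1 -> \bar R}) (k : R.-pker T1 ~> T2).
Variable lambda : {measure set T2 -> \bar R}.
Hypothesis mu1 : mu setT = 1%E.
Hypothesis lambda1 : lambda setT = 1%E.
Hypothesis lambdaE : forall B, measurable B -> lambda B = (\int[mu]_x k x B)%E.

Lemma kernel_fineK x A : measurable A -> (fine (k x A))%:E = k x A.
Proof.
move=> mA; rewrite fineK// ge0_fin_numE//; apply: le_lt_trans (ltry 1).
by rewrite -(@prob_kernel _ _ _ _ _ k x); apply: le_measure; rewrite ?inE.
Qed.

Lemma bounded_fun_kernel (f : T2 -> R) : bounded_fun f ->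
  bounded_fun (fun x => \int[k x]_y f y).
Proof.
move=> bf; have [mf [M fM]] := bf; split; last first.
  by exists M => x; apply: bint_norm_le => //; exact: prob_kernel.
pose g y := f y + M.
have bg : bounded_fun g := bounded_funD bf (bounded_fun_cst _ M).
have g0 y : 0 <= g y by have := fM y; rewrite ler_norml /g => /andP[+ _]; lra.
have -> : (fun x => \int[k x]_y f y) = (fun x => \int[k x]_y g y - M).
  apply/funext => x; rewrite bintD//; [|exact: prob_kernel|exact: bounded_fun_cst].
  by rewrite bint_cst ?addrK//; exact: prob_kernel.
apply: measurable_funB => //.
apply: measurableT_comp => //.
apply: measurable_fun_integral_kernel => //.
  by move=> U mU; exact: measurable_kernel.
by case: bg => mg _; exact/measurable_EFinP.
Qed.

Lemma bint_disintegration (f : T2 -> R) : bounded_fun f ->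
  \int[lambda]_y f y = \int[mu]_x \int[k x]_y f y.
Proof.
have kb x := mean_functional_bint (@prob_kernel _ _ _ _ _ k x).
apply: (mean_functional_ext (I := fun f => \int[lambda]_y f y)
   (J := fun f => \int[mu]_x \int[k x]_y f y)); first exact: mean_functional_bint.
  split=> [g h bg bh|c g bg|c g bg gc].
  - rewrite -bintD//; try exact: bounded_fun_kernel.
    by apply: eq_Rintegral => x _; have [-> ] := kb x.
  - rewrite -bintZ//; last exact: bounded_fun_kernel.
    by apply: eq_Rintegral => x _; have [_ -> ] := kb x.
  - apply: bint_norm_le => //; first exact: bounded_fun_kernel.
    by move=> x; have [_ _ ->] := kb x.
move=> A mA; rewrite bint_indic// lambdaE// /Rintegral; congr fine.
by apply: eq_integral => x _; rewrite -/(Rintegral _ _ _) bint_indic ?kernel_fineK.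
Qed.

End change_of_variables.

(** * Approximation in mean *)

Section sharpening.
Variable R : realType.
Implicit Types (s t r : R) (n M K : nat).

Lemma bernoulli_lower s K : 0 <= s <= 1 -> 1 - K%:R * s <= (1 - s) ^+ K.
Proof.
move=> /andP[s0 s1]; elim: K => [|K IH]; first by rewrite expr0 mul0r subr0.
rewrite exprSr; apply: (@le_trans _ _ ((1 - K%:R * s) * (1 - s))); last first.
  by rewrite ler_wpM2r// subr_ge0.
have : 0 <= K%:R * (s * s) by rewrite mulr_ge0// mulr_ge0.
rewrite -natr1; lra.
Qed.

Lemma bernoulli_upper s K : 0 <= s <= 1 -> (1 - s) ^+ K * (1 + K%:R * s) <= 1.
Proof.
move=> /andP[s0 s1]; elim: K => [|K IH]; first by rewrite expr0 mul0r addr0 mulr1.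
apply: le_trans IH; rewrite exprSr -mulrA; apply: ler_wpM2l.
  by rewrite exprn_ge0// subr_ge0.
have : 0 <= K.+1%:R * (s * s) by rewrite mulr_ge0// mulr_ge0.
rewrite -natr1; lra.
Qed.

(* Splitting [r = s * s], one factor [s ^+ k] absorbs the growth of [k]. *)
Lemma cvg_natmul_expr r : 0 <= r < 1 -> k%:R * r ^+ k @[k --> \oo] --> 0.
Proof.
move=> /andP[r0 r1]; pose s := Num.sqrt r.
have s0 : 0 <= s by exact: sqrtr_ge0.
have rs : r = s * s by rewrite -expr2 sqr_sqrtr.
have s1 : s < 1 by rewrite -[ltRHS]sqrtr1 ltr_sqrt.
apply: (@squeeze_cvgr _ _ _ _ (fun=> 0) (fun k => (1 - s)^-1 * s ^+ k)).
- apply: nearW => k; rewrite mulr_ge0 ?exprn_ge0//=.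
  rewrite rs exprMn mulrA ler_wpM2r ?exprn_ge0// -[leRHS]mul1r ler_pdivlMr ?subr_gt0//.
  have := @bernoulli_upper (1 - s) k; rewrite subKr => /(_ _).
  have -> : 0 <= 1 - s <= 1 by apply/andP; split; lra.
  have := exprn_ge0 k s0; move=> h /(_ isT); rewrite mulrDr mulr1.
  by rewrite [_ * (k%:R * _)]mulrA [s ^+ k * k%:R]mulrC; lra.
- exact: cvg_cst.
- rewrite -[X in _ --> X](mulr0 (1 - s)^-1); apply: cvgMl_tmp.
  by apply: cvg_expr; rewrite ger0_norm.
Qed.

(** The polynomials [(1 - t^n)^(n M^n)] turn a continuous function into the
    indicator of a sublevel set. *)
Lemma sharpening_cvg t M : 0 <= t <= 1 -> (0 < M)%N ->
  (1 - t ^+ n) ^+ (n * M ^ n)%N @[n --> \oo] --> (((t < M%:R^-1)%R : nat)%:R : R).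
Proof.
move=> /andP[t0 t1] M0; have M0' : 0 < M%:R :> R by rewrite ltr0n.
pose r := M%:R * t; have r0 : 0 <= r by rewrite mulr_ge0.
have tn n : 0 <= t ^+ n <= 1 by rewrite exprn_ge0//= exprn_ile1.
have KE n : (n * M ^ n)%N%:R * t ^+ n = n%:R * r ^+ n by rewrite natrM natrX exprMn mulrA.
have -> : (t < M%:R^-1) = (r < 1) by rewrite -[M%:R^-1]mul1r ltr_pdivlMr// mulrC.
have [r1|r1] := ltP r 1; last first.
  apply: (@squeeze_cvgr _ _ _ _ (fun=> 0) (fun n => n.+1%:R^-1)).
  - apply: nearW => n; have /andP[tn0 tn1] := tn n.
    rewrite exprn_ge0 ?subr_ge0//= -[leRHS]mul1r ler_pdivlMr ?ltr0n//.
    apply: le_trans (bernoulli_upper (n * M ^ n)%N (tn n)); apply: ler_wpM2l.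
      by rewrite exprn_ge0// subr_ge0.
    by rewrite KE -natr1 addrC lerD2l ler_peMr// exprn_ege1.
  - exact: cvg_cst.
  - exact: cvg_harmonic.
apply: (@squeeze_cvgr _ _ _ _ (fun n => 1 - n%:R * r ^+ n) (fun=> 1)).
- apply: nearW => n; have /andP[tn0 tn1] := tn n.
  rewrite -KE bernoulli_lower//= exprn_ile1//; first by rewrite subr_ge0.
  by rewrite gerBl.
- rewrite -[X in _ --> X]subr0; apply: cvgB; first exact: cvg_cst.
  by apply: cvg_natmul_expr; rewrite r0.
- exact: cvg_cst.
Qed.

End sharpening.

Section approximation.
Context d (T : measurableType d) (R : realType) (I : finType).
Variable m : I -> {measure set T -> \bar R}.
Hypothesis m1 : forall i, m i setT = 1%E.
Variable D : (T -> R) -> Prop.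
Hypothesis D1 : D (fun=> 1).
Hypothesis DD : forall f g, D f -> D g -> D (fun x => f x + g x).
Hypothesis DZ : forall c f, D f -> D (fun x => c * f x).
Hypothesis DM : forall f g, D f -> D g -> D (fun x => f x * g x).
Hypothesis Db : forall f, D f -> bounded_fun f.
Implicit Types (f g : T -> R).

Definition approximable f := bounded_fun f /\ forall e, 0 < e ->
  exists2 p, D p & forall i, \int[m i]_x `|f x - p x| < e.

Lemma dist_bounded f g : bounded_fun f -> bounded_fun g ->
  bounded_fun (fun x => `|f x - g x|).
Proof. by move=> bf bg; apply: bounded_fun_norm; exact: bounded_funB. Qed.

Lemma approximable_in f : D f -> approximable f.
Proof.
move=> Df; split=> [|e e0]; first exact: Db.
exists f => // i; rewrite (_ : (fun x => _) = (fun=> 0)) ?bint_cst//.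
by apply/funext => x; rewrite subrr normr0.
Qed.

Lemma approximableD f g : approximable f -> approximable g ->
  approximable (fun x => f x + g x).
Proof.
move=> [bf af] [bg ag]; split=> [|e e0]; first exact: bounded_funD.
have e2 : 0 < e / 2 by rewrite divr_gt0.
have [p Dp fp] := af _ e2; have [q Dq gq] := ag _ e2.
exists (fun x => p x + q x) => [|i]; first exact: DD.
have bp := Db Dp; have bq := Db Dq.
apply: (@le_lt_trans _ _ (\int[m i]_x (`|f x - p x| + `|g x - q x|))).
  apply: bint_le => //; first by apply: dist_bounded; exact: bounded_funD.
    by apply: bounded_funD; exact: dist_bounded.
  by move=> x; rewrite opprD addrACA; exact: ler_normD.
rewrite bintD//; try exact: dist_bounded.
by rewrite [e]splitr; apply: ltrD.
Qed.

Lemma approximableM f g : approximable f -> approximable g ->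
  approximable (fun x => f x * g x).
Proof.
move=> [bf af] [bg ag]; split=> [|e e0]; first exact: bounded_funM.
have [_ [M0 fM0]] := bf; pose M := `|M0| + 1.
have Mp : 0 < M by rewrite ltr_wpDl.
have fM x : `|f x| <= M by rewrite (le_trans (fM0 x))// (le_trans (ler_norm _))// lerDl.
have [q Dq gq] := ag (e / 2 / M) ltac:(by rewrite !divr_gt0).
have bq := Db Dq; have [_ [N0 qN0]] := bq; pose N := `|N0| + 1.
have Np : 0 < N by rewrite ltr_wpDl.
have qN x : `|q x| <= N by rewrite (le_trans (qN0 x))// (le_trans (ler_norm _))// lerDl.
have [p Dp fp] := af (e / 2 / N) ltac:(by rewrite !divr_gt0).
have bp := Db Dp.
exists (fun x => p x * q x) => [|i]; first exact: DM.
have bd1 := dist_bounded bg bq; have bd2 := dist_bounded bf bp.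
apply: (@le_lt_trans _ _ (\int[m i]_x (M * `|g x - q x| + N * `|f x - p x|))).
  apply: bint_le => //; first by apply: dist_bounded; exact: bounded_funM.
    by apply: bounded_funD; exact: bounded_funZ.
  move=> x; rewrite (_ : f x * g x - p x * q x = f x * (g x - q x) + q x * (f x - p x)); last by ring.
  by apply: le_trans (ler_normD _ _) _; rewrite !normrM; apply: lerD; rewrite ler_wpM2r.
rewrite bintD//; [|exact: bounded_funZ|exact: bounded_funZ].
rewrite !bintZ// [e]splitr; apply: ltrD; rewrite mulrC -ltr_pdivlMr//.
Qed.

Lemma approximable_cst (c : R) : approximable (fun=> c).
Proof.
apply: approximable_in; rewrite (_ : (fun=> c) = (fun x => c * 1)); first exact: DZ.
by apply/funext => x; rewrite mulr1.
Qed.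

Lemma approximableZ (c : R) f : approximable f -> approximable (fun x => c * f x).
Proof. by move=> af; apply: approximableM => //; exact: approximable_cst. Qed.

Lemma approximableB f g : approximable f -> approximable g ->
  approximable (fun x => f x - g x).
Proof.
move=> af ag; rewrite (_ : (fun x => _) = (fun x => f x + (-1) * g x)).
  by apply: approximableD => //; exact: approximableZ.
by apply/funext => x; rewrite mulN1r.
Qed.

Lemma approximable_prod (J : Type) (r : seq J) (F : J -> T -> R) :
  (forall j, approximable (F j)) -> approximable (fun x => \prod_(j <- r) F j x).
Proof.
move=> aF; elim: r => [|j r IH].
  rewrite (_ : (fun x => _) = (fun=> 1)); first exact: approximable_cst.
  by apply/funext => x; rewrite big_nil.
rewrite (_ : (fun x => _) = (fun x => F j x * \prod_(j <- r) F j x)).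
  exact: approximableM.
by apply/funext => x; rewrite big_cons.
Qed.

Lemma approximableX f k : approximable f -> approximable (fun x => f x ^+ k).
Proof.
move=> af; elim: k => [|k IH].
  rewrite (_ : (fun x => _) = (fun=> 1)); first exact: approximable_cst.
  by apply/funext => x; rewrite expr0.
rewrite (_ : (fun x => _) = (fun x => f x * f x ^+ k)); first exact: approximableM.
by apply/funext => x; rewrite exprS.
Qed.

Lemma approximable_lim (f_ : nat -> T -> R) f (M : R) :
  (forall k, approximable (f_ k)) -> measurable_fun setT f ->
  (forall k x, `|f_ k x| <= M) -> (forall x, f_ k x @[k --> \oo] --> f x) ->
  approximable f.
Proof.
move=> af mf fM ff.
have bf : bounded_fun f.
  split=> //; exists M => x.
  have nf : `|f_ k x| @[k --> \oo] --> `|f x| by exact: cvg_norm.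
  by apply: (cvgr_to_le nf); exact: nearW.
split=> // e e0; have e2 : 0 < e / 2 by rewrite divr_gt0.
have near_i : \forall k \near \oo, forall i, \int[m i]_x `|f x - f_ k x| < e / 2.
  apply: filter_forall => i.
  have bd k := dist_bounded bf (af k).1.
  have : \int[m i]_x `|f x - f_ k x| @[k --> \oo] --> \int[m i]_x (fun=> 0 : R) x.
    apply: (@bint_cvg _ _ _ _ (m1 i) _ _ (M + M)) => //.
    - by move=> k; have [] := bd k.
    - move=> k x; rewrite normr_id; apply: le_trans (ler_normB _ _) _.
      have nf : `|f_ k x| @[k --> \oo] --> `|f x| by exact: cvg_norm.
      apply: lerD; last exact: fM.
      by apply: (cvgr_to_le nf); exact: nearW.
    - move=> x; rewrite -(normr0 R) -(subrr (f x)); apply: cvg_norm.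
      by apply: cvgB; [exact: cvg_cst|exact: ff].
  rewrite bint_cst// => /cvgr_lt; apply; exact: e2.
have [k _ /(_ k (leqnn k)) fk] := near_i.
have [p Dp fp] := (af k).2 _ e2; exists p => // i.
have bp := Db Dp; have [bk _] := af k.
apply: (@le_lt_trans _ _ (\int[m i]_x (`|f x - f_ k x| + `|f_ k x - p x|))).
  apply: bint_le => //; first exact: dist_bounded.
    by apply: bounded_funD; exact: dist_bounded.
  by move=> x; rewrite -{1}[f x](subrK (f_ k x)) -addrA; exact: ler_normD.
rewrite bintD//; try exact: dist_bounded.
by rewrite [e]splitr; apply: ltrD.
Qed.

Lemma approximable_sublevel f (M : nat) : (0 < M)%N -> approximable f ->
  (forall x, 0 <= f x <= 1) -> approximable (\1_[set x | f x < M%:R^-1] : T -> R).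
Proof.
move=> M0 af f01; have [[mf _] _] := af.
apply: (@approximable_lim (fun n x => (1 - f x ^+ n) ^+ (n * M ^ n)%N) _ 1).
- move=> n; apply: approximableX; apply: approximableB; first exact: approximable_cst.
  exact: approximableX.
- apply: measurable_indic; rewrite -[X in measurable X]setTI.
  have -> : [set x | f x < M%:R^-1] = f @^-1` `]-oo, M%:R^-1[.
    by apply/seteqP; split=> x; rewrite /= in_itv.
  exact: mf.
- move=> n x; have /andP[f0 f1] := f01 x.
  have h : 0 <= 1 - f x ^+ n <= 1.
    by rewrite subr_ge0 exprn_ile1//= gerBl exprn_ge0.
  have /andP[h0 h1] := h.
  by rewrite ger0_norm ?exprn_ge0// exprn_ile1.
- move=> x; have := sharpening_cvg (f01 x) M0.
  suff -> : \1_[set x | f x < M%:R^-1] x = ((f x < M%:R^-1)%R : nat)%:R :> R by [].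
  by rewrite indicE; congr (nat_of_bool _)%:R; apply/idP/idP; rewrite inE.
Qed.

(** Complements and intersections correspond to algebraic operations on indicators,
    and countable unions to bounded limits of finite ones. *)
Lemma approximable_sigma_algebra :
  sigma_algebra setT [set A | approximable (\1_A : T -> R)].
Proof.
have aC A : approximable (\1_A : T -> R) -> approximable (\1_(~` A) : T -> R).
  move=> aA; rewrite (_ : \1_(~` A) = (fun x => 1 - \1_A x)).
    by apply: approximableB => //; exact: approximable_cst.
  by apply/funext => x; rewrite !indicE in_setC; case: (_ \in _); rewrite ?subrr ?subr0.
have a0 : approximable (\1_set0 : T -> R).
  rewrite (_ : \1_set0 = (fun=> 0)); first exact: approximable_cst.
  by apply/funext => x; rewrite indic0.
split=> // [A aA|A aA]; first by rewrite /= setTD; exact: aC.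
have mA : measurable (\bigcup_k A k).
  apply: bigcupT_measurable => k; have [[mA _] _] := aA k.
  rewrite (_ : A k = \1_(A k) @^-1` [set (1 : R)]).
    by rewrite -[_ @^-1` _]setTI; exact: mA.
  apply/seteqP; split=> x /=; rewrite indicE; first by move=> Ax; rewrite mem_set.
  by case: (boolP (x \in A k)) => [/set_mem//|_ /eqP]; rewrite eq_sym oner_eq0.
rewrite /= -[X in \1_X]setCK setC_bigcup; apply: (aC).
apply: (@approximable_lim (fun n x => \prod_(j <- iota 0 n) \1_(~` A j) x) _ 1).
- by move=> n; apply: approximable_prod => j; apply: aC; exact: aA.
- by apply: measurable_indic; rewrite -setC_bigcup; exact: measurableC.
- move=> n x; rewrite normr_prod.
  suff /andP[] : 0 <= \prod_(j <- iota 0 n) `|\1_(~` A j) x : R| <= 1 by [].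
  elim/big_ind: _ => [|u v /andP[u0 u1] /andP[v0 v1]|j _]; first by rewrite ler01 lexx.
    by rewrite mulr_ge0//= mulr_ile1.
  by rewrite normr_ge0 indicE; case: (_ \in _); rewrite ?normr1 ?normr0 ?lexx ?ler01.
move=> x; rewrite indicE; case: (boolP (x \in _)) => [/set_mem xA|/negP xA].
  have -> : (fun n => \prod_(j <- iota 0 n) \1_(~` A j) x) = (fun=> 1 : R).
    apply/funext => n; rewrite big1// => j _; rewrite indicE mem_set//.
    by apply: xA.
  exact: cvg_cst.
have [k Akx] : exists k, A k x.
  apply: contrapT => h; apply: xA; rewrite inE => k _ Akx; apply: h.
  by exists k.
apply: cvg_near_cst; exists k.+1 => // n /= kn.
apply/eqP; rewrite prodf_seq_eq0; apply/hasP; exists k; first by rewrite mem_iota add0n.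
by rewrite /= indicE memNset//= => /(_ Akx).
Qed.

End approximation.

(** * Trigonometric functions on the torus bundle *)

Section trigonometric.
Variable R : realType.

Lemma cos_mul (a b : R) : cos a * cos b = 2^-1 * cos (a + b) + 2^-1 * cos (a - b).
Proof. by rewrite cosD cosB; field. Qed.

Lemma rat_approx (x e : R) : 0 < e -> exists q : rat, `|x - ratr q| < e.
Proof.
move=> e0; have [|q] := @rat_in_itvoo R (x - e) (x + e).
  by rewrite ltrD2l gtrN.
rewrite in_itv /= => /andP[q1 q2]; exists q.
by rewrite ltr_norml; apply/andP; split; lra.
Qed.

Lemma nearest_int (x : R) : exists z : int, `|x - z%:~R| <= 2^-1.
Proof.
exists (Num.floor (x + 2^-1)).
have := @floor_le_tmp R (x + 2^-1); have := @floorD1_gt R (x + 2^-1).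
rewrite rmorphD /= ler_norml => h1 h2; apply/andP; split; lra.
Qed.

(** The values of the cosine close to 1 are those of arguments close to the
    multiples of 2 pi. *)
Lemma cos_near1 (e : R) : 0 < e -> exists M : nat, (0 < M)%N /\
  forall x : R, (1 - cos (pi *+ 2 * x)) / 2 < M%:R^-1 ->
  exists z : int, `|x - z%:~R| < e.
Proof.
move=> e0; pose c := Num.min e 2^-1.
have pi0 : 0 < pi :> R := pi_gt0 R.
have pi20 : 0 < pi *+ 2 :> R by rewrite pmulrn_lgt0.
have c0 : 0 < c by rewrite lt_min e0 invr_gt0 ltr0n.
have c2 : c <= 2^-1 by rewrite ge_min lexx orbT.
have dom (t : R) : 0 <= t -> t <= 2^-1 -> pi *+ 2 * t \in `[0, pi].
  move=> t0 t2; rewrite in_itv /=; apply/andP; split; first by rewrite mulr_ge0// ltW.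
  have : pi * (2 * t) <= pi * 1 :> R by rewrite ler_pM2l//; lra.
  by rewrite mulr1 mulr2n; lra.
have cosc : cos (pi *+ 2 * c) < 1.
  have d0 : 0 \in `[0, pi : R] by rewrite in_itv /= lexx ltW.
  by rewrite -(cos0 R) (ltr_cos d0 (dom _ (ltW c0) c2)) mulr_gt0.
pose g := (1 - cos (pi *+ 2 * c)) / 2.
have g0 : 0 < g by rewrite divr_gt0// subr_gt0.
pose M := (Num.truncn g^-1).+1; exists M; split=> // x xM.
have Mg : M%:R^-1 < g.
  rewrite -[g]invrK ltf_pV2 ?posrE ?invr_gt0//; first exact: truncnS_gt.
have [z zx] := nearest_int x; exists z.
apply: (@lt_le_trans _ _ c); last by rewrite ge_min lexx.
rewrite ltNge; apply/negP => cz.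
have cosx : cos (pi *+ 2 * x) = cos (pi *+ 2 * `|x - z%:~R|).
  rewrite -{1}[x](subrK z%:~R) mulrDr cos_addz.
  by case: (ger0P (x - z%:~R)) => // _; rewrite mulrN cosN.
have : cos (pi *+ 2 * x) <= cos (pi *+ 2 * c).
  rewrite cosx leNgt (ltr_cos (dom _ (normr_ge0 _) zx) (dom _ (ltW c0) c2)).
  by rewrite ltr_pM2l// -leNgt.
by move: xM Mg; rewrite /g; lra.
Qed.

End trigonometric.

Lemma points_nbhs_box (R : realType) (n : nat) (P : matgrp R n) (g : points P)
    (A : set (points P)) : nbhs g A ->
  exists2 e : R, 0 < e & forall h : points P, (forall i j, `|val g i j - val h i j| < e) -> A h.
Proof.
rewrite nbhsE => -[U [[W oW WU] Ug] UA].
have : nbhs (val g) W by apply: open_nbhs_nbhs; split => //; move: Ug; rewrite -WU.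
move=> /nbhs_ballP[e e0 eW]; exists e => // h hg; apply: UA; rewrite -WU; apply: eW.
by split=> [|i j]; [exact: e0|exact: hg].
Qed.

Section trig_functions.
Variables (R : realType) (n : nat) (G : alg_group R n) (d : nat).
Variables (rho : rat_rep G d) (Gamma0 : set (points (real_grp G))).
Hypothesis hGamma0 : admissible_lattice rho Gamma0.
Local Notation G0 := (points (real_grp G)).
Local Notation S := (semidirect rho).
Local Notation Gamma := (semidirect_lattice rho Gamma0).
Local Notation X0 := (borel_hspace Gamma0).
Local Notation X := (borel_hspace Gamma).
Local Notation bp := (@bundle_proj R n G d rho Gamma0).
Local Notation wave := (@wave R n G d rho Gamma0).
Local Notation ucoord := (@ucoord R n G d rho Gamma0).
Implicit Types (f g : X -> R) (x : X0) (y : X) (eta : 'cV[int]_d).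

Definition trig_gen (A : set X0) eta theta y : R := \1_A (bp y) * wave eta theta y.

Inductive trig : (X -> R) -> Prop :=
| trig_of_gen A eta theta : measurable A -> trig (trig_gen A eta theta)
| trigD f g : trig f -> trig g -> trig (fun y => f y + g y)
| trigZ c f : trig f -> trig (fun y => c * f y).

Lemma bounded_wave eta theta : bounded_fun (wave eta theta).
Proof.
split; first exact: measurable_wave.
by exists 1 => y; exact: cos_max.
Qed.

Lemma bounded_trig_gen A eta theta : measurable A -> bounded_fun (trig_gen A eta theta).
Proof.
move=> mA; apply: bounded_funM; last exact: bounded_wave.
apply: (@bounded_fun_comp _ _ X X0 R bp); first exact: measurable_bundle_proj.
exact: bounded_fun_indic.
Qed.

Lemma bounded_trig f : trig f -> bounded_fun f.
Proof.
elim=> [A eta theta|{}f g _ bf _ bg|c {}f _ bf].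
- exact: bounded_trig_gen.
- exact: bounded_funD.
- exact: bounded_funZ.
Qed.

Lemma wave_mul eta theta eta' theta' y : wave eta theta y * wave eta' theta' y =
  2^-1 * wave (eta + eta') (theta + theta') y + 2^-1 * wave (eta - eta') (theta - theta') y.
Proof.
rewrite /wave cos_mul /std_phase intvD intvD intvN !dotpDl dotpNl.
by congr (_ * cos _ + _ * cos _); ring.
Qed.

(** Products of waves are sums of waves, by the addition formulas. *)
Lemma trigM f g : trig f -> trig g -> trig (fun y => f y * g y).
Proof.
move=> tf; elim: tf g => [A eta theta mA|{}f f' _ IH _ IH'|c {}f _ IH] g tg.
- elim: tg => [B eta' theta' mB|{}g g' _ IH _ IH'|c {}g _ IH].
  + have mAB : measurable (A `&` B) by exact: measurableI.
    rewrite (_ : (fun y => _) = (fun y =>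
      2^-1 * trig_gen (A `&` B) (eta + eta') (theta + theta') y +
      2^-1 * trig_gen (A `&` B) (eta - eta') (theta - theta') y)).
      by apply: trigD; apply: trigZ; exact: trig_of_gen.
    apply/funext => y; rewrite /trig_gen indicI mulrACA wave_mul /=; ring.
  + rewrite (_ : (fun y => _) = (fun y => trig_gen A eta theta y * g y + trig_gen A eta theta y * g' y)).
      exact: trigD.
    by apply/funext => y; rewrite mulrDr.
  + rewrite (_ : (fun y => _) = (fun y => c * (trig_gen A eta theta y * g y))).
      exact: trigZ.
    by apply/funext => y; rewrite mulrCA.
- rewrite (_ : (fun y => _) = (fun y => f y * g y + f' y * g y)).
    by apply: trigD; [exact: IH|exact: IH'].
  by apply/funext => y; rewrite mulrDl.
- rewrite (_ : (fun y => _) = (fun y => c * (f y * g y))).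
    by apply: trigZ; exact: IH.
  by apply/funext => y; rewrite mulrA.
Qed.

Lemma wave0 theta y : wave 0 theta y = cos theta.
Proof.
by rewrite /wave /std_phase /intv map_mx0 /dotp trmx0 mul0mx mxE mulr0 add0r.
Qed.

Lemma trig1 : trig (fun=> 1).
Proof.
rewrite (_ : (fun=> 1) = trig_gen setT 0 0); first exact: trig_of_gen.
by apply/funext => y; rewrite /trig_gen indicT wave0 cos0 mulr1.
Qed.

Section density.
Variables (I : finType) (m : I -> {measure set X -> \bar R}).
Hypothesis m1 : forall i, m i setT = 1%E.
Local Notation approx := (approximable m trig).

Definition torus_box (q : 'M[rat]_n) (k : nat) (c : 'cV[rat]_d) (M : nat) : set X :=
  [set y | (forall i j, `|val (sec (bp y)) i j - ratr (q i j)| < k.+1%:R^-1) /\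
     forall l, (1 - cos (pi *+ 2 * (ucoord y l 0 - ratr (c l 0)))) / 2 < M.+1%:R^-1].

Lemma approximable_torus_box q k c M : approx (\1_(torus_box q k c M) : X -> R).
Proof.
pose N := [set g : G0 | forall i j, `|val g i j - (map_mx ratr q : 'M[R]_n) i j| < k.+1%:R^-1].
have oN : open N by exact: (open_box _ _ (@continuous_val R n (real_grp G))).
pose f l y : R := (1 - wave (delta_mx l 0) (- (pi *+ 2 * ratr (c l 0))) y) / 2.
have fE l y : f l y = (1 - cos (pi *+ 2 * (ucoord y l 0 - ratr (c l 0)))) / 2.
  rewrite /f /wave /std_phase; congr ((1 - cos _) / 2).
  rewrite mulrBr; congr (_ * _ - _).
  have -> : intv R (delta_mx l 0) = delta_mx l 0 by rewrite /intv map_delta_mx.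
  by rewrite dotpC -[delta_mx l 0]scale1r dotp_delta mul1r.
have af l : approx (f l).
  apply: (approximable_in m1 bounded_trig).
  rewrite (_ : f l = (fun y => 2^-1 * 1 +
      - 2^-1 * trig_gen setT (delta_mx l 0) (- (pi *+ 2 * ratr (c l 0))) y)).
    apply: trigD; first by apply: trigZ; exact: trig1.
    by apply: trigZ; exact: trig_of_gen.
  by apply/funext => y; rewrite /f /trig_gen indicT /=; ring.
have f01 l y : 0 <= f l y <= 1.
  by rewrite fE; have := cos_max (pi *+ 2 * (ucoord y l 0 - ratr (c l 0)));
    rewrite ler_norml => /andP[h1 h2]; apply/andP; split; lra.
pose B l := [set y | f l y < M.+1%:R^-1].
have aB l : approx (\1_(B l) : X -> R).
  exact: (approximable_sublevel m1 trig1 trigD trigZ trigM bounded_trig).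
have aN : approx (trig_gen (@sec R n G Gamma0 @^-1` N) 0 0).
  apply: (approximable_in m1 bounded_trig); apply: trig_of_gen.
  exact: (measurable_sec hGamma0).
rewrite (_ : \1_(torus_box q k c M) = (fun y => trig_gen (@sec R n G Gamma0 @^-1` N) 0 0 y *
    \prod_(l <- enum 'I_d) \1_(B l) y)).
  apply: (approximableM m1 trigM bounded_trig) => //.
  exact: (approximable_prod m1 trig1 trigZ trigM bounded_trig).
apply/funext => y; rewrite /trig_gen wave0 cos0 mulr1.
rewrite [in LHS]indicE; case: (boolP (y \in _)) => [/set_mem[yN yB]|/negP yn].
  rewrite indicE mem_set; last by move=> i j; rewrite mxE; exact: yN.
  rewrite mul1r big1// => l _; rewrite indicE mem_set//.
  by rewrite /B /= fE; exact: yB.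
have [yN|yN] := pselect (N (sec (bp y))); last by rewrite indicE memNset// mul0r.
have [l yl] : exists l, ~ B l y.
  apply: contrapT => h; apply: yn; rewrite inE; split=> [i j|l].
    by have := yN i j; rewrite mxE.
  by rewrite -fE; apply: contrapT => hl; apply: h; exists l.
apply/esym/eqP; rewrite mulf_eq0; apply/orP; right.
rewrite prodf_seq_eq0; apply/hasP; exists l; first by rewrite mem_enum.
by rewrite /= indicE memNset.
Qed.

Lemma torus_box_base (U : set X) y : open (U : set (hspace Gamma)) -> U y ->
  exists q k c M, torus_box q k c M y /\ torus_box q k c M `<=` U.
Proof.
move=> oU Uy; pose F (s : S) : X := hproj Gamma ((s.1, Rrep rho s.1 *m s.2) : S).
pose s0 : S := (sec (bp y), ucoord y).
have Fs0 : F s0 = y by rewrite [RHS](ucoordE hGamma0).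
have Fc : continuous (fun s : S => (s.1, Rrep rho s.1 *m s.2) : S).
  apply: continuous_sd => /=; first exact: continuous_sd_fst.
  apply: mulmx_continuous; last exact: continuous_sd_snd.
  move=> s; apply: (@continuous_comp _ _ _ (fun s : S => s.1) (Rrep rho)); first exact: continuous_sd_fst.
  exact: continuous_Rrep.
have oFU : open (F @^-1` U).
  have -> : F @^-1` U = (fun s : S => (s.1, Rrep rho s.1 *m s.2) : S) @^-1`
      (hproj Gamma @^-1` U) by [].
  by apply: open_comp => [s _|]; [exact: Fc|exact/open_hspaceP].
have : nbhs s0 (F @^-1` U) by apply: open_nbhs_nbhs; split => //=; rewrite /preimage /= Fs0.
move=> [[A B] /= [As0 Bs0] AB].
have [e1 e10 hA] := points_nbhs_box As0.
have /nbhs_ballP[e2 e20 hB] := Bs0.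
have e22 : 0 < e2 / 2 by rewrite divr_gt0.
have [M [M0 hM]] := cos_near1 e22.
have [k ke] : exists k : nat, k.+1%:R^-1 < e1 / 2.
  exists (Num.truncn (e1 / 2)^-1).
  by rewrite -[ltRHS]invrK ltf_pV2 ?posrE ?invr_gt0 ?divr_gt0// truncnS_gt.
have k0 : 0 < k.+1%:R^-1 :> R by rewrite invr_gt0.
have /choice[qf qfP] (ij : 'I_n * 'I_n) := rat_approx (val (sec (bp y)) ij.1 ij.2) k0.
have cosc (x : R) : exists c : rat, `|x - ratr c| < e2 / 2 /\
    (1 - cos (pi *+ 2 * (x - ratr c))) / 2 < M.+1%:R^-1.
  have cc : continuous (fun t : R => (1 - cos (pi *+ 2 * t)) / 2).
    move=> t; apply: cvgMr_tmp; apply: cvgB; first exact: cvg_cst.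
    apply: (@continuous_comp _ _ _ (fun t : R => pi *+ 2 * t) (@cos R)); last exact: continuous_cos.
    by apply: cvgMl_tmp; exact: cvg_id.
  have M1 : 0 < M.+1%:R^-1 :> R by rewrite invr_gt0.
  have := cc 0; rewrite /continuous_at /= mulr0 cos0 subrr mul0r => /cvgr_lt/(_ _ M1)/nbhs_ballP[e3 e30 h3].
  have e4 : 0 < Num.min e3 (e2 / 2) by rewrite lt_min e30.
  have [c xc] := rat_approx x e4; exists c; move: xc; rewrite lt_min => /andP[c3 c2].
  by split=> //; apply: h3; rewrite /ball /= sub0r normrN.
have /choice[cf cfP] (l : 'I_d) := cosc (ucoord y l 0).
exists (\matrix_(i, j) qf (i, j)), k, (\col_l cf l), M; split.
  split=> [i j|l]; rewrite mxE; first exact: (qfP (i, j)).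
  by have [] := cfP l.
move=> y' [yN yB].
have /choice[zf zfP] (l : 'I_d) : exists z : int, `|ucoord y' l 0 - ratr (cf l) - z%:~R| < e2 / 2.
  apply: hM; have := yB l; rewrite mxE => /lt_le_trans; apply.
  by rewrite lef_pV2 ?posrE ?ltr0n// ler_nat.
pose s1 : S := (sec (bp y'), ucoord y' - intv R (\col_l zf l)).
have -> : y' = F s1.
  rewrite /F /s1 /= -[in RHS](torus_pointD hGamma0 _ _ (\col_l zf l)) subrK.
  exact: (ucoordE hGamma0).
apply: AB; split=> /=.
  apply: hA => i j; have := yN i j; rewrite mxE => h1; have h2 := qfP (i, j).
  have -> : val (sec (bp y)) i j - val (sec (bp y')) i j =
     (val (sec (bp y)) i j - ratr (qf (i, j))) - (val (sec (bp y')) i j - ratr (qf (i, j))).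
    by rewrite opprB addrA subrK.
  by apply: le_lt_trans (ler_normB _ _) _; apply: lt_trans (ltrD h2 h1) _; rewrite [e1]splitr ltrD.
apply: hB; split=> [|i j]; first exact: e20.
rewrite (ord1 j).
have E : (ucoord y' - intv R (\col_l zf l)) i 0 = ucoord y' i 0 - (zf i)%:~R.
  by rewrite [LHS]mxE [X in _ + X]mxE; congr (_ - _); rewrite !mxE.
rewrite /ball /= E.
have [c1 _] := cfP i; have z1 := zfP i.
have -> : ucoord y i 0 - (ucoord y' i 0 - (zf i)%:~R) =
   (ucoord y i 0 - ratr (cf i)) - (ucoord y' i 0 - ratr (cf i) - (zf i)%:~R) by ring.
by apply: le_lt_trans (ler_normB _ _) _; lra.
Qed.

(** The sets [torus_box] are a countable basis of the topology, and they are
    cut out by sublevel sets of trigonometric functions. *)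
Theorem trig_dense (A : set X) : measurable A -> approx (\1_A : X -> R).
Proof.
have sa := approximable_sigma_algebra m1 trig1 trigD trigZ trigM bounded_trig.
have [a0 _ aU] := sa.
suff sub : (@open (hspace Gamma) : set (set X)) `<=`
    [set B : set X | approx (\1_B : X -> R)].
  by move=> mA; exact: (smallest_sub sa sub mA).
move=> U oU; pose J := ('M[rat]_n * nat * 'cV[rat]_d * nat)%type.
pose F (t : nat) : set X := if (unpickle t : option J) is Some (q, k, c, M) then
  if `[< torus_box q k c M `<=` U >] then torus_box q k c M else set0 else set0.
rewrite (_ : U = \bigcup_t F t).
  apply: aU => t; rewrite /F; case: unpickle => [[[[q k] c] M]|]; last exact: a0.
  case: asboolP => _; [exact: approximable_torus_box|exact: a0].
apply/seteqP; split=> y.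
  move=> Uy; have [q [k [c [M [By BU]]]]] := torus_box_base oU Uy.
  exists (pickle ((q, k, c, M) : J)); first exact: Logic.I.
  by rewrite /F pickleK asboolT.
move=> [t _]; rewrite /F; case: unpickle => [[[[q k] c] M]|]//.
by case: asboolP => // BU /BU.
Qed.

End density.

(** Uniqueness of a measure with given Fourier coefficients; the approximation in
    mean has to hold for both measures simultaneously. *)
Lemma trig_measure_eq (m1 m2 : {measure set X -> \bar R}) :
  m1 setT = 1%E -> m2 setT = 1%E ->
  (forall A eta theta, measurable A ->
    \int[m1]_y trig_gen A eta theta y = \int[m2]_y trig_gen A eta theta y) ->
  forall B, measurable B -> m1 B = m2 B.
Proof.
move=> m11 m21 eq_gen B mB.
have eq_trig f : trig f -> \int[m1]_y f y = \int[m2]_y f y.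
  elim=> [A eta theta mA|{}f g tf IH tg IH'|c {}f tf IH]; first exact: eq_gen.
    have bf := bounded_trig tf; have bg := bounded_trig tg.
    by rewrite !bintD// IH IH'.
  by have bf := bounded_trig tf; rewrite !bintZ// IH.
pose m (b : bool) := if b then m1 else m2.
have mm b : m b setT = 1%E by case: b.
have [bB aB] := trig_dense mm mB.
have fin (m' : {measure set X -> \bar R}) : m' setT = 1%E -> (fine (m' B))%:E = m' B.
  move=> m'1; rewrite fineK// ge0_fin_numE//; apply: le_lt_trans (ltry 1).
  by rewrite -m'1; apply: le_measure; rewrite ?inE.
rewrite -fin// -[RHS]fin//; congr EFin.
rewrite -(bint_indic m1)// -(bint_indic m2)//.
apply/eqP; rewrite -subr_eq0 -normr_le0; apply/ler_addgt0Pr => e e0; rewrite add0r.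
have e2 : 0 < e / 2 by rewrite divr_gt0.
have [p tp pB] := aB _ e2; have bp_ := bounded_trig tp.
have h b : `|\int[m b]_y \1_B y - \int[m b]_y p y| <= e / 2.
  rewrite -bintB//; apply: le_trans (bint_norm (mm b) _) (ltW (pB b)).
  exact: bounded_funB.
have h1 := h true; have h2 := h false; rewrite /= in h1 h2.
rewrite (eq_trig _ tp) in h1.
rewrite (_ : \int[m1]_y \1_B y - \int[m2]_y \1_B y =
  (\int[m1]_y \1_B y - \int[m2]_y p y) - (\int[m2]_y \1_B y - \int[m2]_y p y)); last by ring.
by apply: le_trans (ler_normB _ _) _; lra.
Qed.

End trig_functions.

(** * Fiber integrals and correlations of trigonometric functions *)

Section fiber_integrals.
Variables (R : realType) (n : nat) (G : alg_group R n) (d : nat).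
Variables (rho : rat_rep G d) (Gamma0 : set (points (real_grp G))).
Hypothesis hGamma0 : admissible_lattice rho Gamma0.
Local Notation G0 := (points (real_grp G)).
Local Notation S := (semidirect rho).
Local Notation Gamma := (semidirect_lattice rho Gamma0).
Local Notation X0 := (borel_hspace Gamma0).
Local Notation X := (borel_hspace Gamma).
Local Notation bp := (@bundle_proj R n G d rho Gamma0).
Local Notation wave := (@wave R n G d rho Gamma0).
Local Notation trig_gen := (@trig_gen R n G d rho Gamma0).
Local Notation phase := (@phase R n G d rho Gamma0).
Local Notation frequency := (@frequency R n G d rho Gamma0).
Local Notation std_phase := (@std_phase R n G d rho Gamma0).
Implicit Types (x : X0) (y : X) (eta : 'cV[int]_d) (A B : set X0) (s : S).

Let sub0 := lattice_subgroup hGamma0.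
Let subG := semidirect_lattice_subgroup hGamma0.

Lemma Rrep_tr_eq0 g (xi : 'cV[R]_d) : ((Rrep rho g)^T *m xi == 0) = (xi == 0).
Proof.
apply/eqP/eqP => [h|->]; last by rewrite mulmx0.
by rewrite -[xi]mul1mx -trmx1 -(Rrep_invr rho g) trmx_mul -mulmxA h mulmx0.
Qed.

Lemma frequency_eq0 eta x : (frequency eta x == 0) = (eta == 0).
Proof. by rewrite /frequency Rrep_tr_eq0 intv_eq0. Qed.

Lemma measurable_fiber x : measurable (bp @^-1` [set x]).
Proof.
rewrite -[_ @^-1` _]setTI; apply: (measurable_bundle_proj hGamma0) => //.
exact: (measurable_point hGamma0).
Qed.

(** A nontrivial character of a torus has mean zero: it is turned into its opposite
    by a suitable translation. *)
Lemma phase_integral x (nu : {measure set X -> \bar R}) (Phi : X -> R) (xi : 'cV[R]_d) :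
  nu setT = 1%E -> is_fiber_haar x nu -> phase x Phi xi -> xi != 0 ->
  bounded_fun (fun y => cos (Phi y)) -> \int[nu]_y cos (Phi y) = 0.
Proof.
move=> nu1 [nux nuinv] phi xi0 bcos.
have [i xi_i] : exists i, xi i 0 != 0.
  apply: contrapT => h; case/eqP: xi0; apply/matrixP => i j.
  by rewrite (ord1 j) mxE; apply: contrapT => /eqP hi; apply: h; exists i.
pose v : 'cV[R]_d := (2 * xi i 0)^-1 *: delta_mx i 0.
have vE : dotp xi v = 2^-1 by rewrite dotp_delta; field.
have mlact := measurable_lact hGamma0 ((1%g, v) : S).
have e1 : \int[nu]_y cos (Phi (lact Gamma (1%g, v) y)) = \int[nu]_y cos (Phi y).
  by apply: (bint_pushforward (f := fun y => cos (Phi y)) nu1 mlact) => // B mB; exact: nuinv.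
have e2 : \int[nu]_y cos (Phi (lact Gamma (1%g, v) y)) = \int[nu]_y (-1 * cos (Phi y)).
  apply: (bint_on nu1 (measurable_fiber x) nux).
  - exact: (bounded_fun_comp mlact bcos).
  - exact: bounded_funZ.
  - move=> y yx; have [z ->] := phi y yx v; rewrite vE mulrDr addrA cos_addz.
    have -> : pi *+ 2 * 2^-1 = pi :> R by rewrite mulr2n; field.
    by rewrite cosDpi mulN1r.
have := e2; rewrite bintZ// e1; lra.
Qed.

Section one_fiber.
Variables (x : X0) (nu : {measure set X -> \bar R}).
Hypothesis nu1 : nu setT = 1%E.
Hypothesis nux : is_fiber_haar x nu.

Lemma wave_integral eta theta : eta != 0 -> \int[nu]_y wave eta theta y = 0.
Proof.
move=> eta0; have f0 : frequency eta x != 0 by rewrite frequency_eq0.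
have := phase_integral nu1 nux (std_phaseP hGamma0 eta theta (x := x)) f0
  (bounded_wave hGamma0 eta theta).
by [].
Qed.

Lemma trig_gen_integral A eta theta : measurable A ->
  \int[nu]_y trig_gen A eta theta y = if eta == 0 then \1_A x * cos theta else 0.
Proof.
move=> mA; transitivity (\int[nu]_y (\1_A x * wave eta theta y)).
  apply: (bint_on nu1 (measurable_fiber x) nux.1).
  - exact: bounded_trig_gen.
  - by apply: bounded_funZ; exact: bounded_wave.
  - by move=> y yx; rewrite /trig_gen yx.
rewrite bintZ//; last exact: bounded_wave.
case: eqVneq => [->|eta0]; last by rewrite wave_integral// mulr0.
rewrite (_ : (fun y => _) = (fun=> cos theta)) ?bint_cst//.
by apply/funext => y; rewrite wave0.
Qed.

Lemma trig_gen_lact_integral A eta theta s : measurable A ->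
  \int[nu]_y trig_gen A eta theta (lact Gamma s y) =
  if eta == 0 then \1_A (lact Gamma0 s.1 x) * cos theta else 0.
Proof.
move=> mA; have mlact := measurable_lact hGamma0 s.
have bw := bounded_fun_comp mlact (bounded_wave hGamma0 eta theta).
transitivity (\int[nu]_y (\1_A (lact Gamma0 s.1 x) * wave eta theta (lact Gamma s y))).
  apply: (bint_on nu1 (measurable_fiber x) nux.1).
  - exact: (bounded_fun_comp mlact (bounded_trig_gen hGamma0 _ _ mA)).
  - exact: bounded_funZ.
  - by move=> y yx; rewrite /trig_gen (bundle_proj_lact hGamma0) yx.
rewrite bintZ//; case: eqVneq => [->|eta0].
  rewrite (_ : (fun y => _) = (fun=> cos theta)) ?bint_cst//.
  by apply/funext => y; rewrite wave0.
have ph := phase_lact hGamma0 (std_phaseP hGamma0 eta theta (x := lact Gamma0 s.1 x)).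
by rewrite (phase_integral nu1 nux ph) ?mulr0// Rrep_tr_eq0 frequency_eq0.
Qed.

(** Beyond the fibers where the two frequencies match up to sign, the product of a
    wave and of a translated wave is a combination of nontrivial characters. *)
Lemma trig_gen_mul_integral A1 eta1 theta1 A2 eta2 theta2 s :
  measurable A1 -> measurable A2 ->
  (Rrep rho s.1)^T *m frequency eta1 (lact Gamma0 s.1 x) != frequency eta2 x ->
  (Rrep rho s.1)^T *m frequency eta1 (lact Gamma0 s.1 x) != - frequency eta2 x ->
  \int[nu]_y (trig_gen A1 eta1 theta1 (lact Gamma s y) * trig_gen A2 eta2 theta2 y) = 0.
Proof.
move=> mA1 mA2 ne1 ne2; have mlact := measurable_lact hGamma0 s.
pose P1 y := std_phase eta1 theta1 (lact Gamma s y); pose P2 := std_phase eta2 theta2.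
have ph1 : phase x P1 _ := phase_lact hGamma0 (std_phaseP hGamma0 eta1 theta1 (x := lact Gamma0 s.1 x)).
have ph2 : phase x P2 _  := std_phaseP hGamma0 eta2 theta2 (x := x).
have bc1 : bounded_fun (fun y => cos (P1 y)) :=
  bounded_fun_comp mlact (bounded_wave hGamma0 eta1 theta1).
have bc2 : bounded_fun (fun y => cos (P2 y)) := bounded_wave hGamma0 eta2 theta2.
have bs1 : bounded_fun (fun y => sin (P1 y)).
  have -> : (fun y => sin (P1 y)) = (fun y => wave eta1 (theta1 - pi / 2) (lact Gamma s y)).
    by apply/funext => y; rewrite /wave /std_phase addrA cosBpihalf.
  exact: (bounded_fun_comp mlact (bounded_wave hGamma0 _ _)).
have bs2 : bounded_fun (fun y => sin (P2 y)).
  have -> : (fun y => sin (P2 y)) = (fun y => wave eta2 (theta2 - pi / 2) y).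
    by apply/funext => y; rewrite /wave /std_phase addrA cosBpihalf.
  exact: bounded_wave.
have bD : bounded_fun (fun y => cos (P1 y + P2 y)).
  have -> : (fun y => cos (P1 y + P2 y)) =
      (fun y => cos (P1 y) * cos (P2 y) - sin (P1 y) * sin (P2 y)).
    by apply/funext => y; rewrite cosD.
  by apply: bounded_funB; exact: bounded_funM.
have bB : bounded_fun (fun y => cos (P1 y - P2 y)).
  have -> : (fun y => cos (P1 y - P2 y)) =
      (fun y => cos (P1 y) * cos (P2 y) + sin (P1 y) * sin (P2 y)).
    by apply/funext => y; rewrite cosB.
  by apply: bounded_funD; exact: bounded_funM.
pose c : R := \1_A1 (lact Gamma0 s.1 x) * \1_A2 x.
transitivity (\int[nu]_y (c * (2^-1 * cos (P1 y + P2 y) + 2^-1 * cos (P1 y - P2 y)))).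
  apply: (bint_on nu1 (measurable_fiber x) nux.1).
  - apply: bounded_funM; last exact: bounded_trig_gen.
    exact: (bounded_fun_comp mlact (bounded_trig_gen hGamma0 _ _ mA1)).
  - by apply: bounded_funZ; apply: bounded_funD; exact: bounded_funZ.
  - by move=> y yx; rewrite -cos_mul /trig_gen (bundle_proj_lact hGamma0) yx mulrACA.
rewrite bintZ//; last by apply: bounded_funD; exact: bounded_funZ.
rewrite bintD//; [|exact: bounded_funZ|exact: bounded_funZ].
rewrite !bintZ// (phase_integral nu1 nux (phaseD ph1 ph2))//; last first.
  by rewrite addr_eq0.
rewrite (phase_integral nu1 nux (phaseB ph1 ph2))//; last by rewrite subr_eq0.
by rewrite !mulr0 addr0 mulr0.
Qed.

End one_fiber.

(** The Haar measures of the fibers are permuted by the action, since they are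
    determined by their Fourier coefficients. *)
Lemma fiber_haar_lact x (nu nu' : {measure set X -> \bar R}) s :
  nu setT = 1%E -> is_fiber_haar x nu ->
  nu' setT = 1%E -> is_fiber_haar (lact Gamma0 s.1 x) nu' ->
  forall B : set X, measurable B -> nu (lact Gamma s @^-1` B) = nu' B.
Proof.
move=> nu1 nux nu'1 nu'x B mB; have mlact := measurable_lact hGamma0 s.
have e := bint_pushforward (m1 := nu) nu1 mlact.
pose m := measure_function_pushforward__canonical__measure_function_Measure nu mlact.
apply: (@trig_measure_eq _ _ _ _ _ _ hGamma0 m nu') => // A eta theta mA.
rewrite (trig_gen_integral nu'1 nu'x)// -(trig_gen_lact_integral nu1 nux)//.
by apply/esym/e => //; exact: bounded_trig_gen.
Qed.

Definition resonant (g : G0) eta1 eta2 : set X0 :=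
  [set x | (Rrep rho g)^T *m frequency eta1 (lact Gamma0 g x) = frequency eta2 x \/
           (Rrep rho g)^T *m frequency eta1 (lact Gamma0 g x) = - frequency eta2 x].

Lemma measurable_frequency eta i : measurable_fun setT (fun x => frequency eta x i 0).
Proof.
pose f (g : G0) : R := ((Rrep rho g^-1%g)^T *m intv R eta) i 0.
have fc : continuous f.
  apply: entry_continuous; apply: mulmx_continuous; last exact: cst_continuous.
  have c : continuous (fun g : G0 => Rrep rho g^-1%g).
    move=> g; apply: (@continuous_comp _ _ _ (fun g : G0 => (g^-1)%g) (Rrep rho)).
      exact: continuous_invg.
    exact: continuous_Rrep.
  apply: mx_continuous => k l.
  have -> : (fun g : G0 => (Rrep rho g^-1%g)^T k l) = (fun g => Rrep rho g^-1%g l k).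
    by apply/funext => g; rewrite mxE.
  exact: entry_continuous.
exact: (measurable_fun_sec hGamma0 fc).
Qed.

Lemma measurable_eq0_col (h : X0 -> 'cV[R]_d) :
  (forall i, measurable_fun setT (fun x => h x i 0)) -> measurable [set x | h x = 0].
Proof.
move=> mh; pose q x := \sum_i (h x i 0 * h x i 0).
have mq : measurable_fun setT q by apply: measurable_sum => i; exact: measurable_funM.
have -> : [set x | h x = 0] = q @^-1` [set 0].
  apply/seteqP; split=> x /=.
    by move=> hx; rewrite /q big1// => i _; rewrite hx mxE mul0r.
  move=> /eqP; rewrite /q psumr_eq0 => [/allP q0|i _]; last by rewrite -expr2 sqr_ge0.
  apply/matrixP => i j; rewrite (ord1 j) mxE.
  by have := q0 i (mem_index_enum i); rewrite mulf_eq0 orbb => /eqP.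
by rewrite -[_ @^-1` _]setTI; exact: mq.
Qed.

Lemma measurable_resonant g eta1 eta2 : measurable (resonant g eta1 eta2).
Proof.
pose h x := (Rrep rho g)^T *m frequency eta1 (lact Gamma0 g x).
have mh i : measurable_fun setT (fun x => h x i 0).
  have -> : (fun x => h x i 0) =
      (fun x => \sum_j (Rrep rho g)^T i j * frequency eta1 (lact Gamma0 g x) j 0).
    by apply/funext => x; rewrite /h mxE.
  apply: measurable_sum => j; apply: measurable_funM => //.
  exact: (measurableT_comp (measurable_frequency eta1 j) (measurable_lact0 hGamma0 g)).
have -> : resonant g eta1 eta2 =
    [set x | h x - frequency eta2 x = 0] `|` [set x | h x + frequency eta2 x = 0].
  apply/seteqP; split=> x [] /= e; [left|right|left|right].
  - by apply/eqP; rewrite subr_eq0; apply/eqP.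
  - by apply/eqP; rewrite addr_eq0; apply/eqP.
  - by apply/eqP; rewrite -subr_eq0; apply/eqP.
  - by apply/eqP; rewrite -addr_eq0; apply/eqP.
apply: measurableU; apply: measurable_eq0_col => i.
  rewrite (_ : (fun x => _) = (fun x => h x i 0 - frequency eta2 x i 0)).
    by apply: measurable_funB => //; exact: measurable_frequency.
  by apply/funext => x; rewrite [LHS]mxE [X in _ + X]mxE.
rewrite (_ : (fun x => _) = (fun x => h x i 0 + frequency eta2 x i 0)).
  by apply: measurable_funD => //; exact: measurable_frequency.
by apply/funext => x; rewrite [LHS]mxE.
Qed.

Section lift.
Variables (mu : probability X0 R) (lambda : probability X R) (k : R.-pker X0 ~> X).
Hypothesis kx : forall x, is_fiber_haar x (k x).
Hypothesis lambdaE : forall B : set X, measurable B -> lambda B = (\int[mu]_x k x B)%E.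

Let k1 x : k x setT = 1%E := @prob_kernel _ _ _ _ _ k x.
Let mu1 : mu setT = 1%E := probability_setT mu.
Let lambda1 : lambda setT = 1%E := probability_setT lambda.

Lemma trig_gen_lambda A eta theta : measurable A ->
  \int[lambda]_y trig_gen A eta theta y =
  if eta == 0 then fine (mu A) * cos theta else 0.
Proof.
move=> mA; have bt := bounded_trig_gen hGamma0 eta theta mA.
rewrite (bint_disintegration mu1 lambda1 lambdaE bt).
rewrite (_ : (fun x => _) = (fun x => (if eta == 0 then cos theta else 0) * \1_A x)).
  rewrite bintZ ?bint_indic//; last exact: bounded_fun_indic.
  by case: ifP => _; rewrite ?mul0r// mulrC.
apply/funext => x; rewrite (trig_gen_integral (k1 x) (kx x))//.
by case: ifP => _; rewrite ?mul0r// mulrC.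
Qed.

(** The fiber integral of the product is bounded by 1 on the resonant set, and
    vanishes elsewhere. *)
Lemma trig_gen_correlation A1 eta1 theta1 A2 eta2 theta2 s :
  measurable A1 -> measurable A2 ->
  `|\int[lambda]_y (trig_gen A1 eta1 theta1 (lact Gamma s y) * trig_gen A2 eta2 theta2 y)|
  <= fine (mu (resonant s.1 eta1 eta2)).
Proof.
move=> mA1 mA2; have mlact := measurable_lact hGamma0 s.
have bt : bounded_fun (fun y => trig_gen A1 eta1 theta1 (lact Gamma s y) *
    trig_gen A2 eta2 theta2 y).
  apply: bounded_funM; last exact: bounded_trig_gen.
  exact: (bounded_fun_comp mlact (bounded_trig_gen hGamma0 _ _ mA1)).
have bi := bounded_fun_kernel k bt.
rewrite (bint_disintegration mu1 lambda1 lambdaE bt).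
have mr := measurable_resonant s.1 eta1 eta2.
apply: le_trans (bint_norm mu1 bi) _; rewrite -(bint_indic mu)//.
apply: bint_le => //; first exact: bounded_fun_norm.
  exact: bounded_fun_indic.
have gen1 A eta theta y : `|trig_gen A eta theta y| <= 1.
  rewrite normrM mulr_ile1//; last exact: cos_max.
  by rewrite indicE; case: (_ \in _); rewrite ?normr1 ?normr0 ?ler01.
move=> x; rewrite indicE; case: (boolP (x \in _)) => [_|/negP xr].
  apply: (bint_norm_le (k1 x) bt) => y.
  by rewrite normrM mulr_ile1.
rewrite (trig_gen_mul_integral (k1 x) (kx x)) ?normr0//.
  by apply/eqP => e; apply: xr; rewrite inE; left.
by apply/eqP => e; apply: xr; rewrite inE; right.
Qed.

End lift.

End fiber_integrals.

(** * The frequencies over a non-concentrated measure *)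

Section dual_lattices.
Variables (R : realType) (n : nat) (G : alg_group R n) (d : nat).
Variables (rho : rat_rep G d) (Gamma0 : set (points (real_grp G))).
Hypothesis hGamma0 : admissible_lattice rho Gamma0.
Local Notation G0 := (points (real_grp G)).
Local Notation X0 := (borel_hspace Gamma0).
Local Notation frequency := (@frequency R n G d rho Gamma0).
Implicit Types (x : X0) (eta : 'cV[int]_d) (xi zeta : 'cV[R]_d) (g h : G0).

Let sub0 := lattice_subgroup hGamma0.

Definition dualvec g eta : 'cV[R]_d := (Rrep rho g^-1%g)^T *m intv R eta.

Definition dual_lattice x : set 'cV[R]_d := [set frequency eta x | eta in setT].

Lemma dualvecM g h eta : dualvec (g * h)%g eta = (Rrep rho g^-1%g)^T *m dualvec h eta.
Proof. by rewrite /dualvec invgM RrepM trmx_mul mulmxA. Qed.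

Lemma dualvec_lattice g c eta : Gamma0 c -> exists eta', dualvec (g * c)%g eta = dualvec g eta'.
Proof.
move=> Gc; have [eta' e] : exists eta', dualvec c eta = intv R eta'.
  apply: int_vectorP; apply: mxOver_mul_int; last exact: intv_int.
  apply/mxOverP => i j; rewrite mxE.
  by apply: (mxOverP (lattice_Rrep_int hGamma0 _)); exact: (subgroupV sub0).
by exists eta'; rewrite dualvecM e.
Qed.

Lemma dual_latticeP g xi :
  dual_lattice (hproj Gamma0 g) xi <-> exists eta, dualvec g eta = xi.
Proof.
have [c Gc gE] := hproj_eqM sub0 (sec_proj (hproj Gamma0 g : X0)).
split=> [[eta _ <-]|[eta <-]].
  have [eta' e] := @dualvec_lattice g c^-1%g eta (subgroupV sub0 Gc).
  exists eta'; rewrite -e; congr dualvec.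
  by rewrite [X in (X * _)%g]gE -mulgA mulgV mulg1.
have [eta' e] := @dualvec_lattice (sec (hproj Gamma0 g : X0)) c eta Gc.
by exists eta' => //; rewrite -[LHS]/(dualvec (sec (hproj Gamma0 g : X0)) eta') -e -gE.
Qed.

Lemma Rrep_trK g xi : (Rrep rho g)^T *m ((Rrep rho g^-1%g)^T *m xi) = xi.
Proof. by rewrite mulmxA -trmx_mul Rrep_invl trmx1 mul1mx. Qed.

Lemma Rrep_trVK g xi : (Rrep rho g^-1%g)^T *m ((Rrep rho g)^T *m xi) = xi.
Proof. by rewrite mulmxA -trmx_mul Rrep_invr trmx1 mul1mx. Qed.

Lemma Rrep_tr_fixV g xi : (Rrep rho g)^T *m xi = xi -> (Rrep rho g^-1%g)^T *m xi = xi.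
Proof. by move=> /(congr1 (mulmx (Rrep rho g^-1%g)^T)); rewrite Rrep_trVK. Qed.

Lemma dual_lattice_lact g x xi :
  dual_lattice x xi -> dual_lattice (lact Gamma0 g x) ((Rrep rho g^-1%g)^T *m xi).
Proof.
have [h <-] := hproj_surj (x : hspace Gamma0).
move=> /dual_latticeP[eta <-]; rewrite (lact_hproj sub0); apply/dual_latticeP.
by exists eta; rewrite dualvecM.
Qed.

Lemma continuous_dualvec eta : continuous (fun g : G0 => dualvec g eta).
Proof.
have c : continuous (fun g : G0 => Rrep rho g^-1%g).
  move=> g; apply: (@continuous_comp _ _ _ (fun g : G0 => (g^-1)%g) (Rrep rho)).
    exact: continuous_invg.
  exact: continuous_Rrep.
apply: mulmx_continuous; last exact: cst_continuous.
apply: mx_continuous => k l.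
have -> : (fun g : G0 => (Rrep rho g^-1%g)^T k l) = (fun g => Rrep rho g^-1%g l k).
  by apply/funext => g; rewrite mxE.
exact: entry_continuous.
Qed.

Lemma continuous_Rrep_tr xi : continuous (fun g : G0 => (Rrep rho g)^T *m xi).
Proof.
apply: mulmx_continuous; last exact: cst_continuous.
apply: mx_continuous => k l.
have -> : (fun g : G0 => (Rrep rho g)^T k l) = (fun g => Rrep rho g l k).
  by apply/funext => g; rewrite mxE.
apply: entry_continuous; exact: continuous_Rrep.
Qed.

Definition box (q : 'cV[rat]_d) (j : nat) : set 'cV[R]_d :=
  [set v | forall i l, `|v i l - (map_mx ratr q : 'cV[R]_d) i l| < j.+1%:R^-1].

Definition meets (Q : set 'cV[R]_d) : set X0 := [set x | exists2 xi, dual_lattice x xi & Q xi].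

Lemma open_meets q j : open (meets (box q j) : set (hspace Gamma0)).
Proof.
apply/open_hspaceP.
have -> : hproj Gamma0 @^-1` meets (box q j) =
    \bigcup_eta [set g : G0 | box q j (dualvec g eta)].
  apply/seteqP; split=> g /=.
    by move=> [xi /dual_latticeP[eta <-] Qxi]; exists eta.
  by move=> [eta _ Q]; exists (dualvec g eta) => //; apply/dual_latticeP; exists eta.
apply: bigcup_open => eta _; apply: open_box; exact: continuous_dualvec.
Qed.

(** A box around a covector outside a dual lattice can be shrunk so as to miss the
    lattice, because lattices are closed. *)
Lemma box_separates xi x : ~ dual_lattice x xi ->
  exists q j, box q j xi /\ ~ meets (box q j) x.
Proof.
have [g <-] := hproj_surj (x : hspace Gamma0).
move=> nxi; pose D : set 'cV[R]_d := [set v | exists eta, v = intv R eta].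
have cD : closed [set v : 'cV[R]_d | D ((Rrep rho g)^T *m v)].
  apply: (@closed_integer_preimage R 'cV[R]_d _ _ (fun v => (Rrep rho g)^T *m v) D).
    by apply: mulmx_continuous; [exact: cst_continuous|move=> v; exact: cvg_id].
  by move=> _ [eta ->]; exact: intv_int.
have : nbhs xi (~` [set v : 'cV[R]_d | D ((Rrep rho g)^T *m v)]).
  apply: open_nbhs_nbhs; split; first exact: closed_openC.
  move=> [eta e]; apply: nxi; apply/dual_latticeP; exists eta.
  by rewrite /dualvec -e Rrep_trVK.
move=> /nbhs_ballP[e /= e0 he].
have e2 : 0 < e / 2 by rewrite divr_gt0.
pose j := Num.truncn (e / 2)^-1.
have je : j.+1%:R^-1 < e / 2.
  by rewrite -[ltRHS]invrK ltf_pV2 ?posrE ?invr_gt0// truncnS_gt.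
have j0 : 0 < j.+1%:R^-1 :> R by rewrite invr_gt0.
have /choice[qf qfP] (i : 'I_d) := rat_approx (xi i 0) j0.
exists (\col_i qf i), j; split.
  by move=> i l; rewrite (ord1 l) !mxE.
move=> [v /dual_latticeP[eta etav] vQ].
have : (~` [set v : 'cV[R]_d | D ((Rrep rho g)^T *m v)]) v.
  apply: he; split=> [|i l]; first exact: e0.
  rewrite (ord1 l) /ball /=.
  have h1 := qfP i; have := vQ i 0; rewrite !mxE => h2.
  have -> : xi i 0 - v i 0 = (xi i 0 - ratr (qf i)) - (v i 0 - ratr (qf i)).
    by rewrite opprB addrA subrK.
  by apply: le_lt_trans (ler_normB _ _) _; apply: lt_trans (ltrD h1 h2) _; rewrite [e]splitr ltrD.
by apply; exists eta; rewrite -etav Rrep_trK.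
Qed.

Lemma box_nbhs q j xi : box q j xi -> nbhs xi (box q j).
Proof.
move=> Qxi; apply: open_nbhs_nbhs; split=> //.
by apply: open_box => v; exact: cvg_id.
Qed.

Variable a : G0.
Variable mu : probability X0 R.
Hypothesis hmu : ergodic mu (lact Gamma0 a).
Hypothesis hnc : non_concentrated a mu.
Hypothesis hconn : connected_group G.
Hypothesis hirr : irreducible_over_rat rho.
Hypothesis hd : (1 < d)%N.
Local Notation T0 := (lact Gamma0 a : X0 -> X0).

Definition fixator zeta : set G0 := [set h | (Rrep rho h)^T *m zeta = zeta].

Lemma fixator_subgroup zeta : is_subgroup (fixator zeta).
Proof.
split=> [|h h' hz h'z]; first by rewrite /fixator /= Rrep1 trmx1 mul1mx.
by rewrite /fixator /= RrepM trmx_mul -mulmxA (Rrep_tr_fixV hz) h'z.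
Qed.

Lemma fixator_zariski_closed zeta : zariski_closed (fixator zeta).
Proof.
pose p (i : 'I_d) : mpoly (n * n + 1) R :=
  \sum_j (mpolyC (n * n + 1) (zeta j 0) * map_mpoly (ratR R) (rr_mx rho j i)) -
  mpolyC (n * n + 1) (zeta i 0).
have pE i (h : G0) : meval (gl_coord (val h)) (p i) = ((Rrep rho h)^T *m zeta) i 0 - zeta i 0.
  rewrite /p mevalB meval_sum mevalC; congr (_ - _).
  rewrite mxE; apply: eq_bigr => j _; rewrite mevalM mevalC mulrC !mxE.
  by rewrite (rat_evalE (ratR R)).
exists [set q | exists i, q = p i]; apply/seteqP; split=> h /=.
  by move=> hz _ [i ->]; rewrite pE hz subrr.
move=> hp; apply/matrixP => i j; rewrite (ord1 j); apply/eqP; rewrite -subr_eq0 -pE.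
by rewrite hp//; exists i.
Qed.

(** The points whose dual lattice contains a given fixed covector form countably many
    closed orbits of its stabilizer, which is a strict subgroup since no rational
    covector is fixed by the whole group. *)
Lemma fixed_covector_null zeta : zeta != 0 -> fixator zeta a ->
  mu.-negligible [set x | dual_lattice x zeta].
Proof.
move=> zeta0 az; have [_ erg] := hmu.
pose E eta : set X0 := [set x | exists2 g, hproj Gamma0 g = x & dualvec g eta = zeta].
have E_null eta : mu.-negligible (E eta).
  have [[x0 [g0 _ g0E]]|E0] := pselect (exists x, E eta x); last first.
    rewrite (_ : E eta = set0); first exact: negligible_set0.
    by rewrite -subset0 => x Ex; apply: E0; exists x.
  have EH : E eta = [set hproj Gamma0 (h * g0)%g | h in fixator zeta].
    apply/seteqP; split=> x /=.
      move=> [g <- gE]; exists (g * g0^-1)%g; last by rewrite -mulgA mulVg mulg1.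
      have e : (Rrep rho g)^T *m zeta = intv R eta by rewrite -gE Rrep_trK.
      by rewrite /fixator /= RrepM trmx_mul -mulmxA e -[RHS]g0E.
    move=> [h hz <-]; exists (h * g0)%g => //.
    by rewrite dualvecM g0E (Rrep_tr_fixV hz).
  have cE : closed (E eta : set (hspace Gamma0)).
    apply/closed_hspaceP.
    pose D : set 'cV[R]_d := [set v | exists2 c, Gamma0 c & v = dualvec c eta].
    have -> : hproj Gamma0 @^-1` E eta = [set g : G0 | D ((Rrep rho g)^T *m zeta)].
      apply/seteqP; split=> g /=.
        move=> [h /esym/(hproj_eqM sub0)[c Gc ->] <-]; exists c => //.
        by rewrite dualvecM Rrep_trK.
      move=> [c Gc e]; exists (g * c)%g; first exact: (hprojMr sub0).
      by rewrite dualvecM -e Rrep_trVK.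
    apply: (@closed_integer_preimage R G0 _ _ (fun g => (Rrep rho g)^T *m zeta) D).
      exact: continuous_Rrep_tr.
    move=> _ [c Gc ->]; apply: mxOver_mul_int; last exact: intv_int.
    apply/mxOverP => i j; rewrite mxE.
    by apply: (mxOverP (lattice_Rrep_int hGamma0 _)); exact: (subgroupV sub0).
  have mE : measurable (E eta) by exact: closed_borel.
  have inv : T0 @^-1` E eta = E eta.
    rewrite EH; apply/seteqP; split=> x /=.
      have [g <-] := hproj_surj (x : hspace Gamma0).
      rewrite (lact_hproj sub0) => -[h hz /(hproj_eqM sub0)[c Gc e]].
      exists (a^-1 * h)%g; first by have [_] := fixator_subgroup zeta; apply.
      have -> : g = (a^-1 * h * g0 * c)%g.
        by rewrite -!mulgA [(h * _)%g]mulgA -e mulgA mulVg mul1g.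
      by apply/esym; exact: (hprojMr sub0).
    move=> [h hz <-]; rewrite (lact_hproj sub0); exists (a * h)%g; last by rewrite mulgA.
    exact: (subgroupM (fixator_subgroup zeta)).
  apply/negligibleP => //; have [//|E1] := erg _ mE inv.
  have [HT|HT] := eqVneq (fixator zeta) [set: G0].
    exfalso; have g0z : fixator zeta g0 by rewrite HT.
    have zE : zeta = intv R eta.
      by have := Rrep_trK g0 (intv R eta); rewrite -/(dualvec g0 eta) g0E (g0z : _ = _).
    apply: (no_fixed_covector hconn hirr hd (eta := eta)).
      by rewrite -(intv_eq0 R) -zE.
    move=> g; have gz : fixator zeta g by rewrite HT.
    by move: gz; rewrite /fixator /= zE.
  have := hnc (fixator_subgroup zeta) (fixator_zariski_closed zeta) HT az (x := g0).
  by rewrite -EH E1 ltxx => /(_ cE).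
pose F (t : nat) := if (unpickle t : option 'cV[int]_d) is Some eta then E eta else set0.
apply: (@negligibleS _ _ _ _ (\bigcup_t F t)).
  move=> x /=; have [g <-] := hproj_surj (x : hspace Gamma0).
  move=> /dual_latticeP[eta e]; exists (pickle eta) => //.
  by rewrite /F pickleK; exists g.
apply: negligible_bigcup => t; rewrite /F; case: unpickle => [eta|]; first exact: E_null.
exact: negligible_set0.
Qed.

Definition eventually_in (E : set X0) : set X0 :=
  \bigcup_N \bigcap_(k in [set k | (N <= k)%N]) (iter k T0 @^-1` E).

Lemma measurable_iter_lact k : measurable_fun setT (iter k T0).
Proof.
elim: k => [|k IH]; first exact: measurable_id.
exact: (measurableT_comp (measurable_lact0 hGamma0 a) IH).
Qed.

Lemma iter_preserving k E : measurable E -> mu (iter k T0 @^-1` E) = mu E.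
Proof.
have [[mT pT] _] := hmu; move=> mE; elim: k => [//|k IH].
rewrite -IH -(pT (iter k T0 @^-1` E)).
  by congr (mu _); apply/seteqP; split=> x; rewrite /preimage /= -iterSr.
by rewrite -[_ @^-1` _]setTI; exact: measurable_iter_lact.
Qed.

Lemma measurable_iter_preimage k E : measurable E -> measurable (iter k T0 @^-1` E).
Proof. by move=> mE; rewrite -[_ @^-1` _]setTI; exact: measurable_iter_lact. Qed.

Lemma measurable_eventually_in E : measurable E -> measurable (eventually_in E).
Proof.
move=> mE; apply: bigcupT_measurable => N; apply: bigcap_measurable.
  by exists N => /=.
by move=> k _; exact: measurable_iter_preimage.
Qed.

(** The set is invariant, and its measure is the limit of measures at most equal to
    that of [E]. *)
Lemma eventually_in_null E : measurable E -> (mu E < 1)%E -> mu (eventually_in E) = 0%E.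
Proof.
move=> mE E1; have [_ erg] := hmu.
have mev := measurable_eventually_in mE.
have inv : T0 @^-1` eventually_in E = eventually_in E.
  apply/seteqP; split=> x /= [N _ h].
    exists N.+1 => // -[//|k] /= Nk; rewrite /preimage /= -iterS iterSr.
    exact: h.
  exists N => // k /= Nk; rewrite /preimage /= -iterSr.
  by apply: h => /=; exact: leqW.
have [//|ev1] := erg _ mev inv.
exfalso; pose F (N : nat) := \bigcap_(k in [set k | (N <= k)%N]) (iter k T0 @^-1` E).
have mF N : measurable (F N).
  apply: bigcap_measurable; first by exists N => /=.
  by move=> k _; exact: measurable_iter_preimage.
have nF : nondecreasing_seq F.
  by move=> N M NM; apply/subsetPset => x h k /= Mk; apply: h; exact: leq_trans Mk.
have cF := nondecreasing_cvg_mu (mu := mu) mF mev nF.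
have le N : (mu (F N) <= mu E)%E.
  rewrite -(iter_preserving N mE); apply: le_measure; rewrite ?inE//.
    exact: measurable_iter_preimage.
  by move=> x; apply => /=.
have : (mu (eventually_in E) <= mu E)%E.
  have := cvg_lim (@ereal_hausdorff R) cF => <-.
  apply: lime_le; first by apply/cvg_ex; exists (mu (eventually_in E)).
  exact: nearW.
by rewrite ev1 leNgt E1.
Qed.

Local Notation A := ((Rrep rho a^-1%g)^T).

Definition converging_orbit : set X0 := [set x | exists2 xi, dual_lattice x xi &
  exists L : 'cV[R]_d, [/\ L != 0, A *m L = L &
    forall i, iter k (mulmx A) xi i 0 @[k --> \oo] --> L i 0]].

Lemma dual_lattice_iter x xi k : dual_lattice x xi ->
  dual_lattice (iter k T0 x) (iter k (mulmx A) xi).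
Proof.
by move=> xxi; elim: k => [//|k IH]; rewrite !iterS; exact: dual_lattice_lact.
Qed.

(** If the orbit of a covector of the dual lattice converges to [L], then the dual
    lattices of the points of the orbit eventually meet all neighborhoods of [L],
    which forces [L] itself to be in almost all dual lattices. *)
Lemma converging_orbit_null : exists2 B, measurable B & mu B = 0%E /\ converging_orbit `<=` B.
Proof.
pose J := ('cV[rat]_d * nat)%type.
pose F (t : nat) : set X0 := if (unpickle t : option J) is Some (q, j) then
  if `[< (mu (meets (box q j)) < 1)%E >] then eventually_in (meets (box q j)) else set0
  else set0.
have mQ q j : measurable (meets (box q j)) by apply: open_borel; exact: open_meets.
have mF t : measurable (F t).
  rewrite /F; case: unpickle => [[q j]|//]; case: asboolP => // _.
  exact: measurable_eventually_in.
exists (\bigcup_t F t); first exact: bigcupT_measurable.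
split.
  apply: measure_negligible; first exact: bigcupT_measurable.
  apply: negligible_bigcup => t; apply/negligibleP => //.
  rewrite /F; case: unpickle => [[q j]|]; last by rewrite measure0.
  by case: asboolP => [E1|_]; [exact: eventually_in_null|rewrite measure0].
move=> x [xi xxi [L [L0 AL cvL]]].
have aL : fixator L a by have := congr1 (mulmx (Rrep rho a)^T) AL; rewrite Rrep_trK.
have [q [j [LQ Q1]]] : exists q j, box q j L /\ (mu (meets (box q j)) < 1)%E.
  apply: contrapT => h.
  have full q j : box q j L -> mu.-negligible (~` meets (box q j)).
    move=> LQ; apply/negligibleP; first exact: measurableC.
    apply: (measure_setC0 (probability_setT mu)) => //.
    apply/eqP; rewrite eq_le probability_le1// leNgt; apply/negP => Q1.
    by apply: h; exists q, j.
  pose C (t : nat) : set X0 := if (unpickle t : option J) is Some (q, j) then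
    if `[< box q j L >] then ~` meets (box q j) else set0 else set0.
  have : mu.-negligible [set: X0].
    apply: (@negligibleS _ _ _ _ ([set x | dual_lattice x L] `|` \bigcup_t C t)).
      move=> z _; have [zL|zL] := pselect (dual_lattice z L); first by left.
      have [q [j [LQ nz]]] := box_separates zL.
      right; exists (pickle ((q, j) : J)) => //; rewrite /C pickleK.
      by case: asboolP.
    apply: negligibleU; first exact: fixed_covector_null.
    apply: negligible_bigcup => t; rewrite /C; case: unpickle => [[q j]|]; last exact: negligible_set0.
    by case: asboolP => [LQ|_]; [exact: full|exact: negligible_set0].
  move=> neg; have m0 := measure_negligible (@measurableT _ X0) neg.
  by have /eqP := etrans (esym (probability_setT mu)) m0; rewrite onee_eq0.
have near_box : \forall k \near \oo, box q j (iter k (mulmx A) xi).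
  have cL : iter k (mulmx A) xi @[k --> \oo] --> L.
    move=> U [/= P LP PU].
    have : \forall k \near \oo, forall i l, P i l (iter k (mulmx A) xi i l).
      apply: filter_forall => i; apply: filter_forall => l; move: (LP i l); rewrite (ord1 l).
      exact: (cvL i).
    by apply: filterS => k Pk; apply: PU.
  exact: (cL _ (box_nbhs LQ)).
have [N _ hN] := near_box.
exists (pickle ((q, j) : J)) => //; rewrite /F pickleK; case: asboolP => // _.
exists N => // k /= Nk; exists (iter k (mulmx A) xi); last exact: hN.
exact: dual_lattice_iter.
Qed.

Hypothesis ha : triang_pos a.

(** The eigenvalues of [A] are the inverses of those of [rho(a)]. *)
Lemma dual_spectrum : exists2 s, all (fun r => 0 < r) s & forall v, shift_prod A s v = 0.
Proof.
apply: (@positive_spectrumP R d A (Rrep rho a^-1%g)); first exact: char_poly_tr.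
move=> z; rewrite -eigenvalue_root_char => /eigenvalueP[v vz v0].
have [_ /(_ d rho z^-1) pos] := ha.
have vA : v *m map_mx (real_complex R) (Rrep rho a^-1%g) *m
    Crep rho (real_to_complex a) = v.
  by rewrite Crep_real -mulmxA -map_mxM Rrep_invl map_mx1 mulmx1.
have z0 : z != 0.
  by apply: contraNneq v0 => z0; rewrite -vA vz z0 scale0r mul0mx.
have [|r r0 rE] := pos.
  apply/eigenvalueP; exists v => //.
  by rewrite -[in RHS]vA vz -scalemxAl scalerA mulVf// scale1r.
by exists r^-1; rewrite ?invr_gt0// -[z]invrK rE fmorphV.
Qed.

Lemma Rrep_iter k xi : (Rrep rho (a ^+ k)^-1%g)^T *m xi = iter k (mulmx A) xi.
Proof.
elim: k => [|k IH]; first by rewrite expg0 invg1 Rrep1 trmx1 mul1mx.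
by rewrite iterS -IH expgS invgM RrepM trmx_mul mulmxA.
Qed.

Local Notation Res k eta1 eta2 := (@resonant R n G d rho Gamma0 (a ^+ k)%g eta1 eta2).

(** By invariance of [mu], the frequency [eta1] lies in a fixed shell [S j] at all
    times up to small measure.  If the resonance holds at infinitely many such times,
    the orbit of the frequency [eta2] recurs in the shell, hence converges, which
    only happens in a null set. *)
Lemma resonant_cvg0_neq0 eta1 eta2 : eta1 != 0 -> eta2 != 0 ->
  fine (mu (Res k eta1 eta2)) @[k --> \oo] --> (0 : R).
Proof.
move=> eta10 eta20; have [B mB [B0 orbB]] := converging_orbit_null.
have mu1 := probability_setT mu.
pose sq x := sqnorm (frequency eta1 x).
have msq : measurable_fun setT sq.
  apply: measurable_sum => i; apply: measurable_funX; exact: (measurable_frequency hGamma0).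
have sq0 x : 0 < sq x.
  rewrite /sq /sqnorm lt_def sumr_ge0 ?andbT => [|i _]; last exact: sqr_ge0.
  apply: contraTneq eta10 => /eqP; rewrite psumr_eq0 => [/allP q0|i _]; last exact: sqr_ge0.
  rewrite negbK -(@frequency_eq0 R n G d rho Gamma0 eta1 x); apply/eqP/matrixP => i l.
  by rewrite (ord1 l) [RHS]mxE; have /= := q0 i (mem_index_enum i); rewrite sqrf_eq0 => /eqP.
pose S (j : nat) : set X0 := [set x | j.+1%:R^-1 <= sq x <= j.+1%:R].
have mS j : measurable (S j).
  have -> : S j = sq @^-1` `[j.+1%:R^-1, j.+1%:R].
    by apply/seteqP; split=> x; rewrite /= in_itv.
  by rewrite -[_ @^-1` _]setTI; exact: msq.
have cS : fine (mu (~` S j)) @[j --> \oo] --> (0 : R).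
  have -> : (fun j => fine (mu (~` S j))) = (fun j => \int[mu]_x \1_(~` S j) x).
    by apply/funext => j; rewrite bint_indic//; exact: measurableC.
  rewrite -[X in _ --> X](bint_cst mu1).
  apply: (@bint_cvg _ _ _ mu mu1 (fun j x => \1_(~` S j) x) (fun=> 0) 1) => //.
  - by move=> j; apply: measurable_indic; exact: measurableC.
  - by move=> j x; rewrite indicE; case: (_ \in _); rewrite ?normr1 ?normr0 ?ler01.
  move=> x; apply: cvg_near_cst.
  exists (maxn (Num.truncn (sq x)) (Num.truncn (sq x)^-1)) => // j /=.
  rewrite geq_max => /andP[j1 j2]; rewrite indicE memNset//; apply.
  apply/andP; split.
    rewrite -[leRHS]invrK lef_pV2 ?posrE ?invr_gt0//.
    by apply: le_trans (ltW (truncnS_gt _)) _; rewrite ler_nat ltnS.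
  by apply: le_trans (ltW (truncnS_gt _)) _; rewrite ler_nat ltnS.
pose V j k := (Res k eta1 eta2 `&` iter k T0 @^-1` S j) `\` B.
have mR k : measurable (Res k eta1 eta2) by exact: measurable_resonant.
have mV j k : measurable (V j k).
  apply: measurableD => //; apply: measurableI => //; exact: measurable_iter_preimage.
have cV j : fine (mu (V j k)) @[k --> \oo] --> (0 : R).
  have -> : (fun k => fine (mu (V j k))) = (fun k => \int[mu]_x \1_(V j k) x).
    by apply/funext => k; rewrite bint_indic.
  rewrite -[X in _ --> X](bint_cst mu1).
  apply: (@bint_cvg _ _ _ mu mu1 (fun k x => \1_(V j k) x) (fun=> 0) 1) => //.
  - by move=> k; exact: measurable_indic.
  - by move=> k x; rewrite indicE; case: (_ \in _); rewrite ?normr1 ?normr0 ?ler01.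
  move=> x; apply: cvg_near_cst.
  have [[N hN]|io] := pselect (exists N, forall k, (N <= k)%N -> ~ V j k x).
    by exists N => // k /= Nk; rewrite indicE memNset//; exact: hN.
  exfalso.
  have io' N : exists2 k, (N <= k)%N & V j k x.
    apply: contrapT => h; apply: io; exists N => k Nk Vk; apply: h.
    by exists k.
  have nB : ~ B x by have [k _ [_]] := io' 0%N.
  apply: nB; apply: orbB; exists (frequency eta2 x); first by exists eta2.
  have [s s0 hs] := dual_spectrum.
  have j0 : 0 < j.+1%:R^-1 :> R by rewrite invr_gt0.
  have sqN (v : 'cV[R]_d) : sqnorm (- v) = sqnorm v.
    by apply: eq_bigr => i _; rewrite mxE sqrrN.
  apply: (recurrent_orbit_cvg (ex_intro2 _ _ s s0 hs) j0 (hi := j.+1%:R)) => N.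
  have [k Nk [[res Sk] _]] := io' N; exists k => //.
  move: Sk; rewrite /S /preimage /= /sq (iter_lact sub0).
  suff -> : sqnorm (frequency eta1 (lact Gamma0 (a ^+ k)%g x)) =
    sqnorm (iter k (mulmx A) (frequency eta2 x)) by [].
  rewrite -Rrep_iter; case: res => [<-|/(congr1 -%R)]; first by rewrite Rrep_trVK.
  by rewrite opprK => <-; rewrite mulmxN Rrep_trVK sqN.
apply/cvgrPdist_le => e e0; have e2 : 0 < e / 2 by rewrite divr_gt0.
have /cvgrPdist_le/(_ _ e2)[j _ /(_ j (leqnn j))] := cS; rewrite /= sub0r normrN => hj.
have /cvgrPdist_le/(_ _ e2) := cV j; apply: filterS => k.
rewrite !sub0r !normrN => hk.
have fin E : measurable E -> (fine (mu E))%:E = mu E.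
  by move=> mE; rewrite fineK// fin_num_measure.
have mSC : measurable (~` S j) by exact: measurableC.
have mSk : measurable (iter k T0 @^-1` (~` S j)) by exact: measurable_iter_preimage.
rewrite ger0_norm ?fine_ge0// in hj; rewrite ger0_norm ?fine_ge0// in hk.
rewrite ger0_norm ?fine_ge0//; apply: (@le_trans _ _ (fine (mu (V j k)) + fine (mu (~` S j)))); last by rewrite [e]splitr lerD.
rewrite -lee_fin EFinD (fin _ (mR k)) (fin _ (mV j k)) (fin _ mSC).
apply: (@le_trans _ _ (mu (V j k) + (mu B + mu (iter k T0 @^-1` (~` S j))))%E); last first.
  have eS : (mu B + mu (iter k T0 @^-1` (~` S j)))%E = mu (~` S j) :=
    etrans (congr2 adde B0 (iter_preserving k mSC)) (add0e _).
  by apply: leeD2l; rewrite eS; exact: lexx.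
apply: (@le_trans _ _ (mu (V j k) + mu (B `|` iter k T0 @^-1` (~` S j)))%E); last first.
  by apply: leeD2l; exact: measureU2.
apply: le_trans (measureU2 _ _ _) => //; last exact: measurableU.
apply: le_measure; rewrite ?inE//; first by apply: measurableU => //; exact: measurableU.
move=> x rx; have [Bx|nB] := pselect (B x); first by right; left.
have [Sx|nS] := pselect (S j (iter k T0 x)); last by right; right.
by left.
Qed.

(** Two frequencies only one of which is zero never resonate. *)
Lemma resonant_cvg0 eta1 eta2 : (eta1 != 0) || (eta2 != 0) ->
  fine (mu (Res k eta1 eta2)) @[k --> \oo] --> (0 : R).
Proof.
have empty k : (eta1 == 0) != (eta2 == 0) -> Res k eta1 eta2 = set0.
  move=> ne; rewrite -subset0 => x res; move/negP: ne; apply; apply/eqP.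
  rewrite -(@frequency_eq0 R n G d rho Gamma0 eta2 x) -(@frequency_eq0 R n G d rho Gamma0 eta1 (lact Gamma0 (a ^+ k)%g x)).
  rewrite -(Rrep_tr_eq0 rho (a ^+ k)%g).
  by case: res => ->; rewrite ?oppr_eq0.
have cempty : (eta1 == 0) != (eta2 == 0) -> fine (mu (Res k eta1 eta2)) @[k --> \oo] --> (0 : R).
  move=> ne; have -> : (fun k => fine (mu (Res k eta1 eta2))) = (fun=> 0).
    by apply/funext => k; rewrite empty// measure0.
  exact: cvg_cst.
case: (eqVneq eta1 0) cempty => [-> c|e1 c] /=; case: (eqVneq eta2 0) c => [->|e2] c h //;
  try exact: c.
by apply: resonant_cvg0_neq0.
Qed.

End dual_lattices.

(** * Null sequences *)

(** What strong mixing (sequences tending to 0) and weak mixing (sequences tending to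
    0 in mean) have in common. *)
Record null_class (R : realType) (N : (nat -> R) -> Prop) : Prop := NullClass {
  null_cvg0 : forall u, u @ \oo --> (0 : R) -> N u;
  nullD : forall u v, N u -> N v -> N (fun k => u k + v k);
  nullZ : forall (c : R) u, N u -> N (fun k => c * u k);
  null_lim : forall v, (forall e : R, 0 < e -> exists2 u, N u & forall k, `|v k - u k| <= e) ->
    N v }.

Section null_sequences.
Variable R : realType.
Implicit Types (u v : nat -> R) (e c : R).

Definition mean_null u := arithmetic_mean (fun k => `|u k|) @ \oo --> (0 : R).

Lemma arithmetic_mean_le u v n : (forall k, u k <= v k) ->
  arithmetic_mean u n <= arithmetic_mean v n.
Proof.
move=> uv; rewrite /arithmetic_mean /= ler_wpM2l ?invr_ge0//.
by rewrite /series /=; apply: ler_sum.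
Qed.

Lemma arithmetic_meanD u v n :
  arithmetic_mean (fun k => u k + v k) n = arithmetic_mean u n + arithmetic_mean v n.
Proof. by rewrite /arithmetic_mean /= /series /= big_split mulrDr. Qed.

Lemma arithmetic_meanZ c u n :
  arithmetic_mean (fun k => c * u k) n = c * arithmetic_mean u n.
Proof. by rewrite /arithmetic_mean /= /series /= -mulr_sumr mulrCA. Qed.

Lemma arithmetic_mean_cst c n : arithmetic_mean (fun=> c) n = c.
Proof.
rewrite /arithmetic_mean /= /series /= sumr_const_nat subn0 -[c *+ _]mulr_natl.
by rewrite mulKf// pnatr_eq0.
Qed.

Lemma mean_ge0 u n : 0 <= arithmetic_mean (fun k => `|u k|) n.
Proof.
by rewrite -[leLHS](arithmetic_mean_cst 0 n); apply: arithmetic_mean_le.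
Qed.

Lemma strong_null_class : null_class (fun u => u @ \oo --> (0 : R)).
Proof.
split=> [u//|u v u0 v0|c u u0|v approx].
- by rewrite -[X in _ --> X]addr0; exact: cvgD.
- by rewrite -[X in _ --> X](mulr0 c); exact: cvgMl_tmp.
apply/cvgrPdist_le => e e0; have e2 : 0 < e / 2 by rewrite divr_gt0.
have [u u0 uv] := approx _ e2.
have /cvgrPdist_le/(_ _ e2) := u0; apply: filterS => k; rewrite !sub0r !normrN => uk.
rewrite -[v k](subrK (u k)); apply: le_trans (ler_normD _ _) _.
by rewrite [e]splitr lerD.
Qed.

Lemma weak_null_class : null_class mean_null.
Proof.
split=> [u u0|u v u0 v0|c u u0|v approx].
- by apply: cesaro; rewrite -(normr0 R); exact: cvg_norm.
- apply: (@squeeze_cvgr _ _ _ _ (fun=> 0)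
    (fun n => arithmetic_mean (fun k => `|u k|) n + arithmetic_mean (fun k => `|v k|) n)).
  + apply: nearW => n; rewrite mean_ge0 -arithmetic_meanD.
    by apply: arithmetic_mean_le => k; exact: ler_normD.
  + exact: cvg_cst.
  + by rewrite -[X in _ --> X]addr0; exact: cvgD.
- rewrite /mean_null.
  have -> : arithmetic_mean (fun k => `|c * u k|) =
      (fun n => `|c| * arithmetic_mean (fun k => `|u k|) n).
    apply/funext => n; rewrite -arithmetic_meanZ; congr (arithmetic_mean _ n).
    by apply/funext => k; rewrite normrM.
  by rewrite -[X in _ --> X](mulr0 `|c|); exact: cvgMl_tmp.
apply/cvgrPdist_le => e e0; have e2 : 0 < e / 2 by rewrite divr_gt0.
have [u u0 uv] := approx _ e2.
have /cvgrPdist_le/(_ _ e2) := u0; apply: filterS => n; rewrite !sub0r !normrN.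
rewrite !ger0_norm ?mean_ge0// => un.
apply: (@le_trans _ _ (arithmetic_mean (fun k => `|u k| + e / 2) n)).
  apply: arithmetic_mean_le => k; rewrite -{1}[v k](subrK (u k)).
  by rewrite addrC; apply: le_trans (ler_normD _ _) _; rewrite lerD2l.
by rewrite arithmetic_meanD arithmetic_mean_cst [leRHS]splitr lerD2r.
Qed.

End null_sequences.

(** * Ergodicity and mixing of the lifted action *)

Section invariant_functions.
Context d (T : measurableType d) (R : realType).
Variables (mu : probability T R) (f : T -> T).
Hypothesis erg : ergodic mu f.

Lemma measurable_iter k : measurable_fun setT (iter k f).
Proof.
have [[mf _] _] := erg.
by elim: k => [|k IH]; [exact: measurable_id|exact: (measurableT_comp mf IH)].
Qed.

(** The positive part of [int phi - phi] has mean zero, since it either vanishes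
    almost everywhere or coincides almost everywhere with [int phi - phi]. *)
Lemma ergodic_invariant_mean (phi : T -> R) : bounded_fun phi ->
  (forall x, phi (f x) = phi x) -> \int[mu]_x `|phi x - \int[mu]_z phi z| = 0.
Proof.
move=> bphi inv; have [_ erg0] := erg; set c := \int[mu]_z phi z.
have mu1 := probability_setT mu.
have bc := bounded_fun_cst T c; have bd := bounded_funB bc bphi.
pose E := [set x | phi x < c].
have mE : measurable E.
  have -> : E = phi @^-1` `]-oo, c[ by apply/seteqP; split=> x; rewrite /= in_itv.
  by rewrite -[_ @^-1` _]setTI; have [mphi _] := bphi; exact: mphi.
have fE : f @^-1` E = E by apply/seteqP; split=> x; rewrite /E /preimage /= inv.
pose pos x := \1_E x * (c - phi x).
have bE : bounded_fun (\1_E : T -> R) := bounded_fun_indic R mE.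
have bpos : bounded_fun pos by exact: bounded_funM.
have int0 : \int[mu]_x (c - phi x) = 0 by rewrite bintB// bint_cst// subrr.
have pos0 : \int[mu]_x pos x = 0.
  have [E0|E1] := erg0 _ mE fE.
    rewrite -(bint_cst mu1 (0 : R)).
    apply: (@bint_on _ _ _ mu mu1 _ _ (~` E)) => //; first exact: measurableC.
    - have mCE : measurable (~` E) by exact: measurableC.
      by rewrite -[LHS]add0e -E0 -measureU// ?setICr// setUv.
    - exact: bounded_fun_cst.
    - by move=> x nE; rewrite /pos indicE memNset// mul0r.
  rewrite -int0; apply: (@bint_on _ _ _ mu mu1 _ _ E) => // x Ex.
  by rewrite /pos indicE mem_set// mul1r.
have -> : (fun x => `|phi x - c|) = (fun x => 2 * pos x - (c - phi x)).
  apply/funext => x; rewrite /pos indicE; case: (boolP (x \in E)) => [/set_mem Ex|/negP nE].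
    by rewrite ltr0_norm ?subr_lt0// mul1r; ring.
  rewrite ger0_norm; first by rewrite mul0r mulr0 sub0r opprB.
  by rewrite subr_ge0 leNgt; apply/negP => h; apply: nE; rewrite inE.
have b2 := bounded_funZ 2 bpos.
by rewrite (bintB mu1 b2 bd) bintZ// pos0 int0 mulr0 subr0.
Qed.

End invariant_functions.

Section lifted_action.
Variables (R : realType) (n : nat) (G : alg_group R n) (d : nat).
Variables (rho : rat_rep G d) (Gamma0 : set (points (real_grp G))).
Hypothesis hGamma0 : admissible_lattice rho Gamma0.
Local Notation G0 := (points (real_grp G)).
Local Notation S := (semidirect rho).
Local Notation Gamma := (semidirect_lattice rho Gamma0).
Local Notation X0 := (borel_hspace Gamma0).
Local Notation X := (borel_hspace Gamma).
Local Notation bp := (@bundle_proj R n G d rho Gamma0).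
Local Notation trig_gen := (@trig_gen R n G d rho Gamma0).
Local Notation trig := (@trig R n G d rho Gamma0).
Variables (a : G0) (alpha : 'cV[R]_d).
Variables (mu : probability X0 R) (lambda : probability X R).
Hypothesis hmu : ergodic mu (lact Gamma0 a).
Hypothesis hnc : non_concentrated a mu.
Hypothesis hconn : connected_group G.
Hypothesis hirr : irreducible_over_rat rho.
Hypothesis hd : (1 < d)%N.
Hypothesis ha : triang_pos a.
Hypothesis muE : forall B : set X0, measurable B -> lambda (bp @^-1` B) = mu B.
Variable k : R.-pker X0 ~> X.
Hypothesis kx : forall x, is_fiber_haar x (k x).
Hypothesis lambdaE : forall B : set X, measurable B -> lambda B = (\int[mu]_x k x B)%E.
Implicit Types (A B : set X) (f g p q : X -> R).

Local Notation T := (lact Gamma ((a, alpha) : S) : X -> X).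
Local Notation T0 := (lact Gamma0 a : X0 -> X0).

Let sub0 := lattice_subgroup hGamma0.
Let subG := semidirect_lattice_subgroup hGamma0.
Let k1 x : k x setT = 1%E := @prob_kernel _ _ _ _ _ k x.
Let mu1 : mu setT = 1%E := probability_setT mu.
Let lambda1 : lambda setT = 1%E := probability_setT lambda.
Let s j : S := (((a, alpha) : S) ^+ j)%g.

Lemma semidirect_expg j : (s j).1 = (a ^+ j)%g.
Proof. by elim: j => [//|j IH]; rewrite /s !expgS -IH. Qed.

Lemma iterT j y : iter j T y = lact Gamma (s j) y.
Proof. exact: iter_lact. Qed.

Lemma bundle_proj_iter j y : bp (iter j T y) = iter j T0 (bp y).
Proof. by rewrite iterT bundle_proj_lact// semidirect_expg iter_lact. Qed.

Lemma measurable_bp (B : set X0) : measurable B -> measurable (bp @^-1` B).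
Proof.
by move=> mB; rewrite -[_ @^-1` _]setTI; exact: (measurable_bundle_proj hGamma0).
Qed.

Lemma measurable_iterT j : measurable_fun setT (iter j T).
Proof.
have -> : iter j T = lact Gamma (s j) by apply/funext => y; exact: iterT.
exact: measurable_lact.
Qed.

Lemma measurable_iterT_preimage j A : measurable A -> measurable (iter j T @^-1` A).
Proof. by move=> mA; rewrite -[_ @^-1` _]setTI; exact: measurable_iterT. Qed.

Lemma fine_lambda A : measurable A -> fine (lambda A) = \int[mu]_x fine (k x A).
Proof.
move=> mA; have bA : bounded_fun (\1_A : X -> R) := bounded_fun_indic R mA.
rewrite -bint_indic// (bint_disintegration mu1 lambda1 lambdaE bA).
by apply: eq_Rintegral => x _; rewrite bint_indic.
Qed.

Lemma bounded_kernel A : measurable A -> bounded_fun (fun x => fine (k x A)).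
Proof.
move=> mA; have bA : bounded_fun (\1_A : X -> R) := bounded_fun_indic R mA.
rewrite (_ : (fun x => _) = (fun x => \int[k x]_y \1_A y)); first exact: bounded_fun_kernel.
by apply/funext => x; rewrite bint_indic.
Qed.

Lemma kernel_T x A : measurable A -> k x (T @^-1` A) = k (T0 x) A.
Proof. by move=> mA; apply: fiber_haar_lact => //; exact: (kx (T0 x)). Qed.

Lemma fine_inj A B : measurable A -> measurable B ->
  fine (lambda A) = fine (lambda B) -> lambda A = lambda B.
Proof.
move=> mA mB e; rewrite -[LHS]fineK ?fin_num_measure// -[RHS]fineK ?fin_num_measure//.
by rewrite e.
Qed.

Lemma T_preserving : measure_preserving lambda T.
Proof.
have mT : measurable_fun setT T by exact: measurable_lact.
split=> // A mA; have [[mT0 pT0] _] := hmu.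
have mTA : measurable (T @^-1` A) by rewrite -[_ @^-1` _]setTI; exact: mT.
apply: fine_inj => //; rewrite !fine_lambda//.
rewrite -(bint_pushforward (m1 := mu) (m2 := mu) (phi := T0) mu1 mT0 pT0 (bounded_kernel mA)).
by apply: eq_Rintegral => x _; rewrite kernel_T.
Qed.

Lemma iterT_preserving j A : measurable A -> lambda (iter j T @^-1` A) = lambda A.
Proof.
have [mT pT] := T_preserving; move=> mA; elim: j => [//|j IH].
rewrite -IH -(pT (iter j T @^-1` A)); last exact: measurable_iterT_preimage.
by congr (lambda _); apply/seteqP; split=> y; rewrite /preimage /= -iterSr.
Qed.

Lemma bint_iterT j f : bounded_fun f ->
  \int[lambda]_y f (iter j T y) = \int[lambda]_y f y.
Proof.
by move=> bf; apply: (bint_pushforward lambda1 (measurable_iterT j)) => // B mB;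
  exact: iterT_preserving.
Qed.

Lemma trig_approx A e : measurable A -> 0 < e ->
  exists2 p, trig p & \int[lambda]_y `|\1_A y - p y| < e.
Proof.
move=> mA e0; have [_ h] := trig_dense hGamma0 (I := unit) (m := fun=> lambda)
  (fun=> lambda1) mA.
by have [p tp /(_ tt) pA] := h e e0; exists p.
Qed.

Lemma dist_integral A p : measurable A -> trig p ->
  `|\int[lambda]_y \1_A y - \int[lambda]_y p y| <= \int[lambda]_y `|\1_A y - p y|.
Proof.
move=> mA tp; have bA : bounded_fun (\1_A : X -> R) := bounded_fun_indic R mA.
have bp_ := bounded_trig hGamma0 tp.
by rewrite -bintB//; apply: bint_norm => //; exact: bounded_funB.
Qed.

Lemma bint_mul_dist f g p (M e : R) : bounded_fun f -> bounded_fun g -> bounded_fun p ->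
  (forall y, `|p y| <= M) -> \int[lambda]_y `|f y - g y| <= e ->
  `|\int[lambda]_y (f y * p y) - \int[lambda]_y (g y * p y)| <= M * e.
Proof.
move=> bf bg bp_ pM fg.
have M0 : 0 <= M by apply: le_trans (pM (hproj Gamma (1%g : S))).
have bd := bounded_fun_norm (bounded_funB bf bg).
rewrite -bintB//; try exact: bounded_funM.
apply: le_trans (bint_norm lambda1 _) _.
  by apply: bounded_funB; exact: bounded_funM.
apply: (@le_trans _ _ (\int[lambda]_y (M * `|f y - g y|))); last first.
  by rewrite bintZ// ler_wpM2l.
apply: bint_le => //.
- by apply: bounded_fun_norm; apply: bounded_funB; exact: bounded_funM.
- exact: bounded_funZ.
- by move=> y; rewrite -mulrBl normrM mulrC ler_wpM2r.
Qed.

Definition product_mean f g j := \int[lambda]_y (f (iter j T y) * g y).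

Lemma bounded_iterT f j : bounded_fun f -> bounded_fun (fun y => f (iter j T y)).
Proof. exact: (bounded_fun_comp (measurable_iterT j)). Qed.

Lemma product_meanDl f f' g j : bounded_fun f -> bounded_fun f' -> bounded_fun g ->
  product_mean (fun y => f y + f' y) g j = product_mean f g j + product_mean f' g j.
Proof.
move=> bf bf' bg; rewrite /product_mean -bintD//; try by apply: bounded_funM => //; exact: bounded_iterT.
by apply: eq_Rintegral => y _; rewrite mulrDl.
Qed.

Lemma product_meanDr f g g' j : bounded_fun f -> bounded_fun g -> bounded_fun g' ->
  product_mean f (fun y => g y + g' y) j = product_mean f g j + product_mean f g' j.
Proof.
move=> bf bg bg'; rewrite /product_mean -bintD//; try by apply: bounded_funM => //; exact: bounded_iterT.
by apply: eq_Rintegral => y _; rewrite mulrDr.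
Qed.

Lemma product_meanZl f g c j : bounded_fun f -> bounded_fun g ->
  product_mean (fun y => c * f y) g j = c * product_mean f g j.
Proof.
move=> bf bg; rewrite /product_mean -bintZ//; last by apply: bounded_funM => //; exact: bounded_iterT.
by apply: eq_Rintegral => y _; rewrite mulrA.
Qed.

Lemma product_meanZr f g c j : bounded_fun f -> bounded_fun g ->
  product_mean f (fun y => c * g y) j = c * product_mean f g j.
Proof.
move=> bf bg; rewrite /product_mean -bintZ//; last by apply: bounded_funM => //; exact: bounded_iterT.
by apply: eq_Rintegral => y _; rewrite mulrCA.
Qed.

Lemma product_mean_gen_cvg0 (A1 A2 : set X0) eta1 theta1 eta2 theta2 :
  measurable A1 -> measurable A2 -> (eta1 != 0) || (eta2 != 0) ->
  product_mean (trig_gen A1 eta1 theta1) (trig_gen A2 eta2 theta2) @ \oo --> (0 : R).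
Proof.
move=> mA1 mA2 ne.
have res0 := resonant_cvg0 hGamma0 hmu hnc hconn hirr hd ha ne.
apply: norm_cvg0; apply: (@squeeze_cvgr _ _ _ _ (fun=> 0) _ _ _ _ _ res0); last exact: cvg_cst.
apply: nearW => j; rewrite normr_ge0 /=.
have := trig_gen_correlation hGamma0 kx lambdaE eta1 theta1 eta2 theta2 (s j) mA1 mA2.
rewrite semidirect_expg; apply: le_trans; rewrite le_eqVlt; apply/orP; left; apply/eqP.
by congr `|_|; apply: eq_Rintegral => y _; rewrite iterT.
Qed.

Lemma product_mean_trig_cvg0 (A : set X0) eta theta q : measurable A -> eta != 0 -> trig q ->
  product_mean (trig_gen A eta theta) q @ \oo --> (0 : R).
Proof.
move=> mA eta0; have bg := bounded_trig_gen hGamma0 eta theta mA.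
elim=> [B eta' theta' mB|f g tf IH tg IH'|c f tf IH].
- by apply: product_mean_gen_cvg0; rewrite ?eta0.
- have bf := bounded_trig hGamma0 tf; have bg' := bounded_trig hGamma0 tg.
  rewrite (_ : product_mean _ _ = (fun j => product_mean (trig_gen A eta theta) f j +
     product_mean (trig_gen A eta theta) g j)).
    by rewrite -[X in _ --> X]addr0; exact: cvgD.
  by apply/funext => j; exact: product_meanDr.
- have bf := bounded_trig hGamma0 tf.
  rewrite (_ : product_mean _ _ = (fun j => c * product_mean (trig_gen A eta theta) f j)).
    by rewrite -[X in _ --> X](mulr0 c); exact: cvgMl_tmp.
  by apply/funext => j; exact: product_meanZr.
Qed.

Section invariant_set.
Variable A : set X.
Hypothesis mA : measurable A.
Hypothesis TA : T @^-1` A = A.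

Let bA : bounded_fun (\1_A : X -> R) := bounded_fun_indic R mA.

Lemma indic_iterT j y : \1_A (iter j T y) = \1_A y :> R.
Proof.
elim: j => [//|j IH]; rewrite iterS -IH.
by rewrite -[in RHS]TA !indicE; congr (nat_of_bool _)%:R; apply/idP/idP; rewrite !inE.
Qed.

Lemma indic_le1 y : `|\1_A y : R| <= 1.
Proof. by rewrite indicE; case: (_ \in _); rewrite ?normr1 ?normr0 ?ler01. Qed.

Lemma trig_gen_le1 (B : set X0) eta theta y : `|trig_gen B eta theta y| <= 1.
Proof.
rewrite normrM mulr_ile1//; last exact: cos_max.
by rewrite indicE; case: (_ \in _); rewrite ?normr1 ?normr0 ?ler01.
Qed.

(** For a nonzero frequency, invariance allows to move the wave by a large power of
    the action, and correlations decay; for the frequency zero, the measure of [A] in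
    the fibers is constant by ergodicity of the base. *)
Lemma invariant_set_trig p : trig p ->
  \int[lambda]_y (\1_A y * p y) = fine (lambda A) * \int[lambda]_y p y.
Proof.
elim=> [B eta theta mB|f g tf IH tg IH'|c f tf IH]; last 2 first.
- have bf := bounded_trig hGamma0 tf; have bg := bounded_trig hGamma0 tg.
  rewrite (bintD lambda1 bf bg) mulrDr -IH -IH' -bintD//; try exact: bounded_funM.
  by apply: eq_Rintegral => y _; rewrite mulrDr.
- have bf := bounded_trig hGamma0 tf.
  rewrite (bintZ lambda1 c bf) mulrCA -IH -bintZ//; last exact: bounded_funM.
  by apply: eq_Rintegral => y _; rewrite mulrCA.
rewrite (trig_gen_lambda hGamma0 kx lambdaE)//.
have bg := bounded_trig_gen hGamma0 eta theta mB.
case: eqVneq => [->|eta0]; last first.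
  rewrite mulr0; apply/eqP; rewrite -normr_le0; apply/ler_addgt0Pr => e e0; rewrite add0r.
  have e2 : 0 < e / 2 by rewrite divr_gt0.
  have [q tq qA] := trig_approx mA e2; have bq := bounded_trig hGamma0 tq.
  have := product_mean_trig_cvg0 theta mB eta0 tq.
  move=> /cvgrPdist_le/(_ _ e2)[j _ /(_ j (leqnn j))]; rewrite sub0r normrN => qj.
  have -> : \int[lambda]_y (\1_A y * trig_gen B eta theta y) =
      \int[lambda]_y (\1_A y * trig_gen B eta theta (iter j T y)).
    rewrite -(bint_iterT j (bounded_funM bA bg)).
    by apply: eq_Rintegral => y _; rewrite indic_iterT.
  have := bint_mul_dist bA bq (bounded_iterT j bg) (fun y => trig_gen_le1 (B : set X0) eta theta _) (ltW qA).
  rewrite mul1r; set I1 := \int[lambda]_y (\1_A y * _).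
  have -> : \int[lambda]_y (q y * trig_gen B eta theta (iter j T y)) =
      product_mean (trig_gen B eta theta) q j.
    by apply: eq_Rintegral => y _; rewrite mulrC.
  set I2 := product_mean _ _ _ in qj *; move=> I12.
  rewrite -[I1](subrK I2); apply: le_trans (ler_normD _ _) _.
  by rewrite [e]splitr lerD.
pose phi x := fine (k x A).
have bphi : bounded_fun phi by exact: bounded_kernel.
have phi_inv x : phi (T0 x) = phi x by rewrite /phi -kernel_T// TA.
have phi_c := ergodic_invariant_mean hmu bphi phi_inv.
rewrite (bint_disintegration mu1 lambda1 lambdaE (bounded_funM bA (bounded_trig_gen hGamma0 0 theta mB))).
have bB : bounded_fun (\1_B : X0 -> R) := bounded_fun_indic R mB.
have bBphi := bounded_funM bB bphi.
have -> : \int[mu]_x \int[k x]_y (\1_A y * trig_gen B 0 theta y) =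
    cos theta * \int[mu]_x (\1_B x * phi x).
  rewrite -bintZ//; apply: eq_Rintegral => x _.
  rewrite /phi -(bint_indic (k x))// mulrA -(bintZ (k1 x))//.
  apply: (bint_on (k1 x) (measurable_fiber hGamma0 x) (kx x).1).
  - exact: (bounded_funM bA (bounded_trig_gen hGamma0 0 theta mB)).
  - exact: bounded_funZ.
  - by move=> y yx; rewrite /trig_gen wave0 yx; ring.
rewrite [_ * cos theta]mulrC mulrCA; congr (_ * _).
rewrite fine_lambda// -(bint_indic mu)// -bintZ//.
apply/eqP; rewrite -subr_eq0 -normr_le0 -phi_c.
have bc := bounded_fun_cst X0 (\int[mu]_z phi z).
have bcB := bounded_funM bc bB.
rewrite -bintB//; apply: le_trans (bint_norm mu1 _) _; first exact: bounded_funB.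
apply: bint_le => //; first by apply: bounded_fun_norm; exact: bounded_funB.
  by apply: bounded_fun_norm; exact: bounded_funB.
move=> x; rewrite [\1_B x * _]mulrC -mulrBl normrM ler_piMr//.
by rewrite indicE; case: (_ \in _); rewrite ?normr1 ?normr0 ?ler01.
Qed.

(** Replacing one factor of [1_A * 1_A] by a trigonometric approximation gives
    [lambda A = lambda A * lambda A]. *)
Lemma invariant_set_01 : lambda A = 0%E \/ lambda A = 1%E.
Proof.
set c := fine (lambda A).
have cE : lambda A = c%:E by rewrite fineK// fin_num_measure.
have c0 : 0 <= c by rewrite fine_ge0.
have c1 : c <= 1 by rewrite -lee_fin -cE probability_le1.
have intA : \int[lambda]_y \1_A y = c by rewrite bint_indic.
have : c = c * c.
  apply/eqP; rewrite -subr_eq0 -normr_le0; apply/ler_addgt0Pr => e e0; rewrite add0r.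
  have e2 : 0 < e / 2 by rewrite divr_gt0.
  have [q tq qA] := trig_approx mA e2; have bq := bounded_trig hGamma0 tq.
  have h1 := bint_mul_dist bA bq bA indic_le1 (ltW qA); rewrite mul1r in h1.
  have h2 : `|\int[lambda]_y \1_A y - \int[lambda]_y q y| <= e / 2.
    by apply: le_trans (dist_integral mA tq) _; exact: ltW.
  have e1 : \int[lambda]_y (\1_A y * \1_A y) = c.
    rewrite -intA; apply: eq_Rintegral => y _.
    by rewrite indicE; case: (_ \in _); rewrite ?mulr1 ?mulr0.
  have e3 : \int[lambda]_y (q y * \1_A y) = c * \int[lambda]_y q y.
    rewrite -invariant_set_trig//; apply: eq_Rintegral => y _; exact: mulrC.
  rewrite e1 e3 in h1; rewrite intA in h2.
  set J := \int[lambda]_y q y in h1 h2.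
  have -> : c - c * c = (c - c * J) - c * (c - J) by ring.
  apply: le_trans (ler_normB _ _) _; rewrite [e]splitr lerD//.
  rewrite normrM (ger0_norm c0); apply: le_trans _ h2.
  by rewrite ler_piMl.
move=> cc; have : c * (c - 1) = 0 by rewrite mulrBr -cc mulr1 subrr.
by rewrite cE => /eqP; rewrite mulf_eq0 subr_eq0 => /orP[]/eqP ->; [left|right].
Qed.

End invariant_set.

Theorem lifted_ergodic : ergodic lambda T.
Proof. by split; [exact: T_preserving|move=> A mA TA; exact: invariant_set_01]. Qed.

Section mixing.
Variable N : (nat -> R) -> Prop.
Hypothesis nullN : null_class N.

Definition covariance f g j :=
  product_mean f g j - \int[lambda]_y f y * \int[lambda]_y g y.

Lemma correlation_covariance A B : measurable A -> measurable B ->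
  correlation lambda T A B = covariance \1_A \1_B.
Proof.
move=> mA mB; apply/funext => j; rewrite /covariance /correlation !bint_indic//.
congr (_ - _); rewrite -(bint_indic lambda).
  apply: eq_Rintegral => y _; rewrite indicI; congr (_ * _).
by apply: measurableI => //; exact: measurable_iterT_preimage.
Qed.

Lemma correlation_base (A B : set X0) : measurable A -> measurable B ->
  correlation lambda T (bp @^-1` A) (bp @^-1` B) = correlation mu T0 A B.
Proof.
move=> mA mB; apply/funext => j; rewrite /correlation !muE//; congr (fine _ - _).
rewrite -muE; last first.
  apply: measurableI => //; rewrite -[_ @^-1` _]setTI.
  exact: (measurable_iter hmu).
by congr (lambda _); apply/seteqP; split=> y [] /=; rewrite /preimage /= bundle_proj_iter.
Qed.

(** Waves of frequency zero come from the base; all other ones decorrelate. *)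
Lemma covariance_gen_null (A1 A2 : set X0) eta1 theta1 eta2 theta2 :
  (forall A B : set X0, measurable A -> measurable B -> N (correlation mu T0 A B)) ->
  measurable A1 -> measurable A2 ->
  N (covariance (trig_gen A1 eta1 theta1) (trig_gen A2 eta2 theta2)).
Proof.
move=> corN mA1 mA2; have [/andP[/eqP -> /eqP ->]|ne] := boolP ((eta1 == 0) && (eta2 == 0)).
  rewrite (_ : covariance _ _ = (fun j => cos theta1 * cos theta2 * correlation mu T0 A1 A2 j)).
    by apply: (nullZ nullN); exact: corN.
  have genE (A : set X0) theta : trig_gen A 0 theta = (fun y => cos theta * \1_(bp @^-1` A) y).
    by apply/funext => y; rewrite /trig_gen wave0 mulrC.
  have mB1 := measurable_bp mA1; have mB2 := measurable_bp mA2.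
  have b1 : bounded_fun (\1_(bp @^-1` A1) : X -> R) := bounded_fun_indic R mB1.
  have b2 : bounded_fun (\1_(bp @^-1` A2) : X -> R) := bounded_fun_indic R mB2.
  apply/funext => j; rewrite -correlation_base// correlation_covariance// !genE.
  rewrite /covariance product_meanZl//; last exact: bounded_funZ.
  by rewrite product_meanZr// !bintZ//; ring.
have ne' : (eta1 != 0) || (eta2 != 0) by rewrite -negb_and.
apply: (null_cvg0 nullN).
rewrite (_ : covariance _ _ = product_mean (trig_gen A1 eta1 theta1) (trig_gen A2 eta2 theta2)).
  exact: product_mean_gen_cvg0.
apply/funext => j; rewrite /covariance !(trig_gen_lambda hGamma0 kx lambdaE)//.
by case/orP: ne' => /negPf ->; rewrite ?mul0r ?mulr0 subr0.
Qed.

Lemma covariance_trig_null f g :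
  (forall A B : set X0, measurable A -> measurable B -> N (correlation mu T0 A B)) ->
  trig f -> trig g -> N (covariance f g).
Proof.
move=> corN tf; elim: tf g => [A1 eta1 theta1 mA1|{}f f' tf IH tf' IH'|c {}f tf IH] g tg.
- have b1 := bounded_trig_gen hGamma0 eta1 theta1 mA1.
  elim: tg => [A2 eta2 theta2 mA2|{}g g' tg IH tg' IH'|c {}g tg IH].
  + exact: covariance_gen_null.
  + have bg := bounded_trig hGamma0 tg; have bg' := bounded_trig hGamma0 tg'.
    rewrite (_ : covariance _ _ = (fun j => covariance (trig_gen A1 eta1 theta1) g j +
      covariance (trig_gen A1 eta1 theta1) g' j)); first exact: (nullD nullN).
    by apply/funext => j; rewrite /covariance product_meanDr// bintD//; ring.
  + have bg := bounded_trig hGamma0 tg.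
    rewrite (_ : covariance _ _ = (fun j => c * covariance (trig_gen A1 eta1 theta1) g j)).
      exact: (nullZ nullN).
    by apply/funext => j; rewrite /covariance product_meanZr// bintZ//; ring.
- have bf := bounded_trig hGamma0 tf; have bf' := bounded_trig hGamma0 tf'.
  have bg := bounded_trig hGamma0 tg.
  rewrite (_ : covariance _ _ = (fun j => covariance f g j + covariance f' g j)).
    by apply: (nullD nullN); [exact: IH|exact: IH'].
  by apply/funext => j; rewrite /covariance product_meanDl// bintD//; ring.
- have bf := bounded_trig hGamma0 tf; have bg := bounded_trig hGamma0 tg.
  rewrite (_ : covariance _ _ = (fun j => c * covariance f g j)).
    by apply: (nullZ nullN); exact: IH.
  by apply/funext => j; rewrite /covariance product_meanZl// bintZ//; ring.
Qed.

(** Covariances are continuous in mean, uniformly in time, in each factor as long as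
    the other one is bounded. *)
Theorem lifted_correlation_null :
  (forall A B : set X0, measurable A -> measurable B -> N (correlation mu T0 A B)) ->
  forall A B, measurable A -> measurable B -> N (correlation lambda T A B).
Proof.
move=> corN A B mA mB; rewrite correlation_covariance//.
have bA : bounded_fun (\1_A : X -> R) := bounded_fun_indic R mA.
have bB : bounded_fun (\1_B : X -> R) := bounded_fun_indic R mB.
apply: (null_lim nullN) => e e0.
have e4 : 0 < e / 4 by rewrite divr_gt0.
have [p tp pA] := trig_approx mA e4; have bp_ := bounded_trig hGamma0 tp.
have [_ [M0 pM0]] := bp_; pose M := `|M0| + 1.
have Mp : 0 < M by rewrite ltr_wpDl.
have pM y : `|p y| <= M by rewrite (le_trans (pM0 y))// (le_trans (ler_norm _))// lerDl.
have eM : 0 < e / 4 / M by rewrite !divr_gt0.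
have [q tq qB] := trig_approx mB eM; have bq := bounded_trig hGamma0 tq.
exists (covariance p q); first exact: covariance_trig_null.
move=> j; rewrite /covariance.
have Me : M * (e / 4 / M) = e / 4 by field; rewrite gt_eqF.
have bAj := bounded_iterT j bA; have bpj := bounded_iterT j bp_.
have h1 : `|product_mean \1_A \1_B j - product_mean p \1_B j| <= e / 4.
  rewrite -[leRHS]mul1r; apply: bint_mul_dist => //; first exact: indic_le1.
  rewrite (bint_iterT j (f := fun y => `|\1_A y - p y|)); first exact: ltW.
  by apply: bounded_fun_norm; exact: bounded_funB.
have h2 : `|product_mean p \1_B j - product_mean p q j| <= e / 4.
  rewrite -Me.
  have := bint_mul_dist bB bq bpj (fun y => pM _) (ltW qB).
  apply: le_trans; rewrite le_eqVlt; apply/orP; left; apply/eqP.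
  by congr `|_ - _|; apply: eq_Rintegral => y _; rewrite mulrC.
have h3 := le_trans (dist_integral mA tp) (ltW pA).
have h4 := le_trans (dist_integral mB tq) (ltW qB).
have B1 : `|\int[lambda]_y \1_B y| <= 1.
  by apply: (bint_norm_le lambda1 bB) => y; exact: indic_le1.
have P1 : `|\int[lambda]_y p y| <= M by apply: (bint_norm_le lambda1 bp_).
set IA := \int[lambda]_y \1_A y in h3 *; set IB := \int[lambda]_y \1_B y in h4 B1 *.
set Ip := \int[lambda]_y p y in h3 P1 *; set Iq := \int[lambda]_y q y in h4 *.
have h5 : `|(IA - Ip) * IB| <= e / 4.
  by rewrite normrM -[leRHS]mulr1; apply: ler_pM.
have h6 : `|Ip * (IB - Iq)| <= e / 4.
  by rewrite normrM -Me; apply: ler_pM.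
set u1 := product_mean \1_A \1_B j in h1 *; set u2 := product_mean p \1_B j in h1 h2.
set u3 := product_mean p q j in h2 *.
have -> : u1 - IA * IB - (u3 - Ip * Iq) =
  (u1 - u2) + (u2 - u3) - (IA - Ip) * IB - Ip * (IB - Iq) by ring.
apply: le_trans (ler_normB _ _) _; rewrite (_ : e = e / 4 + e / 4 + e / 4 + e / 4); last by field.
rewrite lerD//; apply: le_trans (ler_normB _ _) _; rewrite lerD//.
by apply: le_trans (ler_normD _ _) _; rewrite lerD.
Qed.

Lemma base_correlation_null :
  (forall A B, measurable A -> measurable B -> N (correlation lambda T A B)) ->
  forall A B : set X0, measurable A -> measurable B -> N (correlation mu T0 A B).
Proof.
move=> corN A B mA mB; rewrite -correlation_base//.
by apply: corN; exact: measurable_bp.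
Qed.

End mixing.

End lifted_action.

Theorem theorem3 (R : realType) (n : nat) (G : alg_group R n)
  (d : nat) (rho : rat_rep G d) (Gamma0 : set (points (real_grp G)))
  (a : points (real_grp G)) (alpha : 'cV[R]_d)
  (mu : probability (borel_hspace Gamma0) R)
  (lambda : probability (borel_hspace (semidirect_lattice rho Gamma0)) R)
  (hconn : connected_group G) (hG : semisimple_group G)
  (hGamma0 : admissible_lattice rho Gamma0)
  (ha : triang_pos a)
  (hmu : ergodic mu (lact Gamma0 a))
  (hmu' : non_concentrated a mu)
  (hirr : irreducible_over_rat rho)
  (hd : (1 < d)%N)
  (hlambda : is_haar_lift mu lambda) :
  let T := lact (semidirect_lattice rho Gamma0) (a, alpha) in
  ergodic lambda T /\
  (~ unipotent (Rrep rho a) ->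
    (weakly_mixing lambda T <-> weakly_mixing mu (lact Gamma0 a)) /\
    (strongly_mixing lambda T <-> strongly_mixing mu (lact Gamma0 a))).
Proof.
move=> T; have [muE [k [kx lambdaE]]] := hlambda.
have erg : ergodic lambda T :=
  lifted_ergodic hGamma0 alpha hmu hmu' hconn hirr hd ha kx lambdaE.
have presT := erg.1; have presT0 := hmu.1.
have lift N nullN := @lifted_correlation_null _ _ _ _ _ _ hGamma0 a alpha _ _
  hmu hmu' hconn hirr hd ha muE _ kx lambdaE N nullN.
have base N := @base_correlation_null _ _ _ _ _ _ hGamma0 a alpha _ _ hmu muE N.
split=> // _; split; split=> -[_ mix]; split=> //.
- exact: (base (@mean_null R) mix).
- exact: (lift _ (weak_null_class R) mix).
- exact: (base (fun u => u @ \oo --> (0 : R)) mix).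
- exact: (lift _ (strong_null_class R) mix).
Qed.
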